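(* Let $K\subset\mathbb{R}^d$ be compact and convex, $a>0$, $b\ge1$, $\sigma>0$, and let $\mu\in\mathcal{M}_{K,a,b,\sigma}$. Assume $m\le\frac12$. Then for all integers $n\ge\frac1m$, $$\mathbb{E}\left[\sup_{x,y\in K}\left|D_\mu(x,y)-D_{\hat\mu_n}(x,y)\right|\right]\le C\,d\,\mathrm{diam}(K)^{\beta+1}\,\frac{\log(n)}{n^{\frac1{2b}}},$$ where $C$ is a constant depending on $m$, $p$, $\beta$, $a$, $b$ and $\sigma/\mathrm{diam}(K)$.
   Context: $\mathbb{R}^d$ carries the Euclidean norm $\|\cdot\|$; $B(x,r)$ is the open ball; $\mathrm{diam}(K)$ is the Euclidean diameter of $K$. Fixed real parameters: $m\in(0,1]$, $p\ge 1$, $\beta\ge 1$. For a probability measure $\mu$ on $\mathbb{R}^d$, $\delta_{\mu,u}(x)=\inf\{r>0:\mu(B(x,r))>u\}$ and the distance-to-measure is $d_\mu(x)=\left(\frac1m\int_0^m\delta_{\mu,u}(x)^p\,du\right)^{1/p}$. A rectifiable path is a continuous $\gamma:[0,1]\to\mathbb{R}^d$ of finite Euclidean length $|\gamma|=\int_0^1\|\dot\gamma(t)\|\,dt$, parametrized so as to be Lipschitz (always possible, e.g. with constant speed). Its FDTM length is $D_\mu(\gamma)=\int_0^1 d_\mu(\gamma(t))^\beta\|\dot\gamma(t)\|\,dt$. For a closed set $F\subset\mathbb{R}^d$ (the domain) and $x,y\in\mathbb{R}^d$, $\Gamma_F(x,y)$ is the set of rectifiable paths $\gamma$ with $\gamma(0)=x$,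 $\gamma(1)=y$ such that for every open interval $I\subset[0,1]$ with $\gamma(I)\subset\mathbb{R}^d\setminus F$ there is a unit vector $u\in\mathbb{R}^d$ with $\dot\gamma(t)=\|\dot\gamma(t)\|u$ for all $t\in I$ where $\dot\gamma$ is defined. The Fermat distance-to-measure (FDTM) is $D_{\mu,F}(x,y)=\inf_{\gamma\in\Gamma_F(x,y)}D_\mu(\gamma)$, and $D_\mu(x,y)=D_{\mu,\mathrm{supp}(\mu)}(x,y)$. $\mathcal{M}_{K,a,b,\sigma}$ is the set of probability measures $\mu$ on $\mathbb{R}^d$ such that: (i) $\mathrm{supp}(\mu)\subset K$; (ii) $\mu$ is $(a,b)$-standard: $\mu(B(x,r))\ge ar^b$ for all $x\in\mathrm{supp}(\mu)$ and $0<r\le a^{-1/b}$; (iii) $\min_{\mathbb{R}^d}d_\mu\ge\sigma$; (iv) $\mathrm{supp}(\mu)$ is connected. $X_1,\dots,X_n$ are i.i.d. with law $\mu$, $\hat\mu_n=\frac1n\sum_{k=1}^n\delta_{X_k}$ is the empirical measure ($\delta_{X_k}$ denoting Dirac masses here), so $D_{\hat\mu_n}=D_{\hat\mu_n,\{X_1,\dots,X_n\}}$.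
   Formalization: The constant C depends on a through the scale-free quantity a·diam(K)^b (with m, p, β, b, σ/diam(K)); with C a function of the bare a, uniformly over all K, the claim fails under rescaling of K. For diam(K)=1 it is as printed. *)

(* Defs.v *)
From HB Require Import structures.
From mathcomp Require Import all_boot all_order all_algebra.
From mathcomp Require Import all_classical all_reals all_analysis.

Set Implicit Arguments.
Unset Strict Implicit.
Unset Printing Implicit Defensive.

Import Order.TTheory GRing.Theory Num.Theory.
Import numFieldNormedType.Exports.

Local Open Scope classical_set_scope.
Local Open Scope ring_scope.

(* The library norm on 'rV_d is the sup norm.  It induces the same topology, so
   open, closed, compact, connected and the derivative are the library's, but
   every metric quantity below uses [enorm]. *)
Definition enorm (R : realType) (d : nat) (x : 'rV[R]_d) : R :=
  Num.sqrt (\sum_(i < d) x ord0 i ^+ 2).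

Definition eball (R : realType) (d : nat) (x : 'rV[R]_d) (r : R)
  : set 'rV[R]_d := [set y | enorm (x - y) < r].

Definition diam (R : realType) (d : nat) (K : set 'rV[R]_d) : R :=
  sup [set enorm (x - y) | x in K & y in K].

Definition borelE (R : realType) (d : nat) :=
  g_sigma_algebraType (@open 'rV[R]_d).

Definition supp (R : realType) (d : nat)
    (mu : {measure set (borelE R d) -> \bar R}) : set 'rV[R]_d :=
  [set x | forall r : R, 0 < r -> (0 < mu (eball x r))%E].

(* The value is +oo when no ball centred at x has mass > u. *)
Definition delta (R : realType) (d : nat)
    (mu : {measure set (borelE R d) -> \bar R}) (u : R) (x : 'rV[R]_d)
  : \bar R :=
  ereal_inf [set r%:E | r in [set r : R | 0 < r /\ (u%:E < mu (eball x r))%E]].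

Definition dtm (R : realType) (m p : R) (d : nat)
    (mu : {measure set (borelE R d) -> \bar R}) (x : 'rV[R]_d) : \bar R :=
  (((m^-1)%:E * \int[lebesgue_measure]_(u in `[0%R, m]) (delta mu u x `^ p))
     `^ p^-1)%E.

(* Lipschitz parametrization: such a gamma is continuous, differentiable almost
   everywhere and of finite length.  Only the restriction to [0, 1] matters. *)
Definition rectifiable (R : realType) (d : nat) (gamma : R -> 'rV[R]_d) : Prop :=
  exists L : R, forall s t : R, s \in `[0, 1] -> t \in `[0, 1] ->
    enorm (gamma s - gamma t) <= L * `|s - t|.

(* derive1 gamma takes a junk value on the null set where gamma is not
   differentiable. *)
Definition fdtm_length (R : realType) (m p beta : R) (d : nat)
    (mu : {measure set (borelE R d) -> \bar R}) (gamma : R -> 'rV[R]_d)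
  : \bar R :=
  (\int[lebesgue_measure]_(t in `[0%R, 1%R])
     (dtm m p mu (gamma t) `^ beta * (enorm (derive1 gamma t))%:E))%E.

Definition admissible (R : realType) (d : nat) (F : set 'rV[R]_d)
    (x y : 'rV[R]_d) : set (R -> 'rV[R]_d) :=
  [set gamma | [/\ rectifiable gamma, gamma 0 = x, gamma 1 = y &
     forall s1 s2 : R, 0 <= s1 -> s1 < s2 -> s2 <= 1 ->
       (forall t, t \in `]s1, s2[ -> ~ F (gamma t)) ->
       exists u : 'rV[R]_d, enorm u = 1 /\
         forall t, t \in `]s1, s2[ -> derivable gamma t 1 ->
           derive1 gamma t = enorm (derive1 gamma t) *: u]].

Definition fdtm_on (R : realType) (m p beta : R) (d : nat)
    (mu : {measure set (borelE R d) -> \bar R}) (F : set 'rV[R]_d)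
    (x y : 'rV[R]_d) : \bar R :=
  ereal_inf [set fdtm_length m p beta mu gamma | gamma in admissible F x y].

Definition fdtm (R : realType) (m p beta : R) (d : nat)
    (mu : {measure set (borelE R d) -> \bar R}) (x y : 'rV[R]_d) : \bar R :=
  fdtm_on m p beta mu (supp mu) x y.

(* a has the dimension of length^-b; its scale-free form is a * diam K `^ b. *)
Definition standard (R : realType) (a b : R) (d : nat)
    (mu : {measure set (borelE R d) -> \bar R}) : Prop :=
  forall (x : 'rV[R]_d) (r : R), supp mu x -> 0 < r -> r <= a `^ (- b^-1) ->
    ((a * r `^ b)%:E <= mu (eball x r))%E.

Definition model (R : realType) (m p : R) (d : nat) (K : set 'rV[R]_d)
    (a b sigma : R) (mu : probability (borelE R d) R) : Prop :=
  [/\ supp mu `<=` K, standard a b mu,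
      forall x : 'rV[R]_d, (sigma%:E <= dtm m p mu x)%E
    & connected (supp mu)].

Section empirical.
Local Open Scope ereal_scope.
Context (R : realType) (d n : nat) (x : 'I_n -> 'rV[R]_d).

Definition empirical (A : set (borelE R d)) : \bar R :=
  (n%:R^-1)%:E * \sum_(k < n) \d_(x k : borelE R d) A.

Let empirical0 : empirical set0 = 0.
Proof. by rewrite /empirical big1 ?mule0// => k _; rewrite measure0. Qed.

Let empirical_ge0 A : 0 <= empirical A.
Proof. by rewrite mule_ge0 ?lee_fin ?invr_ge0// sume_ge0. Qed.

Let empirical_sigma_additive : semi_sigma_additive empirical.
Proof.
move=> F mF tF mUF; rewrite [X in _ --> X](_ : _ =
    lim ((fun N => \sum_(0 <= i < N) empirical (F i)) @ \oo)).
  by apply: is_cvg_ereal_nneg_natsum => k _; exact: empirical_ge0.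
rewrite nneseriesZl; last by move=> i _; exact: sume_ge0.
rewrite nneseries_sum//; congr (_ * _); apply: eq_bigr => /= i _.
exact: measure_semi_bigcup.
Qed.

HB.instance Definition _ := isMeasure.Build _ _ _ empirical
  empirical0 empirical_ge0 empirical_sigma_additive.

End empirical.

Definition mutually_independent (R : realType) (dO : measure_display)
    (Omega : measurableType dO) (P : probability Omega R)
    (dE : measure_display) (E : measurableType dE) (n : nat)
    (X : 'I_n -> {RV P >-> E}) : Prop :=
  forall (J : {set 'I_n}) (A : 'I_n -> set E),
    (forall i, measurable (A i)) ->
    P (\bigcap_(i in [set` J]) (X i @^-1` A i)) =
    (\prod_(i in J) P (X i @^-1` A i))%E.

Definition iid_sample (R : realType) (dO : measure_display)
    (Omega : measurableType dO) (P : probability Omega R)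
    (d n : nat) (mu : probability (borelE R d) R)
    (X : 'I_n -> {RV P >-> borelE R d}) : Prop :=
  mutually_independent X /\
  forall (i : 'I_n) (A : set (borelE R d)), measurable A ->
    distribution P (X i) A = mu A.

(* Main.v *)
(* Write F for the support of mu, D for the diameter of K, and psi for
   (d ^ 2 * ln n / n) to the power 1 / (2 b).

   A path which is straight off F can be replaced by one which is straight off
   a finite subset G of F, provided every point of F is within
   h = O(psi ^ 2 * D) of G: move along the path by steps of length about
   psi * D, replace each step by a segment joining nearby points of G, and keep
   the long straight pieces, whose end points are moved by at most h.  As the
   weight is Lipschitz and bounded below, every step costs a factor 1 + O(psi),
   and so does every long piece, since h is O(psi) times its length.

   If |mu - nu| <= t on a net of balls, connectedness of F and standardness give
   that the two functions delta differ by O((t / a) to the power 1 / b), hence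
   so do the two distances to measure, by Minkowski's inequality.  Chernoff's
   bound and a union bound over a net of n to the O(d ^ 2) balls allow
   t = O(sqrt (d ^ 2 * ln n / n)), and no hole of mass O(d ^ 2 * ln n / n)
   remains around F, except on an event of probability O(psi), where both
   distances are still at most D ^ (beta + 1).

   The supremum is not known to be a measurable function of the sample; only
   monotonicity of the integral of nonnegative functions is used for it. *)

Require Import Defs.
From HB Require Import structures.
From mathcomp Require Import all_boot all_order all_algebra.
From mathcomp Require Import all_classical all_reals all_analysis.
From mathcomp Require Import measurable_realfun ring lra.

Set Implicit Arguments.
Unset Strict Implicit.
Unset Printing Implicit Defensive.

Import Order.TTheory GRing.Theory Num.Theory.
Import numFieldNormedType.Exports.
Local Open Scope classical_set_scope.
Local Open Scope ring_scope.

(** * The fundamental theorem of calculus for Lipschitz functions *)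

(** Lengths and straightness are defined through [derive1], whereas the surgery on paths handles
    increments. Lipschitz functions are therefore first recovered from their almost everywhere
    derivatives, and every length is read through a measurable integrand.

    The times at which a path meets the support may form any closed set, so the path need not split
    into finitely many straight pieces. The surgery goes by exit times from balls of radius [ell], a
    gap off the support being crossed as a whole. Only one of the two inequalities needs it: the
    sample lies in the support almost surely, so a path straight off the sample is straight off the
    support.

    Two powers of psi occur because holes and fluctuations differ. With q for d ^ 2 * ln n / n, a
    ball of mass of order q is missed with probability exponentially small in n * q, while masses
    fluctuate by the order of sqrt q; by standardness the radii with these masses are of order psi ^
    2 * D and psi * D. Each short step gains length 2 * h, so the relative error h / ell is of order
    psi when ell is psi * D. *)

Section lipschitz_real.
Variable R : realType.
Notation lambda := (@lebesgue_measure R).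

Lemma lipschitz_continuous (f : R -> R) (L : R) :
  (forall s t, `|f s - f t| <= L * `|s - t|) -> continuous f.
Proof.
move=> fL x; apply/cvgrPdist_le => e e0.
have L0 : 0 <= L.
  by have := fL 1 0; rewrite subr0 normr1 mulr1; exact/le_trans.
near=> y.
apply: (le_trans (fL _ _)).
have xy : `|x - y| <= e / (L + 1).
  near: y; apply: cvgr_dist_le; first exact: cvg_id.
  by rewrite divr_gt0// ltr_wpDl.
have := ler_pM L0 (normr_ge0 _) (lexx L) xy; move/le_trans; apply.
rewrite mulrA ler_pdivrMr ?ltr_wpDl// mulrDr mulr1 mulrC lerDl ltW//.
Unshelve. all: by end_near. Qed.

Lemma nondecreasing_addlip (f : R -> R) (L : R) :
  (forall s t, `|f s - f t| <= L * `|s - t|) ->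
  nondecreasing (fun x => L * x + f x).
Proof.
move=> fL x y xy; have := fL x y.
rewrite ler_norml => /andP[h1 h2].
move: h1 h2; rewrite distrC ger0_norm ?subr_ge0// => h1 h2; lra.
Qed.

Section addlip.
Variables (f : R -> R) (L : R).
Hypothesis fL : forall s t, `|f s - f t| <= L * `|s - t|.
(** Taking the Lipschitz bound as an argument lets the cumulative structure be inferred from the
    term [addlip fL] alone. *)
Definition addlip of (forall s t, `|f s - f t| <= L * `|s - t|) :=
  fun x => L * x + f x.

Lemma addlip_rc : right_continuous (addlip fL).
Proof.
apply: right_continuousW => x; apply: cvgD; last exact: lipschitz_continuous fL _.
by apply: cvgMl_tmp; exact: cvg_id.
Qed.

HB.instance Definition _ := @isCumulative.Build R _ R
  (addlip fL) (nondecreasing_addlip fL) addlip_rc.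
End addlip.

Lemma lebesgue_stieltjes_itvoc (f : cumulative R R) (a b : R) : a <= b ->
  lebesgue_stieltjes_measure f `]a, b]%classic = (f b - f a)%:E.
Proof.
move=> ab; rewrite /lebesgue_stieltjes_measure/= /measure_extension/=.
rewrite measurable_mu_extE/=; last exact: is_ocitv.
by rewrite wlength_itv_bnd// EFinB.
Qed.

(** The Stieltjes measures of [L * x + f x] and [L * x - f x] add up to [2 * L] times Lebesgue
    measure. Both are nonnegative, so a Lebesgue null set is null for each. *)
Lemma LS_addlip_dominates (f : R -> R) (L : R)
    (fL : forall s t, `|f s - f t| <= L * `|s - t|) (A : set R) :
  measurable A -> lambda A = 0%E ->
  lebesgue_stieltjes_measure (addlip fL) A = 0%E.
Proof.
move=> mA lA.
have gL (s t : R) : `|- f s - - f t| <= L * `|s - t|.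
  by rewrite -opprD normrN; exact: fL.
(* The zero function, seen as [2 * L]-Lipschitz, presents [2 * L] times Lebesgue measure as a
   measure of the same form, determined by its values on half-open intervals. *)
have zL (s t : R) : `|(fun=> 0 : R) s - (fun=> 0 : R) t| <= (2 * L) * `|s - t|.
  rewrite /= subrr normr0 -mulrA mulr_ge0//.
  exact: le_trans (normr_ge0 _) (fL s t).

have L0 : 0 <= L.
  by have := fL 1 0; rewrite subr0 normr1 mulr1; exact/le_trans.
pose nu1 := lebesgue_stieltjes_measure (addlip fL).
pose nu2 := lebesgue_stieltjes_measure (addlip gL).
have nuE (B : set R) : measurable B ->
    (nu1 B + nu2 B = (2 * L)%:E * lambda B)%E.
  move=> mB.
  have -> : ((2 * L)%:E * lambda B)%E = lebesgue_stieltjes_measure (addlip zL) B.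
    have := @lebesgue_stieltjes_measure_unique _ (addlip zL)
      (mscale (NngNum (mulr_ge0 (ler0n R 2) L0)) lambda).
    move=> -> //= X /ocitvP[->|[[a b] /= ab ->]]; first by rewrite !measure0.
    rewrite /mscale/= lebesgue_measure_itv/= lte_fin ab.
    rewrite lebesgue_stieltjes_itvoc ?ltW//.
    by rewrite -EFinB -EFinM /= /addlip; congr EFin; lra.
  have -> : lebesgue_stieltjes_measure (addlip zL) B = measure_add nu1 nu2 B.
    apply: lebesgue_stieltjes_measure_unique mB => X.
    move=> /ocitvP[->|[[a b] /= ab ->]]; first by rewrite !measure0.
    rewrite [RHS]measure_addE /= /nu1 /nu2 !lebesgue_stieltjes_itvoc ?ltW//.
    by rewrite -EFinD /= /addlip; congr EFin; lra.
  by rewrite measure_addE.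
have := nuE _ mA; rewrite lA mule0 => /eqP.
by rewrite padde_eq0 ?measure_ge0// => /andP[/eqP].
Qed.

(** Adding [L * x] makes the function nondecreasing. Its Stieltjes measure is absolutely continuous,
    hence has a Radon-Nikodym density, which Lebesgue differentiation identifies almost everywhere
    with the derivative. *)
Lemma lipschitz_ftc_global (phi : R -> R) (L : R) :
  (forall s t, `|phi s - phi t| <= L * `|s - t|) ->
  exists k : R -> R, exists N : set R,
  [/\ measurable_fun setT k, measurable N, lambda N = 0%E,
      (forall t, t \in `]0, 1[ -> ~ N t ->
         derivable phi t 1 /\ derive1 phi t = k t) &
      forall s t, 0 <= s -> s <= t -> t <= 1 ->
        lambda.-integrable `[s, t] (EFin \o k) /\
        phi t - phi s = \int[lambda]_(x in `[s, t]) k x].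
Proof.
move=> pL.
pose LS := lebesgue_stieltjes_measure (addlip pL).
have mI : @measurable _ (measurableTypeR R) (`]0, 1]%classic : set R).
  exact: measurable_itv.
have LSoo : (LS `]0%R, 1%R]%classic < +oo)%E.
  by rewrite /LS lebesgue_stieltjes_itvoc// ltry.
(* The restriction to []0, 1]] is finite and has no mass before 0, so that integrals from -oo to [t]
   give the increments from 0 to [t]. *)
pose nu := mfrestr mI LSoo.
have dom : nu `<< lambda.
  apply/null_content_dominatesP => A mA lA.
  rewrite /nu /mfrestr /mrestr; apply: LS_addlip_dominates.
    exact: measurableI.
  by apply/eqP; rewrite -measure_le0 -lA le_measure ?inE//; exact: measurableI.
have [h0 [h00 h0fin inth0 h0E]] := radon_nikodym_sigma_finite dom.
pose h : R -> R := fun x => fine (h0 x).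
have hE : EFin \o h = h0.
  by apply/funext => x; rewrite /h /= fineK.
have inth : lambda.-integrable [set: R] (EFin \o h).
  rewrite hE. exact: inth0.
have mh : measurable_fun setT h.
  by apply/measurable_EFinP; exact: measurable_int inth.
have F0E t : 0 <= t -> t <= 1 ->
    \int[lambda]_(x in `]-oo, t]) h x = addlip pL t - addlip pL 0.
  move=> t0 t1; rewrite /Rintegral.
  have -> : (\int[lambda]_(x in `]-oo, t]) (h x)%:E = nu `]-oo, t]%classic)%E.
    have -> : nu `]-oo, t]%classic = (\int[lambda]_(x in `]-oo, t]) h0 x)%E.
      exact: (h0E _ (measurable_itv _)).
    by apply: eq_integral => x _; rewrite -hE.
  rewrite /nu /mfrestr /mrestr.
  have -> : `]-oo, t]%classic `&` `]0, 1]%classic = (`]0, t]%classic : set R).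
    apply/seteqP; split => x /=; rewrite !in_itv/=.
      by move=> [-> /andP[->]].
    by move=> /andP[-> xt]; split => //; exact: le_trans t1.
  by rewrite /LS (lebesgue_stieltjes_itvoc _ t0).
have inthS (i : interval R) : lambda.-integrable [set` i] (EFin \o h).
  by apply: integrableS inth => //; exact: measurable_itv.
have := FTC1Ny (fun y => inthS `]-oo, y]) (open_integrable_locally openT inth).
move=> [N [mN N0 sN]].
exists (fun x => h x - L); exists N; split => //.
- by apply: measurable_funB.
- move=> t t01 Nt.
  have [dF F't] : derivable (fun x : R => \int[lambda]_(t in `]-oo, x]) h t) t 1
     /\ derive1 (fun x : R => \int[lambda]_(t in `]-oo, x]) h t) t = h t.
    by apply: contrapT => nd; apply: Nt; apply: sN => /=.
  pose G := (fun x : R => \int[lambda]_(t in `]-oo, x]) h t) - ( *%R L) + cst (addlip pL 0).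
  have nearG : {near t, G =1 phi}.
    near=> x.
    have /andP[x0 x1] : 0 < x < 1.
      have : x \in `]0, 1[ by near: x; exact: near_in_itvoo.
      by rewrite in_itv.
    rewrite /G !fctE F0E ?ltW// /addlip; lra.
  have dL : is_derive t 1 ( *%R L) L.
    have -> : *%R L = L *: (id : R -> R) by apply/funext => x.
    by apply: is_derive_eq; rewrite scaler1 //=.
  have dG : is_derive t 1 G (h t - L).
    have dF' : is_derive t 1 (fun x : R => \int[lambda]_(t in `]-oo, x]) h t) (h t).
      by split; [exact: dF|rewrite -derive1E; exact: F't].
    by apply: is_derive_eq; rewrite addr0.
  have dphi : is_derive t 1 phi (h t - L).
    by apply: near_eq_is_derive dG => //; rewrite oner_neq0.
  by split; [apply: ex_derive|rewrite derive1E; apply: derive_val].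
- move=> s t s0 st t1.
  have ih : lambda.-integrable `[s, t] (EFin \o h).
    exact: integrableS inth.
  have ic : lambda.-integrable `[s, t] (EFin \o (fun=> L)).
    apply/integrableP; split; first exact/measurable_EFinP.
    rewrite integral_cst//= lebesgue_measure_itv/=.
    by case: ifP; rewrite ?mule0 ?ltry// -EFinB -EFinM ltry.
  have ihc : lambda.-integrable `[s, t] (EFin \o (fun x => h x - L)).
    have -> : EFin \o (fun x => h x - L) = ((EFin \o h) \- (EFin \o (fun=> L)))%E by [].
    by apply: integrableB => //; exact: measurable_itv.
  split => //.
  rewrite RintegralB//.
  have -> : \int[lambda]_(x in `[s, t]) h x = addlip pL t - addlip pL s.
    have := F0E t (le_trans s0 st) t1.
    rewrite (_ : `]-oo, t]%classic = (`]-oo, s]%classic : set R) `|` `]s, t]%classic); last first.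
      by rewrite -itv_bndbnd_setU.
    rewrite Rintegral_setU//=; last 2 first.
    - by rewrite -itv_bndbnd_setU//; exact: inthS.
    - apply/disj_setPS => x [] /=; rewrite !in_itv/= => xs /andP[sx _].
      by move: (lt_le_trans sx xs); rewrite ltxx.
    rewrite F0E//; last exact: le_trans t1.
    rewrite Rintegral_itv_obnd_cbnd; last first.
      exact: inthS.
    lra.
  rewrite Rintegral_cst//= lebesgue_measure_itv/= lte_fin /addlip.
  case: ltP => [_|ts] /=; first lra.
  by have -> : s = t by [apply/eqP; rewrite eq_le st ts]; lra.
Unshelve. all: by end_near. Qed.

(** Composition with this projection of the line extends a function on [[0, 1]] to the whole line
    with the same Lipschitz constant. *)
Definition clamp01 (x : R) := Num.max 0 (Num.min x 1).

Lemma clamp01_id x : 0 <= x -> x <= 1 -> clamp01 x = x.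
Proof. by move=> x0 x1; rewrite /clamp01 min_l// max_r. Qed.

Lemma clamp01_ge0 x : 0 <= clamp01 x.
Proof. by rewrite /clamp01 le_max lexx. Qed.

Lemma clamp01_le1 x : clamp01 x <= 1.
Proof. by rewrite /clamp01 ge_max ler01 ge_min lexx orbT. Qed.

Lemma clamp01_lip x y : `|clamp01 x - clamp01 y| <= `|x - y|.
Proof.
have cE0 z : z <= 0 -> clamp01 z = 0.
  by move=> z0; rewrite /clamp01 min_l ?max_l// (le_trans z0).
have cE1 z : 1 <= z -> clamp01 z = 1.
  by move=> z1; rewrite /clamp01 min_r// max_r.
have [x0|x0] := leP x 0; have [x1|x1] := leP x 1;
have [y0|y0] := leP y 0; have [y1|y1] := leP y 1; try lra;
rewrite ?(cE0 _ x0) ?(cE0 _ y0) ?(cE1 _ (ltW x1)) ?(cE1 _ (ltW y1))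
  ?(clamp01_id (ltW x0) x1) ?(clamp01_id (ltW y0) y1) ler_norml;
case: (ler0P (x - y)) => ?; apply/andP; split; lra.
Qed.

Lemma lipschitz_ftc (phi : R -> R) (L : R) :
  (forall s t, s \in `[0, 1] -> t \in `[0, 1] ->
     `|phi s - phi t| <= L * `|s - t|) ->
  exists k : R -> R, exists N : set R,
  [/\ measurable_fun setT k, measurable N, lambda N = 0%E,
      (forall t, t \in `]0, 1[ -> ~ N t ->
         derivable phi t 1 /\ derive1 phi t = k t) &
      forall s t, 0 <= s -> s <= t -> t <= 1 ->
        lambda.-integrable `[s, t] (EFin \o k) /\
        phi t - phi s = \int[lambda]_(x in `[s, t]) k x].
Proof.
move=> pL.
have c01 x : clamp01 x \in `[0, 1] by rewrite in_itv/= clamp01_ge0 clamp01_le1.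
have L0 : 0 <= L.
  have := pL 1 0; rewrite !in_itv/= !lexx ler01 => /(_ isT isT).
  by rewrite subr0 normr1 mulr1; exact/le_trans.
have [k [N [mk mN N0 dk ik]]] := @lipschitz_ftc_global (phi \o clamp01) L
   (fun s t => le_trans (pL _ _ (c01 s) (c01 t)) (ler_wpM2l L0 (clamp01_lip s t))).
exists k, N; split => //.
- move=> t t01 Nt; have [dc ct] := dk t t01 Nt.
  have nE : {near t, phi \o clamp01 =1 phi}.
    near=> x; rewrite /= clamp01_id//.
    + have : x \in `]0, 1[ by near: x; exact: near_in_itvoo.
      by rewrite in_itv/= => /andP[/ltW].
    + have : x \in `]0, 1[ by near: x; exact: near_in_itvoo.
      by rewrite in_itv/= => /andP[_ /ltW].
  split; first by apply: near_eq_derivable dc.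
  by rewrite -ct !derive1E; apply/esym/near_eq_derive.
- move=> s t s0 st t1; have [i1 <-] := ik s t s0 st t1; split => //=.
  by rewrite !clamp01_id// ?(le_trans s0)// (le_trans st).
Unshelve. all: by end_near. Qed.

End lipschitz_real.

(** * Euclidean norm and rectifiable paths *)

Section euclid.
Variables (R : realType) (d : nat).
Implicit Types x y z : 'rV[R]_d.

Definition dotv x y : R := \sum_(i < d) x ord0 i * y ord0 i.

Lemma dotvC x y : dotv x y = dotv y x.
Proof. by apply: eq_bigr => i _; rewrite mulrC. Qed.

Lemma dotvDl x y z : dotv (x + y) z = dotv x z + dotv y z.
Proof. by rewrite -big_split; apply: eq_bigr => i _; rewrite mxE mulrDl. Qed.

Lemma dotvDr x y z : dotv x (y + z) = dotv x y + dotv x z.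
Proof. by rewrite dotvC dotvDl !(dotvC x). Qed.

Lemma dotvZl a x y : dotv (a *: x) y = a * dotv x y.
Proof. by rewrite mulr_sumr; apply: eq_bigr => i _; rewrite mxE mulrA. Qed.

Lemma dotvZr a x y : dotv x (a *: y) = a * dotv x y.
Proof. by rewrite dotvC dotvZl dotvC. Qed.

Lemma dotvNl x y : dotv (- x) y = - dotv x y.
Proof. by rewrite -scaleN1r dotvZl mulN1r. Qed.

Lemma dotvNr x y : dotv x (- y) = - dotv x y.
Proof. by rewrite dotvC dotvNl dotvC. Qed.

Lemma dotvBl x y z : dotv (x - y) z = dotv x z - dotv y z.
Proof. by rewrite dotvDl dotvNl. Qed.

Lemma dotvBr x y z : dotv x (y - z) = dotv x y - dotv x z.
Proof. by rewrite dotvDr dotvNr. Qed.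

Lemma dotvv_ge0 x : 0 <= dotv x x.
Proof. by apply: sumr_ge0 => i _; rewrite -expr2 sqr_ge0. Qed.

Lemma dotvv_eq0 x : dotv x x = 0 -> x = 0.
Proof.
move=> /eqP; rewrite psumr_eq0 => [/allP h|i _]; last by rewrite -expr2 sqr_ge0.
apply/rowP => i; rewrite mxE; have := h i (mem_index_enum _).
by rewrite /= -expr2 sqrf_eq0 => /eqP.
Qed.

Lemma enormE x : enorm x = Num.sqrt (dotv x x).
Proof. by congr Num.sqrt; apply: eq_bigr => i _; rewrite expr2. Qed.

Lemma enorm_ge0 x : 0 <= enorm x. Proof. exact: sqrtr_ge0. Qed.

Lemma enorm_sqr x : enorm x ^+ 2 = dotv x x.
Proof. by rewrite enormE sqr_sqrtr// dotvv_ge0. Qed.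

Lemma enorm0 : enorm (0 : 'rV[R]_d) = 0.
Proof. by rewrite enormE -(scale0r 0) dotvZl mul0r sqrtr0. Qed.

Lemma enorm_eq0 x : (enorm x == 0) = (x == 0).
Proof.
apply/idP/eqP => [/eqP h|->]; last by rewrite enorm0.
by apply: dotvv_eq0; rewrite -enorm_sqr h expr0n.
Qed.

Lemma enorm_gt0 x : (0 < enorm x) = (x != 0).
Proof. by rewrite lt_neqAle enorm_ge0 andbT eq_sym enorm_eq0. Qed.

Lemma enormZ a x : enorm (a *: x) = `|a| * enorm x.
Proof.
by rewrite !enormE dotvZl dotvZr mulrA -expr2 sqrtrM ?sqr_ge0// sqrtr_sqr.
Qed.

Lemma enormN x : enorm (- x) = enorm x.
Proof. by rewrite -scaleN1r enormZ normrN normr1 mul1r. Qed.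

Lemma enormB x y : enorm (x - y) = enorm (y - x).
Proof. by rewrite -enormN opprB. Qed.

Lemma dotv_le x y : dotv x y <= enorm x * enorm y.
Proof.
have [->|y0] := eqVneq y 0.
  by rewrite enorm0 mulr0 -(scale0r 0) dotvZr mul0r.
have yy : 0 < enorm y by rewrite enorm_gt0.
have := dotvv_ge0 ((enorm y ^+ 2) *: x - (dotv x y) *: y).
rewrite dotvBl !dotvBr !dotvZl !dotvZr (dotvC y x) -!enorm_sqr.
set a := enorm x; set b := enorm y; set c := dotv x y => h.
have h2 : 0 <= b ^+ 2 * ((a * b) ^+ 2 - c ^+ 2).
  by apply: le_trans h _; rewrite le_eqVlt; apply/orP; left; apply/eqP; ring.
rewrite pmulr_rge0 ?exprn_gt0// subr_ge0 in h2.
apply: (le_trans (ler_norm _)).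
by rewrite -ler_sqr ?nnegrE ?mulr_ge0 ?enorm_ge0// real_normK// num_real.
Qed.

Lemma enormD x y : enorm (x + y) <= enorm x + enorm y.
Proof.
rewrite -ler_sqr ?nnegrE ?addr_ge0 ?enorm_ge0// enorm_sqr dotvDl !dotvDr.
rewrite sqrrD !enorm_sqr (dotvC y x); have := dotv_le x y; lra.
Qed.

Lemma enorm_dist z x y : enorm (x - y) <= enorm (x - z) + enorm (z - y).
Proof. by rewrite -{1}(subrK z x) -addrA; apply: enormD. Qed.

Lemma enorm_distr x y : enorm x - enorm y <= enorm (x - y).
Proof. by rewrite lerBlDr -{1}(subrK y x) enormD. Qed.

Lemma coord_le_enorm x i : `|x ord0 i| <= enorm x.
Proof.
rewrite -sqrtr_sqr ler_sqrt; last by apply: sumr_ge0 => j _; exact: sqr_ge0.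
by rewrite (bigD1 i)//= lerDl; apply: sumr_ge0 => j _; exact: sqr_ge0.
Qed.

Lemma enorm_le_sum x : enorm x <= \sum_(i < d) `|x ord0 i|.
Proof.
rewrite -ler_sqr ?nnegrE ?enorm_ge0 ?sumr_ge0// enorm_sqr expr2 mulr_suml.
apply: ler_sum => i _; rewrite (le_trans (ler_norm _))// normrM.
by apply: ler_wpM2l => //; rewrite (bigD1 i)//= lerDl sumr_ge0.
Qed.

Lemma enorm_le_norm x : enorm x <= d%:R * `|x|.
Proof.
apply: le_trans (enorm_le_sum x) _.
have -> : d%:R * `|x| = \sum_(i < d) `|x| by rewrite sumr_const card_ord mulr_natl.
by apply: ler_sum => i _; rewrite [leRHS]/Num.norm /= mx_normrE; apply/bigmax_geP; right => /=; exists (ord0, i).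
Qed.

Lemma norm_le_enorm x : `|x| <= enorm x.
Proof.
rewrite [leLHS]/Num.norm /= mx_normrE; apply/bigmax_leP; split => [|[i j] _ /=]; first exact: enorm_ge0.
by rewrite (ord1 i) coord_le_enorm.
Qed.

Lemma enorm_continuous : continuous (@enorm R d).
Proof.
move=> x; apply/(@cvgrPdist_le _ _ _ _ (nbhs_filter x)) => e e0; apply/nbhs_ballP.
have d0 : 0 <= d%:R :> R by [].
exists (e / (d%:R + 1)) => /=; first by rewrite divr_gt0// ltr_wpDl.
move=> y; rewrite -ball_normE/= => xy.
have : enorm (x - y) <= e.
  apply: le_trans (enorm_le_norm _) _.
  have : `|x - y| * (d%:R + 1) < e by rewrite -ltr_pdivlMr ?ltr_wpDl.
  have := normr_ge0 (x - y); nra.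
have := enorm_distr x y; have := enorm_distr y x; rewrite (enormB y).
by move=> h1 h2 h3; rewrite ler_norml; apply/andP; split; lra.
Qed.

Lemma open_enormP (A : set 'rV[R]_d) : open A <->
  forall x, A x -> exists2 r, 0 < r & forall y, enorm (x - y) < r -> A y.
Proof.
split => [oA x Ax|h].
  have /nbhs_ballP[r r0 sA] : nbhs x A by exact: open_nbhs_nbhs.
  exists r => // y xy; apply: sA.
  by rewrite -ball_normE/=; apply: le_lt_trans (norm_le_enorm _) xy.
rewrite openE => x /h[r r0 sA]; apply/nbhs_ballP.
exists (r / (d%:R + 1)) => /=; first by rewrite divr_gt0// ltr_wpDl.
move=> y; rewrite -ball_normE/= => xy; apply: sA.
apply: le_lt_trans (enorm_le_norm _) _.
have d0 : 0 <= d%:R :> R by [].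
have : `|x - y| * (d%:R + 1) < r by rewrite -ltr_pdivlMr ?ltr_wpDl.
have := normr_ge0 (x - y); nra.
Qed.

Lemma open_eball x r : open (eball x r).
Proof.
apply/open_enormP => y; rewrite /eball/= => xy; exists (r - enorm (x - y)).
  by rewrite subr_gt0.
by move=> z yz; have := enorm_dist y x z; lra.
Qed.

End euclid.

Section union_bound.
Context dd (T : measurableType dd) (R : realType) (mu : {measure set T -> \bar R}).

Lemma measure_bigsetU_le (I : Type) (s : seq I) (F : I -> set T) :
  (forall i, measurable (F i)) ->
  (mu (\big[setU/set0]_(i <- s) F i) <= \sum_(i <- s) mu (F i))%E.
Proof.
move=> mF; elim: s => [|i s ih]; first by rewrite !big_nil measure0.
rewrite !big_cons; apply: le_trans (leeD2l _ ih).
by apply: measureU2 => //; apply: bigsetU_measurable => j _.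
Qed.

Lemma measure0_setU (A B : set T) : measurable A -> measurable B ->
  mu A = 0%E -> mu B = 0%E -> mu (A `|` B) = 0%E.
Proof.
move=> mA mB A0 B0; apply/eqP; rewrite -measure_le0.
have : (mu (A `|` B) <= mu A + mu B)%E by exact: measureU2.
by rewrite A0 B0 adde0.
Qed.

End union_bound.

(** * Speed and increments of rectifiable paths *)

Section paths.
Variables (R : realType).
Notation lambda := (@lebesgue_measure R).

(** The increment is the integral of the almost everywhere derivative; passing to its positive part
    reduces the claim to a comparison of nonnegative integrands. *)
Lemma lipschitz_incr_le (phi : R -> R) (L : R) (N : set R) (g : R -> R) (s t : R) :
  (forall s t, s \in `[0, 1] -> t \in `[0, 1] ->
     `|phi s - phi t| <= L * `|s - t|) ->
  measurable N -> lambda N = 0%E ->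
  measurable_fun setT g -> (forall r, 0 <= g r) ->
  0 <= s -> s <= t -> t <= 1 ->
  (forall r, r \in `]s, t[ -> ~ N r -> derivable phi r 1 -> derive1 phi r <= g r) ->
  ((phi t - phi s)%:E <= \int[lambda]_(r in `[s, t]) (g r)%:E)%E.
Proof.
move=> pL mN N0 mg g0 s0 st t1 dg.
have [k [N' [mk mN' N'0 dk ik]]] := lipschitz_ftc pL.
have [ink ->] := ik s t s0 st t1.
rewrite /Rintegral fineK; last by apply: integrable_fin_num => //; exact: measurable_itv.
have mst : measurable (`[s, t] : set R) by [].
have mkE : measurable_fun `[s, t] (EFin \o k) by exact: measurable_int ink.
apply: (@le_trans _ _ (\int[lambda]_(r in `[s, t]) ((EFin \o k)^\+ r))%E).
  by rewrite integralE leeBlDr ?leeDl ?integral_ge0//;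
    apply: integrable_neg_fin_num.
apply: ae_ge0_le_integral => //.
- exact: measurable_funepos.
- by move=> x _; rewrite lee_fin.
- exact/measurable_EFinP/measurable_funTS.
exists (N `|` N' `|` [set s] `|` [set t]); split.
- by do 3 (apply: measurableU; last exact: measurable_set1 || exact: mN').
- have l1 x : lambda [set x] = 0%E by exact: lebesgue_measure_set1.
  apply: measure0_setU (l1 t) => //.
    by apply: measurableU; [exact: measurableU|exact: measurable_set1].
  apply: measure0_setU (l1 s) => //; first exact: measurableU.
  exact: measure0_setU.
move=> r /= nh; apply: contrapT => nr; apply: nh => rst.
have rs : r != s by apply/eqP => rs; apply: nr; left; right.
have rt : r != t by apply/eqP => rt; apply: nr; right.
have Nr : ~ N r by move=> Nr; apply: nr; left; left; left.
have Nr' : ~ N' r by move=> Nr'; apply: nr; left; left; right.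
have /andP[sr tr] : s < r < t.
  by move: rst; rewrite in_itv/= !le_eqVlt (eq_sym s) (negbTE rs) (negbTE rt).
have [dp ke] := dk r ltac:(by rewrite in_itv/= (le_lt_trans s0 sr) (lt_le_trans tr t1)) Nr'.
rewrite funeposE /= -EFin_max lee_fin ge_max g0 andbT -ke.
by apply: dg => //; rewrite in_itv/= sr tr.
Qed.

Variable d : nat.
Implicit Types gamma : R -> 'rV[R]_d.

Lemma derivable_coord gamma t i : derivable gamma t 1 ->
  derivable (fun x => gamma x ord0 i) t 1.
Proof. by move/derivable_mxP. Qed.

Lemma derive1_coord gamma t i : derivable gamma t 1 ->
  derive1 (fun x => gamma x ord0 i) t = derive1 gamma t ord0 i.
Proof. by move=> dg; rewrite !derive1E derive_mx// mxE. Qed.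

Lemma is_derive_dotv gamma (e : 'rV[R]_d) t : derivable gamma t 1 ->
  is_derive t (1 : R) (fun x => dotv e (gamma x)) (dotv e (derive1 gamma t)).
Proof.
move=> dg.
have -> : (fun x => dotv e (gamma x)) =
    \sum_(i < d) (fun x => e ord0 i * gamma x ord0 i).
  by apply/funext => x; rewrite fct_sumE.
apply: is_derive_sum => i.
have h : is_derive t (1:R) (fun x => gamma x ord0 i) (derive1 gamma t ord0 i).
  split; first exact: derivable_coord.
  by rewrite -derive1E derive1_coord.
have -> : (fun x => e ord0 i * gamma x ord0 i) = e ord0 i *: (fun x => gamma x ord0 i).
  by [].
exact: is_deriveZ.
Qed.

Lemma path_incr_le gamma (N : set R) (e : 'rV[R]_d) (g : R -> R) (s t : R) :
  rectifiable gamma ->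
  measurable N -> lambda N = 0%E ->
  (forall r, r \in `]0, 1[ -> ~ N r -> derivable gamma r 1) ->
  measurable_fun setT g -> (forall r, 0 <= g r) ->
  0 <= s -> s <= t -> t <= 1 ->
  (forall r, r \in `]s, t[ -> ~ N r -> derivable gamma r 1 ->
     dotv e (derive1 gamma r) <= g r) ->
  ((dotv e (gamma t - gamma s))%:E <= \int[lambda]_(r in `[s, t]) (g r)%:E)%E.
Proof.
move=> [L gL] mN N0 dN mg g0 s0 st t1 h; rewrite dotvBr.
apply: (@lipschitz_incr_le (fun x => dotv e (gamma x)) (enorm e * L) N) => //.
- move=> x y x01 y01; rewrite -dotvBr -mulrA ler_norml; apply/andP; split.
    rewrite lerNl -dotvNr; apply: (le_trans (dotv_le _ _)).
    by rewrite enormN ler_wpM2l ?enorm_ge0// gL.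
  by apply: (le_trans (dotv_le _ _)); rewrite ler_wpM2l ?enorm_ge0// gL.
- move=> r rst Nr _; have dg : derivable gamma r 1.
    apply: dN => //; move: rst; rewrite !in_itv/= => /andP[sr rt].
    by rewrite (le_lt_trans s0 sr) (lt_le_trans rt t1).
  have dd := is_derive_dotv e dg.
  by rewrite derive1E derive_val; exact: h.
Qed.

(** [v] is a measurable version of the speed, built from the densities of the coordinates. It is 0
    on [N], hence below [enorm (derive1 gamma t)] even where the latter is a junk value; [N]
    contains 0 and 1 so that claims off [N] extend to the closed interval. *)
Lemma path_speed gamma : rectifiable gamma ->
  exists v : R -> R, exists N : set R,
  [/\ measurable_fun setT v /\ (forall t, 0 <= v t), measurable N, lambda N = 0%E,
      [/\ forall t, N t -> v t = 0, N 0 & N 1] &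
      forall t, t \in `]0, 1[ -> ~ N t ->
        derivable gamma t 1 /\ v t = enorm (derive1 gamma t)].
Proof.
move=> [L gL].
have cL i s t : s \in `[0, 1] -> t \in `[0, 1] ->
    `|gamma s ord0 i - gamma t ord0 i| <= L * `|s - t|.
  move=> s01 t01; apply: le_trans (gL s t s01 t01).
  by have := coord_le_enorm (gamma s - gamma t) i; rewrite !mxE.
have H i := lipschitz_ftc (@cL i).
have [k Hk] := choice H; have {H Hk} [N Hk] := choice Hk.
pose NN := \big[setU/set0]_(i < d) N i `|` [set 0] `|` [set 1].
have mNi i : measurable (N i) by case: (Hk i).
have mU : measurable (\big[setU/set0]_(i < d) N i).
  by apply: bigsetU_measurable => i _.
have mU0 : measurable (\big[setU/set0]_(i < d) N i `|` [set 0]).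
  by apply: measurableU => //; exact: measurable_set1.
have mNN : measurable NN by apply: measurableU => //; exact: measurable_set1.
have NN0 : lambda NN = 0%E.
  have l1 x : lambda [set x] = 0%E by exact: lebesgue_measure_set1.
  apply: measure0_setU (l1 1) => //; apply: measure0_setU (l1 0) => //.
  apply/eqP; rewrite -measure_le0.
  apply: (le_trans (measure_bigsetU_le _ _ _)) => //.
  by rewrite big1// => i _; case: (Hk i).
have notN t i : ~ NN t -> ~ N i t.
  by move=> nN Ni; apply: nN; left; left; rewrite (bigD1 i)//=; left.
exists (fun t => Num.sqrt (\sum_(i < d) k i t ^+ 2) * \1_(~` NN) t); exists NN.
split => //.
- split; last by move=> t; rewrite mulr_ge0// sqrtr_ge0.
  apply: measurable_funM; last exact/measurable_indic/measurableC.
  apply: (measurableT_comp (continuous_measurable_fun (@sqrt_continuous R))).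
  apply: measurable_sum => i; apply: measurable_funX; by case: (Hk i).
- split; [|by left; right|by right].
  by move=> t Nt; rewrite indicE memNset ?mulr0//= => /(_ Nt).
- move=> t t01 Nt; have dg : derivable gamma t 1.
    apply/derivable_mxP => a i; rewrite (ord1 a).
    by case: (Hk i) => _ _ _ /(_ t t01 (notN _ _ Nt))[].
  split => //; rewrite indicE mem_set// mulr1; congr Num.sqrt.
  apply: eq_bigr => i _; rewrite -derive1_coord//.
  by case: (Hk i) => _ _ _ /(_ t t01 (notN _ _ Nt))[_ ->].
Qed.

(** Straightness in terms of increments: it passes to subintervals and makes distances along the
    path additive. *)
Definition straight gamma (u : 'rV[R]_d) (s t : R) :=
  forall r1 r2, s <= r1 -> r1 <= r2 -> r2 <= t ->
    gamma r2 - gamma r1 = enorm (gamma r2 - gamma r1) *: u.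

(** By integration, [dotv e u <= 0] implies [dotv e D <= 0] for an increment [D]. Taking for [e] the
    vector [- u], then the component of [D] orthogonal to [u], shows that [D] is a nonnegative
    multiple of [u]. *)
Lemma straight_of_derive gamma (u : 'rV[R]_d) s t : rectifiable gamma ->
  0 <= s -> t <= 1 -> enorm u = 1 ->
  (forall r, r \in `]s, t[ -> derivable gamma r 1 ->
     derive1 gamma r = enorm (derive1 gamma r) *: u) ->
  straight gamma u s t.
Proof.
move=> rg s0 t1 u1 hu r1 r2 sr1 r12 r2t.
have [v [N [_ mN N0 _ dN]]] := path_speed rg.
have uu : dotv u u = 1 by rewrite -enorm_sqr u1 expr1n.
set D := gamma r2 - gamma r1.
have key (e : 'rV[R]_d) : dotv e u <= 0 -> dotv e D <= 0.
  move=> eu; rewrite -lee_fin.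
  have := @path_incr_le gamma N e (fun=> 0) r1 r2 rg mN N0.
  rewrite integral0_eq//; apply => //.
  - by move=> r r01 Nr; case: (dN r r01 Nr).
  - exact: le_trans sr1.
  - exact: le_trans t1.
  - move=> r; rewrite in_itv/= => /andP[ar br] _ dr.
    rewrite (hu _ _ dr); last by rewrite in_itv/= (le_lt_trans sr1 ar) (lt_le_trans br r2t).
    by rewrite dotvZr mulr_ge0_le0// enorm_ge0.
set c := dotv D u.
have c0 : 0 <= c.
  have := key (- u); rewrite !dotvNl uu lerN10 => /(_ isT).
  by rewrite oppr_le0 dotvC.
have Dc : D = c *: u.
  apply/eqP; rewrite -subr_eq0; apply/eqP; apply: dotvv_eq0.
  set w := D - c *: u.
  have wu : dotv w u = 0 by rewrite /w dotvBl dotvZl uu mulr1 subrr.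
  apply/eqP; rewrite eq_le dotvv_ge0 andbT.
  by rewrite {2}/w dotvBr dotvZr wu mulr0 subr0 key// wu.
by rewrite Dc enormZ u1 mulr1 ger0_norm.
Qed.

(** The increment is tested against the unit vector in its own direction. *)
Lemma enorm_le_speed gamma (v : R -> R) (N : set R) s t : rectifiable gamma ->
  measurable_fun setT v -> (forall t, 0 <= v t) -> measurable N -> lambda N = 0%E ->
  (forall t, t \in `]0, 1[ -> ~ N t ->
     derivable gamma t 1 /\ v t = enorm (derive1 gamma t)) ->
  0 <= s -> s <= t -> t <= 1 ->
  ((enorm (gamma t - gamma s))%:E <= \int[lambda]_(r in `[s, t]) (v r)%:E)%E.
Proof.
move=> rg mv v0 mN N0 dN s0 st t1.
set D := gamma t - gamma s.
have [D0|D0] := eqVneq (enorm D) 0.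
  by rewrite D0 integral_ge0// => x _; rewrite lee_fin.
have -> : enorm D = dotv ((enorm D)^-1 *: D) D.
  by rewrite dotvZl -enorm_sqr expr2 mulKf.
apply: (path_incr_le rg mN N0) => //.
  by move=> r r01 Nr; case: (dN r r01 Nr).
move=> r rst Nr dr.
have r01 : r \in `]0, 1[.
  move: rst; rewrite !in_itv/= => /andP[sr rt].
  by rewrite (le_lt_trans s0 sr) (lt_le_trans rt t1).
have [_ ->] := dN r r01 Nr.
apply: (le_trans (dotv_le _ _)); rewrite enormZ ger0_norm ?invr_ge0 ?enorm_ge0//.
by rewrite mulVf// mul1r.
Qed.

End paths.

(** * Straightening of paths *)

Section nodes.
Variable R : realType.

(** [P] is closed relative to the interval, so the infimum of its points is attained. *)
Lemma first_node (P : R -> Prop) (a b : R) : a <= b -> P b ->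
  (forall t, a <= t -> t <= b -> ~ P t ->
     exists2 e, 0 < e & forall r, a <= r -> r <= b -> `|r - t| < e -> ~ P r) ->
  exists c, [/\ a <= c, c <= b, P c & forall r, a <= r -> r < c -> ~ P r].
Proof.
move=> ab Pb cP; pose E := [set t | [/\ a <= t, t <= b & P t]].
have Eb : E b by split.
have lbE : lbound E a by move=> t [].
have hE : has_inf E by split; [exists b|exists a].
have ac : a <= inf E by apply: lb_le_inf => //; exists b.
have cb : inf E <= b by apply: ge_inf => //; exists a.
exists (inf E); split => //.
- apply: contrapT => nP; have [e e0 he] := cP _ ac cb nP.
  have [t [at_ tb Pt] te] := inf_adherent e0 hE.
  apply: (he t at_ tb) => //.
  have : inf E <= t by apply: ge_inf; [exists a|split].
  by move=> ?; rewrite ger0_norm ?subr_ge0// ltrBlDl.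
- move=> r ar rc Pr; have : inf E <= r.
    apply: ge_inf; [by exists a|split => //].
    exact: le_trans (ltW rc) cb.
  by rewrite leNgt rc.
Qed.

Lemma last_node (P : R -> Prop) (a b : R) : a <= b -> P a ->
  (forall t, a <= t -> t <= b -> ~ P t ->
     exists2 e, 0 < e & forall r, a <= r -> r <= b -> `|r - t| < e -> ~ P r) ->
  exists c, [/\ a <= c, c <= b, P c & forall r, c < r -> r <= b -> ~ P r].
Proof.
move=> ab Pa cP.
have [||t bt ta nP|c [c1 c2 c3 c4]] := @first_node (fun t => P (- t)) (- b) (- a).
- by rewrite lerN2.
- by rewrite opprK.
- have [||e e0 he] := cP (- t) _ _ nP; rewrite 1?lerNr 1?lerNl//.
  exists e => // r br ra rt; apply: he; rewrite 1?lerNr 1?lerNl//.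
  by rewrite -opprD normrN.
- exists (- c); split => //; rewrite 1?lerNr 1?lerNl//.
  by move=> r cr rb; rewrite -(opprK r); apply: c4; rewrite 1?lerN2// ltrNl.
Qed.

Lemma derive1_ge0_right (f : R -> R) (r e : R) : 0 < e ->
  (forall h, 0 < h -> h < e -> f r <= f (h + r)) -> derivable f r 1 ->
  0 <= derive1 f r.
Proof.
move=> e0 fh df; rewrite leNgt; apply/negP => l0.
have : h^-1 *: (f (h + r) - f r) @[h --> 0^'] --> derive1 f r.
  have := df; rewrite /derivable; under eq_fun do rewrite /GRing.scale/= mulr1.
  by move=> /cvg_ex[l fl]; rewrite /derive1 (cvg_lim _ fl).
move/cvgr_lt => /(_ _ l0)[/= e' e'0 He].
pose h := Num.min (e / 2) (e' / 2).
have h0 : 0 < h by rewrite lt_min !divr_gt0.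
have he : h < e by rewrite gt_min; apply/orP; left; lra.
have he' : h < e' by rewrite gt_min; apply/orP; right; lra.
have := He h; rewrite /ball_/= sub0r normrN gtr0_norm// => /(_ he' (lt0r_neq0 h0)).
apply/negP; rewrite -leNgt /GRing.scale/=; apply: mulr_ge0; first by rewrite invr_ge0 ltW.
rewrite subr_ge0.
exact: fh.
Qed.

End nodes.

Section good.
Variables (R : realType) (d : nat).
Notation lambda := (@lebesgue_measure R).
Implicit Types (gamma : R -> 'rV[R]_d) (u z : 'rV[R]_d) (G K : set 'rV[R]_d).

(** Converse of [straight_of_derive], by the same duality with test vectors, now applied to
    difference quotients from the right. *)
Lemma straight_derive gamma u s t r : straight gamma u s t -> enorm u = 1 ->
  s < r -> r < t -> derivable gamma r 1 ->
  derive1 gamma r = enorm (derive1 gamma r) *: u.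
Proof.
move=> sg u1 sr rt dg; set D := derive1 gamma r.
have uu : dotv u u = 1 by rewrite -enorm_sqr u1 expr1n.
have key (e : 'rV[R]_d) : 0 <= dotv e u -> 0 <= dotv e D.
  move=> eu; have dd := is_derive_dotv e dg.
  have <- : derive1 (fun x => dotv e (gamma x)) r = dotv e D.
    by rewrite derive1E derive_val.
  apply: (@derive1_ge0_right _ _ _ (t - r)); first by rewrite subr_gt0.
    move=> h h0 ht; rewrite -subr_ge0 -dotvBr sg.
    - by rewrite dotvZr mulr_ge0// enorm_ge0.
    - exact: ltW.
    - by rewrite lerDr ltW.
    - by rewrite -lerBrDr ltW.
  by apply: ex_derive.
set c := dotv u D.
have c0 : 0 <= c by apply: key; rewrite uu.
have Dc : D = c *: u.
  apply/eqP; rewrite -subr_eq0; apply/eqP; apply: dotvv_eq0.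
  set w := D - c *: u.
  have wu : dotv w u = 0 by rewrite /w dotvBl dotvZl uu mulr1 dotvC subrr.
  have wD : dotv w D = 0.
    apply/eqP; rewrite eq_le key ?wu// andbT -oppr_ge0 -dotvNl key//.
    by rewrite dotvNl wu oppr0.
  by rewrite {2}/w dotvBr dotvZr wu wD mulr0 subr0.
by rewrite Dc enormZ u1 mulr1 ger0_norm.
Qed.

Definition free_straight G gamma s t := forall s1 s2 : R, s <= s1 -> s1 < s2 -> s2 <= t ->
  (forall r, r \in `]s1, s2[ -> ~ G (gamma r)) ->
  exists u, enorm u = 1 /\
    forall r, r \in `]s1, s2[ -> derivable gamma r 1 ->
      derive1 gamma r = enorm (derive1 gamma r) *: u.

(* [good G K w s t z z' c]: a Lipschitz path in [K] from [z] to [z'] over the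
   time interval [[s, t]], straight away from [G], whose [w]-weighted length
   is at most [c]; the integrand is dominated almost everywhere by a
   measurable function, which avoids any measurability issue with [derive1]. *)
Definition good G K (w : 'rV[R]_d -> R) (s t : R) z z' (c : R) :=
  exists gamma, exists g : R -> R, exists N : set R,
  [/\ (exists2 L, 0 <= L & forall a b, s <= a -> a <= t -> s <= b -> b <= t ->
         enorm (gamma a - gamma b) <= L * `|a - b|) /\
        (forall r, s <= r -> r <= t -> K (gamma r)),
      gamma s = z /\ gamma t = z',
      free_straight G gamma s t,
      [/\ measurable_fun setT g, (forall r, 0 <= g r), measurable N & lambda N = 0%E] &
      (forall r, r \in `]s, t[ -> ~ N r ->
         w (gamma r) * enorm (derive1 gamma r) <= g r) /\
      (\int[lambda]_(r in `[s, t]) (g r)%:E <= c%:E)%E].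

Lemma good_cat G K w s t e z z' z'' c c' : s <= t -> t <= e -> G z' ->
  good G K w s t z z' c -> good G K w t e z' z'' c' ->
  good G K w s e z z'' (c + c').
Proof.
move=> st te Gz'
  [g1 [f1 [N1 [[[L1 L10 gL1] K1] [g1s g1t] adm1 [mf1 f10 mN1 N10] [b1 i1]]]]]
  [g2 [f2 [N2 [[[L2 L20 gL2] K2] [g2s g2t] adm2 [mf2 f20 mN2 N20] [b2 i2]]]]].
pose gm r := if r < t then g1 r else g2 r.
have gmt1 r : r <= t -> gm r = g1 r.
  by rewrite /gm le_eqVlt => /predU1P[->|->//]; rewrite ltxx g2s g1t.
have gmt2 r : t <= r -> gm r = g2 r by rewrite /gm ltNge => ->.
have near1 r : r < t -> {near r, g1 =1 gm}.
  move=> rt; near=> x; rewrite gmt1//; apply/ltW.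
  by near: x; exact: lt_nbhsl.
have near2 r : t < r -> {near r, g2 =1 gm}.
  move=> rt; near=> x; rewrite gmt2//; apply/ltW.
  by near: x; exact: lt_nbhsr.
have D1 r : r < t -> derive1 gm r = derive1 g1 r.
  by move=> rt; rewrite !derive1E; apply/esym/near_eq_derive/near1.
have D2 r : t < r -> derive1 gm r = derive1 g2 r.
  by move=> rt; rewrite !derive1E; apply/esym/near_eq_derive/near2.
have dd1 r : r < t -> derivable gm r 1 -> derivable g1 r 1.
  move=> rt; apply: near_eq_derivable.
  by have := near1 r rt; apply: filterS => x ->.
have dd2 r : t < r -> derivable gm r 1 -> derivable g2 r 1.
  move=> rt; apply: near_eq_derivable.
  by have := near2 r rt; apply: filterS => x ->.
(* [t] joins the exceptional set, since the path may turn there. *)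
exists gm, (fun r => if r < t then f1 r else f2 r), (N1 `|` N2 `|` [set t]).
split.
- split.
  + exists (Num.max L1 L2); first by rewrite le_max L10.
    have M1 : L1 <= Num.max L1 L2 by rewrite le_max lexx.
    have M2 : L2 <= Num.max L1 L2 by rewrite le_max lexx orbT.
    have lt_case a b : s <= a -> a <= t -> t <= b -> b <= e ->
        enorm (gm a - gm b) <= Num.max L1 L2 * `|a - b|.
      move=> sa at_ tb be; apply: (le_trans (enorm_dist z' _ _)).
      rewrite gmt1// gmt2// -{1}g1t -g2s.
      have := gL1 a t sa at_ st (lexx _); have := gL2 t b (lexx _) te tb be.
      rewrite (ler0_norm (_ : a - t <= 0)) ?subr_le0//.
      rewrite (ler0_norm (_ : t - b <= 0)) ?subr_le0//.
      rewrite (ler0_norm (_ : a - b <= 0)) ?subr_le0//; last exact: le_trans tb.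
      move: (Num.max L1 L2) M1 M2 => M M1 M2.
      rewrite g1t g2s; nra.
    move=> a b sa ae sb be.
    have [at_|/ltW ta] := leP a t; have [bt|/ltW tb] := leP b t.
    * by rewrite !gmt1//; apply: (le_trans (gL1 _ _ _ _ _ _)) => //; rewrite ler_wpM2r.
    * exact: lt_case.
    * by rewrite enormB distrC; exact: lt_case.
    * by rewrite !gmt2//; apply: (le_trans (gL2 _ _ _ _ _ _)) => //; rewrite ler_wpM2r.
  + move=> r sr re; have [rt|/ltW tr] := leP r t.
      by rewrite gmt1//; exact: K1.
    by rewrite gmt2//; exact: K2.
- by rewrite gmt1// gmt2.
- move=> s1 s2 ss1 s12 s2e fr.
  have [s2t|ts2] := leP s2 t.
    have [r|u [u1 hu]] := adm1 s1 s2 ss1 s12 s2t.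
      move=> r12; rewrite -gmt1; first exact: fr.
      by move: r12; rewrite in_itv/= => /andP[_ /ltW rs2]; exact: le_trans s2t.
    exists u; split; first exact: u1.
    move=> r r12.
    have rt : r < t.
      by move: r12; rewrite in_itv/= => /andP[_ rs2]; exact: lt_le_trans s2t.
    by move=> /(dd1 _ rt) /(hu _ r12); rewrite D1.
  have [ts1|s1t] := leP t s1.
    have [r|u [u1 hu]] := adm2 s1 s2 ts1 s12 s2e.
      move=> r12; rewrite -gmt2; first exact: fr.
      by move: r12; rewrite in_itv/= => /andP[/ltW s1r _]; exact: le_trans s1r.
    exists u; split; first exact: u1.
    move=> r r12.
    have tr : t < r.
      by move: r12; rewrite in_itv/= => /andP[s1r _]; exact: le_lt_trans s1r.
    by move=> /(dd2 _ tr) /(hu _ r12); rewrite D2.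
  by case: (fr t); rewrite ?in_itv/= ?s1t// gmt1// g1t.
- split.
  + apply: measurable_fun_ifT => //.
    exact: measurable_fun_ltr.
  + by move=> r; case: ifP.
  + by apply: measurableU; [exact: measurableU|exact: measurable_set1].
  + have lt0 : lambda [set t] = 0%E by exact: lebesgue_measure_set1.
    apply: measure0_setU lt0 => //; [exact: measurableU|exact: measure0_setU].
- split.
  + move=> r rse nN.
    have nt : r != t by apply/eqP => rt; apply: nN; right.
    have nN1 : ~ N1 r by move=> ?; apply: nN; left; left.
    have nN2 : ~ N2 r by move=> ?; apply: nN; left; right.
    move: rse; rewrite in_itv/= => /andP[sr re].
    have [rt|tr] := ltP r t.
      by rewrite gmt1 ?(ltW rt)// D1// b1// in_itv/= sr rt.
    have {}tr : t < r by rewrite lt_neqAle eq_sym nt.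
    by rewrite gmt2 ?(ltW tr)// D2// b2// in_itv/= re tr.
  + pose g r := if r < t then f1 r else f2 r.
    rewrite -[leLHS]/(\int[lambda]_(r in `[s, e]) (g r)%:E)%E.
    have mg : measurable_fun setT g.
      by apply: measurable_fun_ifT => //; exact: measurable_fun_ltr.
    have g0 r : 0 <= g r by rewrite /g; case: ifP.
    have -> : `[s, e]%classic = (`[s, t[%classic : set R) `|` `[t, e]%classic.
      by rewrite -itv_bndbnd_setU//= bnd_simp.
    rewrite ge0_integral_setU//=; last 3 first.
    * apply/measurable_EFinP; exact: measurable_funTS.
    * by move=> x _; rewrite lee_fin.
    * apply/disj_setPS => x [] /=; rewrite !in_itv/= => /andP[_ xt] /andP[tx _].
      by move: (lt_le_trans xt tx); rewrite ltxx.
    rewrite EFinD; apply: leeD.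
      apply: le_trans i1.
      rewrite [leLHS](_ : _ = \int[lambda]_(r in `[s, t[) (f1 r)%:E)%E; last first.
        apply: eq_integral => x; rewrite inE/= in_itv/= => /andP[_ xt].
        by rewrite /g xt.
      apply: ge0_subset_integral => //=.
        by apply/measurable_EFinP; exact: measurable_funTS.
        by move=> x _; rewrite lee_fin.
      by move=> x /=; rewrite !in_itv/= => /andP[-> /ltW].
    rewrite [leLHS](_ : _ = \int[lambda]_(r in `[t, e]) (f2 r)%:E)%E//.
    apply: eq_integral => x; rewrite inE/= in_itv/= => /andP[tx _].
    by rewrite /g ltNge tx.
Unshelve. all: by end_near. Qed.

End good.

(** * Replacement of one piece of a path by a segment *)

Section pieces.
Variables (R : realType) (d : nat).
Notation lambda := (@lebesgue_measure R).
Implicit Types (gamma : R -> 'rV[R]_d) (u z : 'rV[R]_d) (G K : set 'rV[R]_d).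

Definition segment_closed K := forall x y (t : R), K x -> K y -> 0 <= t -> t <= 1 ->
  K (x + t *: (y - x)).

Lemma segE (z z' : 'rV[R]_d) (t : R) : z + t *: (z' - z) = (1 - t) *: z + t *: z'.
Proof. by rewrite scalerBr scalerBl scale1r addrA addrAC. Qed.

Lemma seg_dist2 (z z' a a' : 'rV[R]_d) (r t : R) : 0 <= t -> t <= 1 ->
  enorm (z - a) <= r -> enorm (z' - a') <= r ->
  enorm (z + t *: (z' - z) - (a + t *: (a' - a))) <= r.
Proof.
move=> t0 t1 zr z'r; rewrite !segE opprD addrACA -!scalerBr.
apply: (le_trans (enormD _ _)); rewrite !enormZ ger0_norm ?subr_ge0// ger0_norm//.
nra.
Qed.

Lemma seg_dist (z z' p : 'rV[R]_d) (r t : R) : 0 <= t -> t <= 1 ->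
  enorm (z - p) <= r -> enorm (z' - p) <= r ->
  enorm (z + t *: (z' - z) - p) <= r.
Proof.
move=> t0 t1 zr z'r; have := seg_dist2 t0 t1 zr z'r.
by rewrite subrr scaler0 addr0.
Qed.

Lemma is_derive_seg (z v : 'rV[R]_d) (theta : R -> R) (r l : R) :
  is_derive r (1 : R) theta l ->
  derivable (fun x => z + theta x *: v) r 1 /\
  derive1 (fun x => z + theta x *: v) r = l *: v.
Proof.
move=> dt.
have ci i j : is_derive r (1 : R) (fun x => (z + theta x *: v) i j) (l * v i j).
  have -> : (fun x => (z + theta x *: v) i j) = cst (z i j) + v i j *: theta.
    by apply/funext => x; rewrite !mxE [X in _ + X]mulrC.
  rewrite -[l * _]add0r [l * _]mulrC.
  exact: (is_deriveD (is_derive_cst _ _ _) (is_deriveZ _ dt)).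
have dg : derivable (fun x => z + theta x *: v) r 1.
  by apply/derivable_mxP => i j; apply: ex_derive.
split => //; apply/rowP => j; rewrite -derive1_coord// mxE derive1E.
exact: derive_val.
Qed.

Variable u0 : 'rV[R]_d.
Hypothesis u01 : enorm u0 = 1.

(** The segment is run through with a time change [theta], whose monotonicity makes it straight on
    the whole interval, whatever [G] is. The vector [u0] serves as direction when [z] equals
    [z']. *)
Lemma good_param G K w (s t : R) (z z' : 'rV[R]_d) (c L : R)
    (theta theta' g : R -> R) (N : set R) :
  segment_closed K -> K z -> K z' -> s <= t ->
  theta s = 0 -> theta t = 1 ->
  (forall a b, s <= a -> a <= b -> b <= t -> theta a <= theta b) ->
  (forall a b, s <= a -> a <= t -> s <= b -> b <= t ->
     `|theta a - theta b| <= L * `|a - b|) -> 0 <= L ->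
  measurable N -> lambda N = 0%E ->
  (forall r, r \in `]s, t[ -> ~ N r -> is_derive r (1 : R) theta (theta' r)) ->
  measurable_fun setT g -> (forall r, 0 <= g r) ->
  (forall r, r \in `]s, t[ -> ~ N r ->
     w (z + theta r *: (z' - z)) * (`|theta' r| * enorm (z' - z)) <= g r) ->
  (\int[lambda]_(r in `[s, t]) (g r)%:E <= c%:E)%E ->
  good G K w s t z z' c.
Proof.
move=> cK Kz Kz' st th0 th1 thm thL L0 mN N0 dth mg g0 gb ic.
pose gm r := z + theta r *: (z' - z).
exists gm, g, N; split => //.
- split.
    exists (L * enorm (z' - z)); first by rewrite mulr_ge0// enorm_ge0.
    move=> a b sa at_ sb bt; rewrite /gm opprD addrACA subrr add0r -scalerBl enormZ.
    by rewrite mulrAC ler_wpM2r ?enorm_ge0// thL.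
  move=> r sr rt; apply: cK => //.
    by rewrite -th0; exact: thm.
  by rewrite -th1; exact: thm.
- by rewrite /gm th0 th1 scale0r addr0 scale1r subrKC.
- have [u [u1 sgu]] : exists u, enorm u = 1 /\ straight gm u s t.
    have [zz|zz] := eqVneq (z' - z) 0.
      exists u0; split => // r1 r2 _ _ _.
      by rewrite /gm zz !scaler0 !addr0 subrr enorm0 scale0r.
    exists ((enorm (z' - z))^-1 *: (z' - z)); split.
      by rewrite enormZ ger0_norm ?invr_ge0 ?enorm_ge0// mulVf// enorm_eq0.
    move=> r1 r2 sr1 r12 r2t.
    rewrite /gm opprD addrACA subrr add0r -scalerBl enormZ.
    rewrite ger0_norm ?subr_ge0 ?thm//.
    by rewrite scalerA mulfK// enorm_eq0.
  move=> s1 s2 ss1 s12 s2t _; exists u; split => // r; rewrite in_itv/= => /andP[s1r rs2].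
  apply: straight_derive sgu u1 _ _.
    exact: le_lt_trans ss1 s1r.
  exact: lt_le_trans rs2 s2t.
- split => // r rst Nr.
  have [_ ->] := is_derive_seg z (z' - z) (dth r rst Nr).
  by rewrite enormZ; exact: gb.
Qed.

Lemma good_lin G K w (s t : R) (z z' : 'rV[R]_d) (M : R) :
  segment_closed K -> K z -> K z' -> s < t -> 0 <= M ->
  (forall r, 0 <= r -> r <= 1 -> w (z + r *: (z' - z)) <= M) ->
  good G K w s t z z' (M * enorm (z' - z)).
Proof.
move=> cK Kz Kz' st M0 wM; have st0 : 0 < t - s by rewrite subr_gt0.
have i0 : 0 <= (t - s)^-1 by rewrite invr_ge0 ltW.
apply: (@good_param G K w s t z z' _ ((t - s)^-1) (fun r => (r - s) * (t - s)^-1)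
  (fun=> (t - s)^-1) (fun=> M * ((t - s)^-1 * enorm (z' - z))) set0) => //.
- exact: ltW.
- by rewrite subrr mul0r.
- by rewrite mulfV// gt_eqF.
- by move=> a b _ ab _; rewrite ler_wpM2r// lerB.
- move=> a b _ _ _ _; rewrite -mulrBl opprB addrA subrK normrM mulrC.
  by rewrite (ger0_norm i0).
- move=> r _ _.
  have -> : (fun r => (r - s) * (t - s)^-1) = (t - s)^-1 *: (id - cst s : R -> R).
    by apply/funext => x; rewrite /= mulrC.
  by apply: is_derive_eq; rewrite subr0 /GRing.scale/= mulr1.
- by move=> r; rewrite !mulr_ge0// enorm_ge0.
- move=> r; rewrite in_itv/= => /andP[sr rt] _; rewrite ger0_norm//.
  rewrite ler_wpM2r ?mulr_ge0 ?enorm_ge0// wM//.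
    by rewrite mulr_ge0// subr_ge0 ltW.
  by rewrite ler_pdivrMr// mul1r lerB// ltW.
- rewrite integral_cst//= lebesgue_measure_itv/= lte_fin st -EFinB -EFinM lee_fin.
  by rewrite -mulrA (mulrC (_^-1)) mulfVK// gt_eqF.
Qed.

Lemma straight_add gamma u s t r : straight gamma u s t -> enorm u = 1 ->
  s <= r -> r <= t ->
  enorm (gamma t - gamma s) = enorm (gamma r - gamma s) + enorm (gamma t - gamma r).
Proof.
move=> sg u1 sr rt.
have -> : gamma t - gamma s = (gamma r - gamma s) + (gamma t - gamma r).
  by rewrite [RHS]addrC addrA subrK.
rewrite {1}(sg s r (lexx _) sr rt) {1}(sg r t sr rt (lexx _)) -scalerDl enormZ u1 mulr1.
by rewrite ger0_norm// addr_ge0// enorm_ge0.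
Qed.

(** A long straight piece cannot be compared with a single value of the weight. The new segment is
    parametrized by the fraction of the distance already covered on the old one, so that equal times
    mean equal barycentric coordinates [q], and the weights are compared at each time. *)
Lemma good_jump gamma u G K w (s t L kappa c : R) (z z' : 'rV[R]_d) (fh : R -> R) (N : set R) :
  segment_closed K -> K z -> K z' -> s < t -> 0 <= L ->
  (forall a b, s <= a -> a <= t -> s <= b -> b <= t ->
     enorm (gamma a - gamma b) <= L * `|a - b|) ->
  straight gamma u s t -> enorm u = 1 -> gamma t != gamma s ->
  measurable N -> lambda N = 0%E ->
  measurable_fun setT fh -> (forall r, 0 <= fh r) ->
  (forall r, r \in `]s, t[ -> ~ N r ->
     derivable gamma r 1 /\ fh r = w (gamma r) * enorm (derive1 gamma r)) ->
  0 <= kappa ->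
  (forall a, 0 <= w a) ->
  (forall r q, s <= r -> r <= t -> 0 <= q -> q <= 1 ->
     gamma r = gamma s + q *: (gamma t - gamma s) ->
     w (z + q *: (z' - z)) * enorm (z' - z) <= kappa * enorm (gamma t - gamma s) * w (gamma r)) ->
  (kappa%:E * \int[lambda]_(r in `[s, t]) (fh r)%:E <= c%:E)%E ->
  good G K w s t z z' c.
Proof.
move=> cK Kz Kz' st L0 gL sg u1 gts mN N0 mf f0 fE k0 w0 wk ic.
set D := enorm (gamma t - gamma s).
have D0 : 0 < D by rewrite enorm_gt0 subr_eq0.
have Di0 : 0 <= D^-1 by rewrite invr_ge0 ltW.
have uu : dotv u u = 1 by rewrite -enorm_sqr u1 expr1n.
have du a b : s <= a -> a <= b -> b <= t ->
    dotv u (gamma b - gamma a) = enorm (gamma b - gamma a).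
  by move=> sa ab bt; rewrite {1}(sg a b)// dotvZr uu mulr1.
(* On the straight piece this is [enorm (gamma r - gamma s) / D]. The scalar product makes it affine
   in [gamma], hence differentiable wherever [gamma] is. *)
pose th r := D^-1 * dotv u (gamma r - gamma s).
have thB a b : th b - th a = D^-1 * dotv u (gamma b - gamma a).
  by rewrite /th -mulrBr -dotvBr opprB addrA subrK.
have th0 : th s = 0 by rewrite /th subrr -(scale0r 0) dotvZr mul0r mulr0.
have th1 : th t = 1 by rewrite /th du// ?ltW// mulVf// gt_eqF.
have thm a b : s <= a -> a <= b -> b <= t -> th a <= th b.
  by move=> sa ab bt; rewrite -subr_ge0 thB du// mulr_ge0// enorm_ge0.
apply: (@good_param G K w s t z z' c (D^-1 * L) th
  (fun r => D^-1 * dotv u (derive1 gamma r)) (fun r => kappa * fh r) N) => //.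
- exact: ltW.
- move=> a b sa at_ sb bt; rewrite thB normrM (ger0_norm Di0) -mulrA ler_wpM2l//.
  apply: le_trans (gL _ _ sa at_ sb bt).
  rewrite ler_norml lerNl -dotvNr opprB (enormB (gamma a)).
  apply/andP; split; apply: (le_trans (dotv_le _ _)); rewrite u1 mul1r//.
  by rewrite enormB.
- by rewrite mulr_ge0.
- move=> r rst Nr; have [dg _] := fE r rst Nr.
  have dd := is_derive_dotv u dg.
  have -> : th = D^-1 *: ((fun r => dotv u (gamma r)) - cst (dotv u (gamma s))).
    by apply/funext => x; rewrite /th dotvBr.
  by apply: is_derive_eq; rewrite subr0.
- by apply: measurable_funM.
- by move=> r; rewrite mulr_ge0.
- move=> r rst Nr; have [dg ->] := fE r rst Nr.
  move: rst; rewrite in_itv/= => /andP[/ltW sr /ltW rt].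
  have q0 : 0 <= th r by rewrite -th0 thm.
  have q1 : th r <= 1 by rewrite -th1 thm// ltW.
  have gr : gamma r = gamma s + th r *: (gamma t - gamma s).
    have -> : gamma t - gamma s = D *: u by apply: sg => //; exact: ltW.
    rewrite scalerA (_ : th r * D = enorm (gamma r - gamma s)).
      by rewrite -sg// subrKC.
    by rewrite /th mulrAC mulVf ?gt_eqF// mul1r du.
  have dle : `|dotv u (derive1 gamma r)| <= enorm (derive1 gamma r).
    rewrite ler_norml lerNl -dotvNr.
    by apply/andP; split; apply: (le_trans (dotv_le _ _)); rewrite u1 mul1r// enormN.
  have := wk r (th r) sr rt q0 q1 gr; rewrite -/D => h.
  rewrite normrM (ger0_norm Di0).
  apply: (@le_trans _ _ (w (z + th r *: (z' - z)) * enorm (z' - z) * (D^-1 * enorm (derive1 gamma r)))).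
    rewrite -mulrA ler_wpM2l//  [X in _ <= X]mulrC ler_wpM2r ?enorm_ge0//.
    by rewrite ler_wpM2l.
  apply: (le_trans (ler_wpM2r _ h)); first by rewrite mulr_ge0// enorm_ge0.
  rewrite le_eqVlt; apply/orP; left; apply/eqP.
  by field; rewrite gt_eqF.
- apply: le_trans ic; under eq_integral do rewrite EFinM.
  rewrite ge0_integralZl//.
  + apply/measurable_EFinP; exact: measurable_funTS.
  + by move=> x _; rewrite lee_fin.
Qed.

End pieces.

(** * Gaps: time intervals that a path spends off the support *)

Section gaps.
Variables (R : realType) (d : nat).
Notation lambda := (@lebesgue_measure R).
Variables (F K : set 'rV[R]_d) (gamma : R -> 'rV[R]_d) (x y : 'rV[R]_d).
Hypotheses (cF : closed F) (adm : admissible F x y gamma).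

Let rg : rectifiable gamma. Proof. by case: adm. Qed.

Lemma path_lip : exists2 L, 0 < L & forall a b, 0 <= a -> a <= 1 -> 0 <= b -> b <= 1 ->
  enorm (gamma a - gamma b) <= L * `|a - b|.
Proof.
have [L gL] := rg; exists (`|L| + 1); first by rewrite ltr_wpDl.
move=> a b a0 a1 b0 b1; apply: (le_trans (gL a b _ _)).
- by rewrite in_itv/= a0.
- by rewrite in_itv/= b0.
- by rewrite ler_wpM2r//; have := ler_norm L; lra.
Qed.

Lemma notF_near t : 0 <= t -> t <= 1 -> ~ F (gamma t) ->
  exists2 e, 0 < e & forall r, 0 <= r -> r <= 1 -> `|r - t| < e -> ~ F (gamma r).
Proof.
move=> t0 t1 nF; have [L L0 gL] := path_lip.
have /open_enormP/(_ _ nF)[e e0 he] : open (~` F) by exact/closed_openC.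
exists (e / L); first by rewrite divr_gt0.
move=> r r0 r1 rt; apply: he; apply: (le_lt_trans (gL _ _ _ _ _ _)) => //.
by rewrite mulrC -ltr_pdivlMr// distrC.
Qed.

(** The end points are the last time before [t] and the first time after [t] at which the path is in
    [F]; the limits [a] and 1 stand in when there is none. *)
Lemma gap a t : 0 <= a -> a <= t -> t <= 1 -> (a = 0 \/ F (gamma a)) ->
  ~ F (gamma t) ->
  exists al be, [/\ a <= al /\ al <= t, t <= be /\ be <= 1,
    al = a \/ F (gamma al), be = 1 \/ F (gamma be) &
    forall r, al < r -> r < be -> ~ F (gamma r)].
Proof.
move=> a0 at_ t1 na nF.
have [||al [al1 al2 al3 al4]] := @last_node _ (fun r => r = a \/ F (gamma r)) a t at_.
- by left.
- move=> r ar rt /not_orP[/eqP ra nFr].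
  have [//|||e e0 he] := @notF_near r; [exact: le_trans ar|exact: le_trans t1|by []|].
  exists (Num.min e `|r - a|); first by rewrite lt_min e0 normr_gt0 subr_eq0.
  move=> q aq qt; rewrite lt_min => /andP[h1 h2] [qa|]; last first.
    by apply: he => //; [exact: le_trans aq|exact: le_trans t1].
  by move: h2; rewrite qa distrC ltxx.
have [||be [be1 be2 be3 be4]] := @first_node _ (fun r => r = 1 \/ F (gamma r)) t 1 t1.
- by left.
- move=> r tr r1 /not_orP[/eqP r1n nFr].
  have r0 : 0 <= r by apply: le_trans tr; exact: le_trans at_.
  have [//|e e0 he] := @notF_near r r0 r1.
  exists (Num.min e `|r - 1|); first by rewrite lt_min e0 normr_gt0 subr_eq0.
  move=> q tq q1; rewrite lt_min => /andP[h1 h2] [qa|]; last first.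
    by apply: he => //; apply: le_trans tq; exact: le_trans at_.
  by move: h2; rewrite qa distrC ltxx.
exists al, be; split => // r alr rbe Fr.
have [rt|tr] := leP r t; first by case: (al4 r alr rt); right.
by case: (be4 r (ltW tr) rbe); right.
Qed.

Lemma gap_straight al be : 0 <= al -> al < be -> be <= 1 ->
  (forall r, al < r -> r < be -> ~ F (gamma r)) ->
  exists2 u, enorm u = 1 & straight gamma u al be.
Proof.
move=> al0 albe be1 nF; have [_ _ _ /(_ al be al0 albe be1)] := adm.
case=> [r|u [u1 hu]].
  by rewrite in_itv/= => /andP[h1 h2]; exact: nF.
by exists u => //; apply: straight_of_derive.
Qed.

(** Off [F] the path runs along a segment whose end points are [x], [y] or points of [F], all in
    [K]. *)
Lemma path_in_convex t : segment_closed K -> F `<=` K -> K x -> K y ->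
  0 <= t -> t <= 1 -> K (gamma t).
Proof.
move=> cK FK Kx Ky t0 t1.
have [/FK//|nF] := pselect (F (gamma t)).
have [_ gx gy _] := adm.
have [al [be [[al0 alt] [tbe be1] nal nbe nF']]] := @gap 0 t (lexx _) t0 t1 (or_introl erefl) nF.
have Kal : K (gamma al) by case: nal => [->|/FK//]; rewrite gx.
have Kbe : K (gamma be) by case: nbe => [->|/FK//]; rewrite gy.
have := alt; rewrite le_eqVlt => /predU1P[<-//|alt'].
have albe : al < be by exact: lt_le_trans tbe.
have [u u1 sg] := gap_straight al0 albe be1 nF'.
have sa := straight_add sg u1 alt tbe.
have [D0|D0] := eqVneq (enorm (gamma be - gamma al)) 0.
  have : enorm (gamma t - gamma al) = 0.
    by apply/eqP; rewrite eq_le enorm_ge0 -D0 sa lerDl enorm_ge0.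
  by move/eqP; rewrite enorm_eq0 subr_eq0 => /eqP ->.
have Dp : 0 < enorm (gamma be - gamma al) by rewrite lt_neqAle eq_sym D0 enorm_ge0.
have -> : gamma t = gamma al + (enorm (gamma t - gamma al) / enorm (gamma be - gamma al))
    *: (gamma be - gamma al).
  rewrite {2}(sg al be)// ?ltW// scalerA mulfVK// -sg//.
  by rewrite subrKC.
apply: cK => //; first by rewrite divr_ge0 ?enorm_ge0.
by rewrite ler_pdivrMr// mul1r sa lerDl enorm_ge0.
Qed.

End gaps.

(** * Polygonal replacement of a whole path *)

Section polygon.
Variables (R : realType) (d : nat).
Notation lambda := (@lebesgue_measure R).
Variables (F G K : set 'rV[R]_d) (rho : 'rV[R]_d -> R) (beta s0 D h ell : R).
Hypotheses (beta0 : 0 <= beta) (s00 : 0 < s0) (h0 : 0 <= h) (ell0 : 0 < ell).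
Hypotheses (cK : segment_closed K) (cF : closed F) (FK : F `<=` K) (GK : G `<=` K).
Hypothesis rhoL : forall p q, K p -> K q -> rho p <= rho q + enorm (p - q).
Hypothesis rho_lb : forall p, K p -> s0 <= rho p.
Hypothesis rho_ub : forall p, K p -> rho p <= D.
Hypothesis nearG : forall p, F p -> exists2 g, G g & enorm (g - p) <= h.

Let w p := rho p `^ beta.
(** Bounds the ratio of the weights at two points within distance [4 * ell + h]: an additive error
    on [rho] becomes a factor because [rho] is at least [s0]. *)
Let k1 := (1 + (4 * ell + h) / s0) `^ beta.

Let eh0 : 0 <= 4 * ell + h. Proof. by rewrite addr_ge0// mulr_ge0// ltW. Qed.

Lemma weight_ratio p q e : K p -> K q -> rho p <= rho q + e -> 0 <= e -> e <= 4 * ell + h ->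
  w p <= k1 * w q.
Proof.
move=> Kp Kq pq e0 e1; have sq := rho_lb Kq; have sp := rho_lb Kp.
have c0 : 0 <= 1 + (4 * ell + h) / s0.
  by rewrite addr_ge0// divr_ge0 ?addr_ge0 ?mulr_ge0// ltW.
rewrite /w /k1 -powRM//; last by apply: le_trans sq; exact: ltW.
apply: ge0_ler_powR => //; rewrite ?nnegrE.
- by apply: le_trans sp; exact: ltW.
- by rewrite mulr_ge0//; apply: le_trans sq; exact: ltW.
apply: (le_trans pq); rewrite mulrDl mul1r lerD2l.
apply: (le_trans e1).
by rewrite mulrAC ler_pdivlMr// ler_wpM2l.
Qed.

Variables (gamma : R -> 'rV[R]_d) (x y : 'rV[R]_d).
Hypotheses (adm : admissible F x y gamma) (Kx : K x) (Ky : K y).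
Variables (u0 : 'rV[R]_d) (u01 : enorm u0 = 1).
Variables (v fh : R -> R) (N : set R).
Hypotheses (mv : measurable_fun setT v) (v0 : forall r, 0 <= v r).
Hypotheses (mN : measurable N) (N0 : lambda N = 0%E).
Hypothesis vE : forall r, r \in `]0, 1[ -> ~ N r ->
  derivable gamma r 1 /\ v r = enorm (derive1 gamma r).
Hypotheses (mf : measurable_fun setT fh) (f0 : forall r, 0 <= fh r).
Hypothesis fE : forall r, 0 <= r -> r <= 1 -> fh r = w (gamma r) * v r.
Hypothesis ffin : (\int[lambda]_(r in `[0%R, 1%R]) (fh r)%:E < +oo)%E.

Let w0 p : 0 <= w p. Proof. exact: powR_ge0. Qed.
Let k10 : 0 <= k1. Proof. exact: powR_ge0. Qed.
Let gK t : 0 <= t -> t <= 1 -> K (gamma t).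
Proof. by move=> *; apply: (path_in_convex cF adm). Qed.
Let rg : rectifiable gamma. Proof. by case: adm. Qed.

Let J a b := fine (\int[lambda]_(r in `[a, b]) (fh r)%:E)%E.

Lemma JE a b : 0 <= a -> b <= 1 ->
  (\int[lambda]_(r in `[a, b]) (fh r)%:E = (J a b)%:E)%E.
Proof.
move=> a0 b1; rewrite /J fineK// ge0_fin_numE.
  apply: le_lt_trans ffin; apply: ge0_subset_integral => //=.
  - by apply/measurable_EFinP; exact: measurable_funTS.
  - by move=> r _; rewrite lee_fin.
  - by move=> r /=; rewrite !in_itv/= => /andP[ar rb]; rewrite (le_trans a0 ar) (le_trans rb b1).
by apply: integral_ge0 => r _; rewrite lee_fin.
Qed.

Lemma J_ge0 a b : 0 <= J a b.
Proof. by apply: fine_ge0; apply: integral_ge0 => r _; rewrite lee_fin. Qed.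

Lemma J_cat a b c : 0 <= a -> a <= b -> b <= c -> c <= 1 -> J a c = J a b + J b c.
Proof.
move=> a0 ab bc c1; apply: EFin_inj.
rewrite EFinD -!JE//; [|exact: le_trans ab|exact: le_trans c1].
have -> : `[a, c]%classic = (`[a, b[%classic : set R) `|` `[b, c]%classic.
  by rewrite -itv_bndbnd_setU//= bnd_simp.
rewrite ge0_integral_setU//=.
- by rewrite integral_itv_bndo_bndc//; apply/measurable_EFinP; exact: measurable_funTS.
- by apply/measurable_EFinP; exact: measurable_funTS.
- by move=> r _; rewrite lee_fin.
- apply/disj_setPS => r [] /=; rewrite !in_itv/= => /andP[_ rb] /andP[br _].
  by move: (lt_le_trans rb br); rewrite ltxx.
Qed.

Lemma J_ge M k a b : 0 <= M -> 0 <= k -> 0 <= a -> a <= b -> b <= 1 ->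
  (forall r, a <= r -> r <= b -> M <= k * w (gamma r)) ->
  M * enorm (gamma b - gamma a) <= k * J a b.
Proof.
move=> M0 k0 a0 ab b1 Mk; rewrite -lee_fin !EFinM -JE//.
have := enorm_le_speed rg mv v0 mN N0 vE a0 ab b1.
move=> /(lee_wpmul2l _) => /(_ M%:E); rewrite lee_fin => /(_ M0)/le_trans; apply.
rewrite -!ge0_integralZl//; try by [move=> r _; rewrite lee_fin|
  apply/measurable_EFinP; exact: measurable_funTS|rewrite lee_fin].
apply: ge0_le_integral => //.
- by move=> r _; rewrite -EFinM lee_fin mulr_ge0.
- by apply/measurable_EFinP/measurable_funTS/measurable_funM.
- by apply/measurable_EFinP/measurable_funTS/measurable_funM.
move=> r /=; rewrite in_itv/= => /andP[ar rb]; rewrite -!EFinM lee_fin.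
rewrite fE; [|exact: le_trans ar|exact: le_trans b1].
by rewrite mulrA ler_wpM2r// Mk.
Qed.

Lemma good_le s t z z' c c' : c <= c' -> good G K w s t z z' c -> good G K w s t z z' c'.
Proof.
move=> cc [g [f [n [h1 h2 h3 h4 [h5 h6]]]]]; exists g, f, n; split => //; split => //.
by apply: le_trans h6 _; rewrite lee_fin.
Qed.

(** The new segment stays within [2 * ell + h] of [gamma s] and the old piece within [2 * ell],
    whence the [4 * ell + h] of [k1]. Moving both end points by [h] adds at most [2 * h] to the
    length, paid at the largest weight. *)
Lemma short_piece s t z z' : 0 <= s -> s < t -> t <= 1 -> K z -> K z' ->
  enorm (z - gamma s) <= h -> enorm (z' - gamma t) <= h ->
  (forall r, s <= r -> r <= t -> enorm (gamma r - gamma s) <= 2 * ell) ->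
  good G K w s t z z' (k1 * (J s t + 2 * h * D `^ beta)).
Proof.
move=> sp st t1 Kz Kz' zs z't close; set p := gamma s.
have st' := ltW st; have Kp : K p by apply: gK => //; exact: le_trans t1.
have p0 : 0 <= rho p + 2 * ell + h.
  by rewrite !addr_ge0 ?mulr_ge0 ?(ltW ell0)// (le_trans (ltW s00))// rho_lb.
pose M := (rho p + 2 * ell + h) `^ beta.
have M0 : 0 <= M by exact: powR_ge0.
have Mle q : K q -> rho p <= rho q + 2 * ell -> M <= k1 * w q.
  move=> Kq pq; have sq := rho_lb Kq.
  rewrite /M /w /k1 -powRM; last 2 first.
  - by rewrite addr_ge0// divr_ge0 ?addr_ge0 ?mulr_ge0// ltW.
  - by apply: le_trans sq; exact: ltW.
  apply: ge0_ler_powR => //; rewrite ?nnegrE//.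
    rewrite mulr_ge0//; last by apply: le_trans sq; exact: ltW.
    by rewrite addr_ge0// divr_ge0 ?addr_ge0 ?mulr_ge0// ltW.
  rewrite mulrDl mul1r.
  have : 4 * ell + h <= (4 * ell + h) / s0 * rho q.
    by rewrite mulrAC ler_pdivlMr// ler_wpM2l.
  lra.
have Mp : M <= k1 * D `^ beta.
  apply: (@le_trans _ _ (k1 * w p)); first by apply: Mle => //; rewrite lerDl mulr_ge0// ltW.
  rewrite ler_wpM2l// /w ge0_ler_powR ?nnegrE ?rho_ub//.
    by rewrite (le_trans (ltW s00))// rho_lb.
  by rewrite (le_trans (ltW s00))// (le_trans (rho_lb Kp))// rho_ub.
have MJ : M * enorm (gamma t - p) <= k1 * J s t.
  apply: J_ge => // r sr rt; apply: Mle.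
    by apply: gK; [exact: le_trans sr|exact: le_trans t1].
  have Kr : K (gamma r) by apply: gK; [exact: le_trans sr|exact: le_trans t1].
  have := rhoL Kp Kr; have := close r sr rt; rewrite enormB -/p; lra.
have zz' : enorm (z' - z) <= enorm (gamma t - p) + 2 * h.
  have := enorm_dist (gamma t) z' z; have := enorm_dist p (gamma t) z.
  by rewrite (enormB p z); move: zs z't; rewrite -/p; lra.
have wM r : 0 <= r -> r <= 1 -> w (z + r *: (z' - z)) <= M.
  move=> r0 r1; have Kr : K (z + r *: (z' - z)) by apply: cK.
  rewrite /w /M ge0_ler_powR ?nnegrE//; first by rewrite (le_trans (ltW s00))// rho_lb.
  apply: (le_trans (rhoL Kr Kp)); rewrite -(addrA (rho p)) lerD2l.
  apply: seg_dist => //; first by rewrite (le_trans zs)// lerDr mulr_ge0// ltW.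
  apply: (le_trans (enorm_dist (gamma t) _ _)).
  by rewrite addrC lerD// close.
apply: (good_le _ (@good_lin R d u0 u01 G K w s t z z' M cK Kz Kz' st M0 wM)).
apply: (le_trans (ler_wpM2l M0 zz')); rewrite !mulrDr lerD//.
have -> : k1 * (2 * h * D `^ beta) = k1 * D `^ beta * (2 * h) by ring.
by rewrite ler_wpM2r// mulr_ge0.
Qed.

Let Dnn : 0 <= D.
Proof. by rewrite (le_trans (ltW s00))// (le_trans (rho_lb Kx))// rho_ub. Qed.

Let s0D : s0 `^ beta <= D `^ beta.
Proof.
by rewrite ge0_ler_powR ?nnegrE ?(ltW s00)// (le_trans (rho_lb Kx))// rho_ub.
Qed.

(** At equal barycentric coordinates the old and the new segment are at distance at most [h], and a
    length greater than [ell] grows by at most [2 * h]. *)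
Lemma jump_piece u s t z z' : 0 <= s -> s < t -> t <= 1 -> K z -> K z' ->
  enorm (z - gamma s) <= h -> enorm (z' - gamma t) <= h ->
  straight gamma u s t -> enorm u = 1 -> ell < enorm (gamma t - gamma s) ->
  good G K w s t z z' (k1 * (1 + 2 * h / ell) * J s t).
Proof.
move=> sp st t1 Kz Kz' zs z't sg u1 lD.
have [L L0 gL] := path_lip adm.
have k20 : 0 <= 1 + 2 * h / ell.
  by rewrite addr_ge0// divr_ge0// ?mulr_ge0// ltW.
apply: (@good_jump _ _ u0 u01 gamma u G K w s t L (k1 * (1 + 2 * h / ell)) _ z z' fh N) => //.
- exact: ltW.
- by move=> a b sa at_ sb bt; apply: gL; rewrite ?(le_trans _ t1) ?(le_trans sp).
- by rewrite -subr_eq0 -enorm_eq0 gt_eqF// (lt_trans ell0).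
- move=> r; rewrite in_itv/= => /andP[sr rt] Nr.
  have r0 : 0 < r by exact: le_lt_trans sr.
  have r1 : r < 1 by exact: lt_le_trans t1.
  have r01 : r \in `]0, 1[ by rewrite in_itv/= r0 r1.
  have [dg ve] := vE r01 Nr.
  by split => //; rewrite fE ?ltW// ve.
- exact: mulr_ge0.
- move=> r q sr rt q0 q1 gr.
  have Kr : K (gamma r) by apply: gK; [exact: le_trans sr|exact: le_trans t1].
  have Kq : K (z + q *: (z' - z)) by apply: cK.
  have dq : enorm (z + q *: (z' - z) - gamma r) <= h by rewrite gr seg_dist2.
  have wq : w (z + q *: (z' - z)) <= k1 * w (gamma r).
    apply: (@weight_ratio _ _ h) => //; last by rewrite lerDr mulr_ge0// ltW.
    by apply: (le_trans (rhoL Kq Kr)); rewrite lerD2l.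
  have zz' : enorm (z' - z) <= (1 + 2 * h / ell) * enorm (gamma t - gamma s).
    have e1 : enorm (z' - z) <= enorm (gamma t - gamma s) + 2 * h.
      have := enorm_dist (gamma t) z' z; have := enorm_dist (gamma s) (gamma t) z.
      by rewrite (enormB (gamma s) z); move: zs z't; lra.
    apply: (le_trans e1); rewrite [X in _ <= X]mulrDl mul1r lerD2l [X in _ <= X]mulrAC ler_pdivlMr//.
    by rewrite ler_wpM2l ?mulr_ge0// ltW.
  apply: (le_trans (ler_pM (w0 _) (enorm_ge0 _) wq zz')).
  by rewrite le_eqVlt; apply/orP; left; apply/eqP; ring.
- by rewrite JE// -EFinM.
Qed.

(** The end point error, [2 * h] at the largest weight, relative to the smallest cost of travelling
    a distance [ell]. A stretch that travels that far absorbs the error into a factor [1 + E]. *)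
Let E := 2 * h * D `^ beta / (s0 `^ beta * ell).
(** One [E] pays for a short piece and the other for the jump that may follow it. *)
Let kap := k1 * (1 + 2 * E).
(** Error of the final piece, which may be too short to absorb it. *)
Let A := k1 * (2 * h * D `^ beta).

Let sb0 : 0 < s0 `^ beta. Proof. exact: powR_gt0. Qed.

Let E0 : 0 <= E.
Proof. by rewrite divr_ge0 ?mulr_ge0 ?powR_ge0// ltW. Qed.

Let EJ j : s0 `^ beta * ell <= j -> 2 * h * D `^ beta <= E * j.
Proof.
move=> hj; apply: le_trans (ler_wpM2l E0 hj).
by rewrite /E mulfVK// gt_eqF// mulr_gt0.
Qed.

Let hE : 2 * h / ell <= E.
Proof.
rewrite /E ler_pdivlMr ?mulr_gt0// mulrA mulrAC mulfVK ?gt_eqF//.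
by rewrite ler_wpM2l// mulr_ge0.
Qed.

Lemma J_progress s r t : 0 <= s -> s <= r -> r <= t -> t <= 1 ->
  ell <= enorm (gamma r - gamma s) -> s0 `^ beta * ell <= J s t.
Proof.
move=> sp sr rt t1 lr; rewrite (J_cat sp sr rt t1).
apply: (@le_trans _ _ (J s r)); last by rewrite lerDl J_ge0.
apply: (@le_trans _ _ (s0 `^ beta * enorm (gamma r - gamma s))).
  by rewrite ler_wpM2l// ltW.
rewrite -[X in _ <= X]mul1r; apply: J_ge => //; first exact: ltW.
  exact: le_trans t1.
move=> q sq qr; have Kq : K (gamma q).
  by apply: gK; [exact: le_trans sq|rewrite (le_trans qr)// (le_trans rt)].
rewrite mul1r /w ge0_ler_powR ?nnegrE ?(ltW s00)// ?rho_lb//.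
by rewrite (le_trans (ltW s00))// rho_lb.
Qed.

Lemma exit_time s : 0 <= s -> s <= 1 ->
  (forall r, s <= r -> r <= 1 -> enorm (gamma r - gamma s) <= ell) \/
  exists s', [/\ s <= s', s' <= 1, ell <= enorm (gamma s' - gamma s) &
    forall r, s <= r -> r <= s' -> enorm (gamma r - gamma s) <= ell].
Proof.
move=> sp s1; have [L L0 gL] := path_lip adm.
have [[b [sb b1 lb]]|nex] :=
    pselect (exists b, [/\ s <= b, b <= 1 & ell <= enorm (gamma b - gamma s)]); last first.
  left => r sr r1; rewrite leNgt; apply/negP => lr; apply: nex.
  by exists r; split => //; exact: ltW.
right.
have [//||c [sc cb lc hc]] := @first_node _ (fun r => ell <= enorm (gamma r - gamma s)) s b sb.
  move=> t st tb /negP; rewrite -ltNge => lt; exists ((ell - enorm (gamma t - gamma s)) / L).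
    by rewrite divr_gt0// subr_gt0.
  move=> r sr rb; rewrite ltr_pdivlMr// mulrC => rt; apply/negP; rewrite -ltNge.
  have := gL r t (le_trans sp sr) (le_trans rb b1) (le_trans sp st) (le_trans tb b1).
  by have := enorm_dist (gamma t) (gamma r) (gamma s); lra.
exists c; split => //; first exact: le_trans b1.
move=> r sr; rewrite le_eqVlt => /predU1P[->|rc]; last first.
  by have /negP := hc r sr rc; rewrite -ltNge => /ltW.
rewrite leNgt; apply/negP => lc'.
have sc' : s < c.
  rewrite lt_neqAle sc andbT; apply/eqP => sE.
  by move: lc'; rewrite -sE subrr enorm0 ltNge ltW.
(* If the distance at [c] exceeded [ell], the Lipschitz bound would give distance at least [ell]
   already at this earlier time. *)
pose q := Num.max s (c - (enorm (gamma c - gamma s) - ell) / L).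
have e0 : 0 < (enorm (gamma c - gamma s) - ell) / L by rewrite divr_gt0// subr_gt0.
have sq : s <= q by rewrite le_max lexx.
have qc : q < c by rewrite gt_max sc' gtrBl.
apply: (hc q sq qc).
have := gL c q (le_trans sp sc) (le_trans cb b1) (le_trans sp sq)
  (le_trans (ltW qc) (le_trans cb b1)).
rewrite gtr0_norm ?subr_gt0// => h1.
have : L * (c - q) <= enorm (gamma c - gamma s) - ell.
  rewrite mulrC -ler_pdivlMr// lerBlDr -lerBlDl.
  by rewrite le_max lexx orbT.
by have := enorm_dist (gamma q) (gamma c) (gamma s); lra.
Qed.

(* Induction on the number of steps of duration [ell / L] left before time 1:
   by the Lipschitz bound, leaving a ball of radius [ell] takes at least that
   long. *)
Lemma polygon_from (L : R) (n : nat) : 0 < L ->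
  (forall a b, 0 <= a -> a <= 1 -> 0 <= b -> b <= 1 ->
     enorm (gamma a - gamma b) <= L * `|a - b|) ->
  forall s z, 0 <= s -> s < 1 -> (s = 0 \/ F (gamma s)) -> K z ->
  enorm (z - gamma s) <= h -> 1 - s <= n%:R * (ell / L) ->
  good G K w s 1 z y (kap * J s 1 + A).
Proof.
move=> L0 gL; have gy : gamma 1 = y by case: adm.
have A0 : 0 <= A by rewrite mulr_ge0// mulr_ge0 ?powR_ge0// mulr_ge0.
have dl0 : 0 < ell / L by exact: divr_gt0.
elim: n => [|n ih] s z sp s1 ns Kz zs sn.
  by exfalso; move: sn; rewrite mul0r subr_le0 leNgt s1.
(* Common end of all cases: a piece up to the node [r] is continued by the induction hypothesis from
   a point of [G] near [gamma r]. Before time 1 its cost must be free of additive error; at time 1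
   the error [A] is allowed once. *)
have cont r : s < r -> r <= 1 -> (r = 1 \/ F (gamma r)) -> (r < 1 -> ell / L <= r - s) ->
    forall c, (forall z1, K z1 -> enorm (z1 - gamma r) <= h -> good G K w s r z z1 c) ->
    (r < 1 -> c <= kap * J s r) -> c <= kap * J s r + A ->
    good G K w s 1 z y (kap * J s 1 + A).
  move=> sr r1 nr step c gc c1 c2.
  have [rE|rn1] := eqVneq r 1.
    rewrite rE in gc c2; apply: (good_le c2); apply: gc => //.
    by rewrite gy subrr enorm0.
  have rlt : r < 1 by rewrite lt_neqAle rn1.
  have Fr : F (gamma r) by case: nr => // rE; rewrite rE eqxx in rn1.
  have [g Gg gh] := nearG Fr.
  have r0 : 0 <= r by rewrite (le_trans sp)// ltW.
  have := good_cat (ltW sr) r1 Gg (gc g (GK Gg) gh)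
    (ih r g r0 rlt (or_intror Fr) (GK Gg) gh _).
  have e1 : 1 - r <= n%:R * (ell / L).
    by have := step rlt; move: sn; rewrite -natr1 mulrDl mul1r; lra.
  move=> /(_ e1); apply: good_le.
  by rewrite (J_cat sp (ltW sr) r1 (lexx _)) mulrDr addrA lerD2r lerD2r c1.
have shortc j : k1 * (j + 2 * h * D `^ beta) <= kap * j + A \/ j < 0.
  have [j0|] := leP 0 j; last by right.
  left; rewrite mulrDr /A lerD2r /kap ler_wpM2r//.
  by rewrite -[X in X <= _]mulr1; apply: ler_wpM2l => //; rewrite lerDl mulr_ge0.
have shortA r : k1 * (J s r + 2 * h * D `^ beta) <= kap * J s r + A.
  by case: (shortc (J s r)) => //; rewrite ltNge J_ge0.
have shortB r : s0 `^ beta * ell <= J s r ->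
    k1 * (J s r + 2 * h * D `^ beta) <= kap * J s r.
  move=> lJ; rewrite /kap -(mulrA k1); apply: ler_wpM2l => //.
  have := EJ lJ; have := mulr_ge0 E0 (J_ge0 s r); lra.
case: (exit_time sp (ltW s1)) => [near|[s' [ss' s'1 ls' near]]].
  apply: (cont 1 s1 (lexx _) (or_introl erefl) _ (k1 * (J s 1 + 2 * h * D `^ beta))) => //.
  - by rewrite ltxx.
  - move=> z1 Kz1 zz1; apply: short_piece => // r sr r1.
    by have := near r sr r1; move: ell0; lra.
  - by rewrite ltxx.
have s's : ell / L <= s' - s.
  rewrite ler_pdivrMr// mulrC.
  have := gL s' s (le_trans sp ss') s'1 sp (ltW s1).
  by rewrite ger0_norm ?subr_ge0//; exact: le_trans.
have ss'lt : s < s' by rewrite -subr_gt0 (lt_le_trans dl0).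
have s'0 : 0 <= s' by exact: le_trans ss'.
(* An exit point in [F] is the next node. Otherwise the gap around it is crossed entirely, and its
   end [be] is the next node. *)
have [Fs'|nFs'] := pselect (F (gamma s')).
  apply: (cont s' ss'lt s'1 (or_intror Fs') _ (k1 * (J s s' + 2 * h * D `^ beta))) => //.
  - move=> z1 Kz1 zz1; apply: short_piece => // r sr r1.
    by have := near r sr r1; move: ell0; lra.
  - by move=> _; apply: shortB; exact: (J_progress sp ss' (lexx _) s'1).
have ns' : s = 0 \/ F (gamma s) by [].
have [al [be [[sal als'] [s'be be1] nal nbe nF']]] :
    exists al be, [/\ s <= al /\ al <= s', s' <= be /\ be <= 1,
      al = s \/ F (gamma al), be = 1 \/ F (gamma be) &
      forall r, al < r -> r < be -> ~ F (gamma r)].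
  case: ns => [s0E|Fs].
    have := gap cF adm sp ss' s'1 (or_introl _) nFs'; apply.
    exact: s0E.
  have := gap cF adm sp ss' s'1 (or_intror Fs) nFs'; exact.
have albe : al < be.
  have [->|Fal] := nal; first exact: lt_le_trans s'be.
  apply: lt_le_trans s'be; rewrite lt_neqAle als' andbT; apply/eqP => aE.
  by apply: nFs'; rewrite -aE.
have al0 : 0 <= al by exact: le_trans sal.
have sbe : s < be by exact: lt_le_trans s'be.
have stepbe : be < 1 -> ell / L <= be - s.
  by move=> _; apply: (le_trans s's); rewrite lerD2r.
have lJ : s0 `^ beta * ell <= J s be by exact: (J_progress sp ss' s'be be1).
have [u u1 sg] := gap_straight adm al0 albe be1 nF'.
(* Across a short gap the whole stretch remains within [2 * ell] of [gamma s], so that one segment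
   replaces it. *)
have [short|long] := leP (enorm (gamma be - gamma al)) ell.
  apply: (cont be sbe be1 nbe stepbe (k1 * (J s be + 2 * h * D `^ beta))) => //.
  - move=> z1 Kz1 zz1; apply: short_piece => // r sr rbe.
    have [ral|alr] := leP r al.
      by have := near r sr (le_trans ral als'); move: ell0; lra.
    have := straight_add sg u1 (ltW alr) rbe.
    have := enorm_ge0 (gamma be - gamma r).
    have := near al sal als'.
    have := enorm_dist (gamma al) (gamma r) (gamma s); lra.
  - by move=> _; exact: shortB.
have jk : forall j, 0 <= j -> k1 * (1 + 2 * h / ell) * j <= k1 * ((1 + E) * j).
  by move=> j j0; rewrite -(mulrA k1); apply: ler_wpM2l => //; apply: ler_wpM2r => //; rewrite lerD2l.
move: sal; rewrite le_eqVlt => /predU1P[sE|sal].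
  have jc : k1 * (1 + 2 * h / ell) * J s be <= kap * J s be.
    apply: (le_trans (jk _ (J_ge0 _ _))); rewrite /kap -(mulrA k1); apply: ler_wpM2l => //.
    by apply: ler_wpM2r; rewrite ?J_ge0// lerD2l; move: E0; lra.
  apply: (cont be sbe be1 nbe stepbe _ _ _) => [z1 Kz1 zz1|_|].
  - by apply: (@jump_piece u) => //; rewrite sE.
  - exact: jc.
  - by apply: (le_trans jc); rewrite lerDl.
(* The long gap starts after [s]: a short piece leads to a point of [G] near its entry, then comes
   the jump, whose cost is large enough to absorb the errors of both. *)
have Fal : F (gamma al) by case: nal => // aE; rewrite aE ltxx in sal.
have [g Gg gh] := nearG Fal.
have Jc := J_cat sp (ltW sal) (ltW albe) be1.
have lJ2 : s0 `^ beta * ell <= J al be.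
  by apply: (@J_progress al be be) => //; exact: ltW.
have jc : k1 * (J s al + 2 * h * D `^ beta) + k1 * (1 + 2 * h / ell) * J al be <= kap * J s be.
  apply: (le_trans (lerD (lexx _) (jk _ (J_ge0 _ _)))).
  rewrite -mulrDr /kap -(mulrA k1); apply: ler_wpM2l => //; rewrite Jc.
  have := EJ lJ2; have := mulr_ge0 E0 (J_ge0 s al); lra.
apply: (cont be sbe be1 nbe stepbe _ _ _) => [z1 Kz1 zz1|_|].
- apply: (good_cat (ltW sal) (ltW albe) Gg).
    apply: short_piece => //.
    - exact: le_trans (ltW albe) be1.
    - exact: GK.
    move=> r sr ral; have := near r sr (le_trans ral als'); move: ell0; lra.
  by apply: (@jump_piece u) => //; exact: GK.
- exact: jc.
- by apply: (le_trans jc); rewrite lerDl.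
Qed.

Lemma polygon_good : good G K w 0 1 x y (kap * J 0 1 + A).
Proof.
have [L L0 gL] := path_lip adm.
have gx : gamma 0 = x by case: adm.
pose n := (Num.truncn ((ell / L)^-1)).+1.
have l0 : 0 < ell / L by exact: divr_gt0.
apply: (@polygon_from L n L0 gL 0 x) => //.
- by left.
- by rewrite gx subrr enorm0.
- rewrite subr0 -ler_pdivrMr// div1r; apply/ltW/truncnS_gt.
Qed.

End polygon.

(** * Comparison of Fermat distances *)

Section lower_integral.
Context dd (T : measurableType dd) (R : realType) (mu : {measure set T -> \bar R}).

(* [ge0_le_integral] without measurability: the integral of a nonnegative
   function is a supremum over the simple functions below it. *)
Lemma ge0_le_lower_integral (D : set T) (f g : T -> \bar R) :
  (forall x, D x -> 0 <= f x)%E -> (forall x, D x -> f x <= g x)%E ->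
  (\int[mu]_(x in D) f x <= \int[mu]_(x in D) g x)%E.
Proof.
move=> f0 fg.
have g0 x : D x -> (0 <= g x)%E by move=> Dx; apply: le_trans (fg x Dx); exact: f0.
rewrite !ge0_integralE//; apply: le_ereal_sup => _ [h hf <-].
exists h => // x; apply: (le_trans (hf x)); rewrite /patch.
by case: ifPn => // /set_mem; exact: fg.
Qed.

(** Raising [g] to +oo on the null set [N] keeps it measurable, leaves its integral unchanged and
    makes the domination hold everywhere; [f] may be any nonnegative function. *)
Lemma ae_ge0_le_lower_integral (D N : set T) (f g : T -> \bar R) :
  measurable D -> measurable N -> mu N = 0%E -> measurable_fun D g ->
  (forall x, D x -> 0 <= f x)%E -> (forall x, D x -> 0 <= g x)%E ->
  (forall x, D x -> ~ N x -> f x <= g x)%E ->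
  (\int[mu]_(x in D) f x <= \int[mu]_(x in D) g x)%E.
Proof.
move=> mD mN N0 mg f0 g0 fg.
pose g2 x := if x \in N then +oo%E else g x.
have mN2 : measurable_fun D (fun x => x \in N).
  apply: (@measurable_fun_bool _ _ _ _ true).
  rewrite (_ : _ @^-1` _ = N); first exact: measurableI.
  by apply/seteqP; split => x /=; [exact: set_mem|exact: mem_set].
apply: (@le_trans _ _ (\int[mu]_(x in D) g2 x)%E).
  apply: ge0_le_lower_integral => // x Dx; rewrite /g2.
  case: ifPn => [_|/negP nN]; first exact: leey.
  by apply: fg => // Nx; apply: nN; rewrite inE.
rewrite le_eqVlt; apply/orP; left; apply/eqP; apply: ge0_ae_eq_integral => //.
- apply: measurable_fun_if => //.
  exact: measurable_funS mg.
- by move=> x Dx; rewrite /g2; case: ifP => // _; exact: g0.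
exists N; split => // x /=; rewrite /g2 => h; apply: contrapT => Nx; apply: h => _.
by rewrite memNset.
Qed.

End lower_integral.

Section fdtm.
Variables (R : realType) (m p beta : R) (d : nat).
Hypothesis beta0 : 0 <= beta.
Notation lambda := (@lebesgue_measure R).
Implicit Types (nu : {measure set (borelE R d) -> \bar R}) (F G K : set 'rV[R]_d)
  (gamma : R -> 'rV[R]_d).

Definition dtm_real K nu (rho : 'rV[R]_d -> R) :=
  forall z, K z -> dtm m p nu z = (rho z)%:E.

Lemma fdtm_length_ge0 nu gamma : (0 <= fdtm_length m p beta nu gamma)%E.
Proof.
by apply: integral_ge0 => t _; rewrite mule_ge0 ?poweR_ge0// lee_fin enorm_ge0.
Qed.

Lemma fdtm_on_ge0 nu F x y : (0 <= fdtm_on m p beta nu F x y)%E.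
Proof. by apply: le_ereal_inf_tmp => _ [g _ <-]; exact: fdtm_length_ge0. Qed.

Lemma integrandE K nu rho gamma t : dtm_real K nu rho -> K (gamma t) ->
  (dtm m p nu (gamma t) `^ beta * (enorm (derive1 gamma t))%:E)%E =
  (rho (gamma t) `^ beta * enorm (derive1 gamma t))%:E.
Proof. by move=> nr Kt; rewrite nr// poweR_EFin EFinM. Qed.

Lemma fdtm_good nu rho G K x y c : dtm_real K nu rho ->
  good G K (fun z => rho z `^ beta) 0 1 x y c ->
  (fdtm_on m p beta nu G x y <= c%:E)%E.
Proof.
move=> nr [g [f [N [[[L L0 gL] gK] [gx gy] fs [mf f0 mN N0] [fb ic]]]]].
apply: (@le_trans _ _ (fdtm_length m p beta nu g)).
  apply: ereal_inf_lbound; exists g => //; split => //.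
  exists L => s t; rewrite !in_itv/= => /andP[s0 s1] /andP[t0 t1]; exact: gL.
apply: le_trans ic.
have l1 z : lambda [set z] = 0%E by exact: lebesgue_measure_set1.
have mN2 : measurable (N `|` [set 0] `|` [set 1]).
  by apply: measurableU; [apply: measurableU => //|]; exact: measurable_set1.
have N20 : lambda (N `|` [set 0] `|` [set 1]) = 0%E.
  apply: measure0_setU (l1 1) => //.
    by apply: measurableU => //; exact: measurable_set1.
  exact: measure0_setU (l1 0).
apply: (@ae_ge0_le_lower_integral _ _ _ lambda _ (N `|` [set 0] `|` [set 1])) => //.
- by apply/measurable_EFinP/measurable_funTS.
- by move=> t _; rewrite mule_ge0 ?poweR_ge0// lee_fin enorm_ge0.
- by move=> t _; rewrite lee_fin.
move=> t /=; rewrite in_itv/= => /andP[t0 t1] nN.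
rewrite (integrandE nr); last exact: gK.
rewrite lee_fin; apply: fb; last by move=> Nt; apply: nN; left; left.
rewrite in_itv/= !lt_neqAle t0 t1 !andbT; apply/andP; split; apply/eqP => tE.
  by apply: nN; left; right.
by apply: nN; right.
Qed.

(** The segment from [x] to [y] is straight everywhere, hence a competitor for every [G]. *)
Lemma fdtm_segment nu rho G K x y D (u0 : 'rV[R]_d) : enorm u0 = 1 ->
  dtm_real K nu rho -> segment_closed K -> K x -> K y ->
  (forall z, K z -> 0 <= rho z) -> (forall z, K z -> rho z <= D) ->
  (fdtm_on m p beta nu G x y <= (D `^ beta * enorm (y - x))%:E)%E.
Proof.
move=> u01 nr cK Kx Ky rho0 rhoD; apply: (fdtm_good nr).
apply: (@good_lin R d u0 u01) => //; first exact: powR_ge0.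
move=> r r0 r1; have Kr : K (x + r *: (y - x)) by exact: cK.
apply: ge0_ler_powR => //; rewrite ?nnegrE ?rho0 ?rhoD//.
exact: le_trans (rho0 _ Kr) (rhoD _ Kr).
Qed.

(** [fh] equals the integrand of [fdtm_length] off the null set [N] and is 0 on [N]. It is thus a
    measurable minorant of that integrand on [[0, 1]], insensitive to the junk values of
    [derive1]. *)
Lemma path_integrand nu rho K gamma : dtm_real K nu rho ->
  (forall a b, K a -> K b -> rho a <= rho b + enorm (a - b)) ->
  rectifiable gamma -> (forall t, 0 <= t -> t <= 1 -> K (gamma t)) ->
  exists v fh : R -> R, exists N : set R,
  [/\ measurable_fun setT v /\ (forall r, 0 <= v r),
      [/\ measurable N, lambda N = 0%E &
        forall r, r \in `]0, 1[ -> ~ N r ->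
          derivable gamma r 1 /\ v r = enorm (derive1 gamma r)],
      measurable_fun setT fh /\ (forall r, 0 <= fh r),
      (forall r, 0 <= r -> r <= 1 -> fh r = rho (gamma r) `^ beta * v r) &
      [/\ (forall r, 0 <= r -> r <= 1 -> ~ N r -> fh r = rho (gamma r) `^ beta * enorm (derive1 gamma r)) &
      (\int[lambda]_(r in `[0%R, 1%R]) (fh r)%:E <= fdtm_length m p beta nu gamma)%E]].
Proof.
move=> nr rhoL rg gK.
have [v [N [[mv v0] mN N0 [vN N00 N11] vE]]] := path_speed rg.
have {}vE r : 0 <= r -> r <= 1 -> ~ N r ->
    derivable gamma r 1 /\ v r = enorm (derive1 gamma r).
  move=> r0 r1 Nr; apply: vE => //; rewrite in_itv/= !lt_neqAle r0 r1 !andbT.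
  by apply/andP; split; apply/eqP => rE; apply: Nr; rewrite ?rE// -rE.
have [L gL] := rg.
have mr : measurable_fun setT (fun r => rho (gamma (clamp01 r))).
  apply: continuous_measurable_fun.
  apply: (@lipschitz_continuous _ _ `|L|) => s t.
  have h a b : rho (gamma (clamp01 a)) - rho (gamma (clamp01 b)) <= `|L| * `|a - b|.
    have gKc r := gK _ (clamp01_ge0 r) (clamp01_le1 r).
    rewrite lerBlDl; apply: (le_trans (rhoL _ _ (gKc a) (gKc b))).
    rewrite lerD2l; apply: (le_trans (gL _ _ _ _)); rewrite ?in_itv/= ?clamp01_ge0 ?clamp01_le1//.
    apply: (@le_trans _ _ (`|L| * `|clamp01 a - clamp01 b|)); first by rewrite ler_wpM2r// ler_norm.
    by rewrite ler_wpM2l// clamp01_lip.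
  by rewrite ler_norml h lerNl opprB distrC h.
exists v, (fun r => rho (gamma (clamp01 r)) `^ beta * v r), N; split => //.
- by split => // r r01; move: r01; rewrite in_itv/= => /andP[/ltW r0 /ltW r1]; exact: vE.
- split; last by move=> r; rewrite mulr_ge0 ?powR_ge0.
  apply: measurable_funM => //.
  by apply: (measurableT_comp (f := fun z : R => z `^ beta)) mr; exact: measurable_powR.
- by move=> r r0 r1; rewrite clamp01_id.
- split => [r r0 r1 Nr|]; first by have [_ <-] := vE r r0 r1 Nr; rewrite clamp01_id.
  apply: ge0_le_lower_integral => r /=; rewrite in_itv/= => /andP[r0 r1].
    by rewrite lee_fin mulr_ge0 ?powR_ge0.
  rewrite (integrandE nr); last exact: gK.
  rewrite lee_fin clamp01_id// ler_wpM2l ?powR_ge0//.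
  have [Nr|Nr] := pselect (N r); first by rewrite vN// enorm_ge0.
  by have [_ ->] := vE r r0 r1 Nr.
Qed.

Lemma fdtm_length_compare nu nu' rho rho' K gamma c : dtm_real K nu rho -> dtm_real K nu' rho' ->
  (forall a b, K a -> K b -> rho' a <= rho' b + enorm (a - b)) ->
  rectifiable gamma -> (forall t, 0 <= t -> t <= 1 -> K (gamma t)) ->
  0 <= c -> (forall z, K z -> 0 <= rho z) -> (forall z, K z -> 0 <= rho' z) ->
  (forall z, K z -> rho z <= c * rho' z) ->
  (fdtm_length m p beta nu gamma <= (c `^ beta)%:E * fdtm_length m p beta nu' gamma)%E.
Proof.
move=> nr nr' rhoL rg gK c0 r0 r0' rc.
have [v [fh [N [_ [mN N0 _] [mf f0] _ [fE fi]]]]] := path_integrand nr' rhoL rg gK.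
apply: (@le_trans _ _ ((c `^ beta)%:E * \int[lambda]_(r in `[0%R, 1%R]) (fh r)%:E)%E); last first.
  by apply: lee_wpmul2l fi; rewrite lee_fin powR_ge0.
rewrite -ge0_integralZl//; last 3 first.
- by apply/measurable_EFinP; exact: measurable_funTS.
- by move=> x _; rewrite lee_fin.
- by rewrite lee_fin powR_ge0.
apply: (@ae_ge0_le_lower_integral _ _ _ lambda _ N) => //.
- by apply/measurable_EFinP/measurable_funTS/measurable_funM.
- by move=> t _; rewrite mule_ge0 ?poweR_ge0// lee_fin enorm_ge0.
- by move=> t _; rewrite -EFinM lee_fin mulr_ge0 ?powR_ge0.
move=> t /=; rewrite in_itv/= => /andP[t0 t1] Nt.
rewrite (integrandE nr); last exact: gK.
rewrite -EFinM lee_fin fE// mulrA ler_wpM2r ?enorm_ge0//.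
have Kt := gK t t0 t1; rewrite -powRM ?r0'//.
by rewrite ge0_ler_powR ?nnegrE ?r0 ?mulr_ge0 ?r0' ?rc.
Qed.

End fdtm.

(** The common bound [B] turns the multiplicative comparison into an additive one. *)
Lemma ereal_dist_le (R : realType) (X Y : \bar R) (k c A B : R) :
  (0 <= X)%E -> (0 <= Y)%E -> (X <= B%:E)%E -> (Y <= B%:E)%E ->
  1 <= k -> 1 <= c -> 0 <= A ->
  (X <= c%:E * Y)%E -> (Y <= (k * c)%:E * X + A%:E)%E ->
  (`|X - Y| <= ((k * c - 1) * B + A)%:E)%E.
Proof.
move: X Y => [X| |] [Y| |]//.
rewrite -!EFinM -EFinD -EFinB abse_EFin !lee_fin => X0 Y0 XB YB k1 c1 A0 h1 h2.
have kc : c <= k * c by rewrite ler_peMl// (le_trans _ c1).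
rewrite ler_norml; apply/andP; split.
  rewrite lerNl opprB lerBlDr; apply: (le_trans h2).
  suff : (k * c - 1) * X <= (k * c - 1) * B by lra.
  by rewrite ler_wpM2l// subr_ge0 (le_trans c1).
rewrite lerBlDr; apply: (le_trans h1).
have : (c - 1) * Y <= (k * c - 1) * B.
  by apply: ler_pM => //; rewrite ?subr_ge0// lerD2r.
lra.
Qed.

Section comparison.
Variables (R : realType) (m p beta : R) (d : nat).
Hypothesis beta0 : 0 <= beta.
Notation lambda := (@lebesgue_measure R).
Variables (mu nu : {measure set (borelE R d) -> \bar R}).
Variables (F G K : set 'rV[R]_d) (rho rho' : 'rV[R]_d -> R).
Hypotheses (cK : segment_closed K) (cF : closed F) (FK : F `<=` K) (GF : G `<=` F).
Hypotheses (mr : dtm_real m p K mu rho) (nr : dtm_real m p K nu rho').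
Hypothesis rhoL : forall a b, K a -> K b -> rho a <= rho b + enorm (a - b).
Hypothesis rhoL' : forall a b, K a -> K b -> rho' a <= rho' b + enorm (a - b).
Variables (D s0 eta h ell : R).
Hypotheses (s00 : 0 < s0) (eta0 : 0 <= eta) (h0 : 0 <= h) (ell0 : 0 < ell).
Hypothesis rho_lb : forall a, K a -> s0 <= rho a.
Hypothesis rho_lb' : forall a, K a -> s0 <= rho' a.
Hypothesis rho_ub : forall a, K a -> rho a <= D.
Hypothesis rho_ub' : forall a, K a -> rho' a <= D.
Hypothesis rho_le : forall a, K a -> rho a <= rho' a + eta.
Hypothesis rho_ge : forall a, K a -> rho' a <= rho a + eta.
Hypothesis nearG : forall a, F a -> exists2 g, G g & enorm (g - a) <= h.
Variables (u0 : 'rV[R]_d) (u01 : enorm u0 = 1).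
Variables (x y : 'rV[R]_d) (Kx : K x) (Ky : K y).

Let X := fdtm_on m p beta mu F x y.
Let Y := fdtm_on m p beta nu G x y.
Let c := (1 + eta / s0) `^ beta.
Let k1 := (1 + (4 * ell + h) / s0) `^ beta.
Let E := 2 * h * D `^ beta / (s0 `^ beta * ell).
Let kap := k1 * (1 + 2 * E).
Let A := k1 * (2 * h * D `^ beta).

Lemma admissible_sub gamma : admissible G x y gamma -> admissible F x y gamma.
Proof.
move=> [rg gx gy ag]; split => // s1 s2 h1 h2 h3 nF; apply: ag => // t ts Gt.
by apply: (nF t ts); exact: GF.
Qed.

Let e0 : 0 <= 1 + eta / s0. Proof. by rewrite addr_ge0// divr_ge0// ltW. Qed.

Let ratio a b : s0 <= b -> a <= b + eta -> a <= (1 + eta / s0) * b.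
Proof.
move=> sb ab; apply: (le_trans ab); rewrite mulrDl mul1r lerD2l.
by rewrite mulrAC ler_pdivlMr// ler_wpM2l.
Qed.

(** By [admissible_sub] every competitor for [G] is one for [F], so the path is kept and only the
    weight changes. *)
Lemma fdtm_supp_le : (X <= c%:E * Y)%E.
Proof.
have c0 : 0 < c by apply: powR_gt0; rewrite ltr_pwDl// divr_ge0// ltW.
rewrite -lee_pdivrMl//; apply: le_ereal_inf_tmp => _ [gamma ag <-].
rewrite lee_pdivrMl//; have ag' := admissible_sub ag.
apply: (@le_trans _ _ (fdtm_length m p beta mu gamma)).
  by apply: ereal_inf_lbound; exists gamma.
apply: (@fdtm_length_compare _ _ _ _ _ beta0 mu nu rho rho' K) => //.
- by case: ag.
- by move=> t t0 t1; exact: (path_in_convex cF ag').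
- by move=> z Kz; rewrite (le_trans (ltW s00))// rho_lb.
- by move=> z Kz; rewrite (le_trans (ltW s00))// rho_lb'.
- by move=> z Kz; apply: ratio; [exact: rho_lb'|exact: rho_le].
Qed.

(** A competitor for [F] is first charged with the weight of [nu], at a factor [c], and only then
    made polygonal, at a factor [kap] and an additive [A]. *)
Lemma fdtm_sample_le : (Y <= (kap * c)%:E * X + A%:E)%E.
Proof.
have c0 : 0 < c by apply: powR_gt0; rewrite ltr_pwDl// divr_ge0// ltW.
have k10 : 0 < k1.
  apply: powR_gt0; rewrite ltr_pwDl// divr_ge0 ?(ltW s00)//.
  by rewrite addr_ge0// mulr_ge0// ltW.
have E0 : 0 <= E by rewrite divr_ge0 ?mulr_ge0 ?powR_ge0// ltW.
have kc0 : 0 < kap * c by rewrite mulr_gt0// mulr_gt0// ltr_pwDl// mulr_ge0.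
suff : ((kap * c)^-1%:E * (Y - A%:E) <= X)%E by rewrite lee_pdivrMl// leeBlDr.
apply: le_ereal_inf_tmp => _ [gamma ag <-]; rewrite lee_pdivrMl// leeBlDr//.
have gK t : 0 <= t -> t <= 1 -> K (gamma t).
  by move=> t0 t1; exact: (path_in_convex cF ag).
have rg : rectifiable gamma by case: ag.
have lc := @fdtm_length_compare _ m p _ _ beta0 nu mu rho' rho K gamma _ nr mr
  rhoL rg gK e0 _ _ _.
have {}lc : (fdtm_length m p beta nu gamma <= c%:E * fdtm_length m p beta mu gamma)%E.
  apply: lc => z Kz.
  - by rewrite (le_trans (ltW s00))// rho_lb'.
  - by rewrite (le_trans (ltW s00))// rho_lb.
  - by apply: ratio; [exact: rho_lb|exact: rho_ge].
have kapE : (0 <= kap%:E)%E.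
  by rewrite lee_fin mulr_ge0 ?(ltW k10)// addr_ge0// mulr_ge0.
apply: (@le_trans _ _ (kap%:E * fdtm_length m p beta nu gamma + A%:E)%E); last first.
  have H := leeD2r A%:E (lee_wpmul2l kapE lc).
  by apply: (le_trans H); rewrite muleA -EFinM.
(* [polygon_good] needs a path of finite cost; for an infinite one the bound is trivial. *)
have [fin|inf] := ltP (fdtm_length m p beta nu gamma) +oo%E; last first.
  move: inf; rewrite leye_eq => /eqP ->.
  rewrite gt0_muley ?addye ?leey// lte_fin mulr_gt0//.
  by rewrite ltr_pwDl// mulr_ge0.
have [v [fh [N [[mv v0] [mN N0 vE] [mf f0] fE [_ fi]]]]] := path_integrand beta nr rhoL' rg gK.
have ffin := le_lt_trans fi fin.
have := polygon_good beta0 s00 h0 ell0 cK cF FK (subset_trans GF FK) rhoL' rho_lb' rho_ub'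
  nearG ag Kx Ky u01 mv v0 mN N0 vE mf f0 fE ffin.
move=> /(fdtm_good nr) /le_trans; apply.
have fiE : ((fine (\int[lambda]_(r in `[0%R, 1%R]) (fh r)%:E))%:E <=
    fdtm_length m p beta nu gamma)%E.
  rewrite fineK// ge0_fin_numE//.
  by apply: integral_ge0 => r _; rewrite lee_fin.
apply: (le_trans _ (leeD2r A%:E (lee_wpmul2l kapE fiE))).
by rewrite -EFinM -EFinD.
Qed.

Lemma fdtm_dist (B : R) : D `^ beta * enorm (y - x) <= B ->
  (`|X - Y| <= ((kap * c - 1) * B + A)%:E)%E.
Proof.
move=> hB.
have XB : (X <= B%:E)%E.
  apply: (le_trans (fdtm_segment beta0 F u01 mr cK Kx Ky _ rho_ub)); last by rewrite lee_fin.
  by move=> z Kz; rewrite (le_trans (ltW s00))// rho_lb.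
have YB : (Y <= B%:E)%E.
  apply: (le_trans (fdtm_segment beta0 G u01 nr cK Kx Ky _ rho_ub')); last by rewrite lee_fin.
  by move=> z Kz; rewrite (le_trans (ltW s00))// rho_lb'.
have X0 : (0 <= X)%E by exact: fdtm_on_ge0.
have Y0 : (0 <= Y)%E by exact: fdtm_on_ge0.
refine (@ereal_dist_le R X Y kap c A B X0 Y0 XB YB _ _ _ fdtm_supp_le fdtm_sample_le).
- rewrite /kap; have : 1 <= k1.
    rewrite -{1}(powRr0 (1 + (4 * ell + h) / s0)) /k1 ler_powR// lerDl divr_ge0 ?(ltW s00)//.
    by rewrite addr_ge0// mulr_ge0// ltW.
  have : 0 <= E by rewrite divr_ge0 ?mulr_ge0 ?powR_ge0// ltW.
  by move: (E) (k1) => e k ee0 k1'; nra.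
- by rewrite -{1}(powRr0 (1 + eta / s0)) /c ler_powR// lerDl divr_ge0// ltW.
- by rewrite mulr_ge0 ?powR_ge0// mulr_ge0 ?powR_ge0// mulr_ge0.
Qed.

End comparison.

(** * Collection of the errors into one multiple of psi *)

Section rate.
Variable R : realType.

Lemma powR1D_le_expR (x b : R) : 0 <= x -> 0 <= b -> (1 + x) `^ b <= expR (b * x).
Proof.
move=> x0 b0; rewrite mulrC expRM ge0_ler_powR ?nnegrE ?expR_ge0 ?expR_ge1Dx//.
by rewrite addr_ge0.
Qed.

Lemma expRB1_le (x : R) : expR x - 1 <= x * expR x.
Proof.
have := expR_ge1Dx (- x); rewrite expRN => h.
have e0 := expR_gt0 x.
have : (1 - x) * expR x <= 1 by rewrite -ler_pdivlMr// div1r.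
lra.
Qed.

(** The three factors of [rate_bound], for the weight along the surgery, its length and the change
    of measure, are each at most an exponential. This is the sum of the exponents per unit of [psi],
    with [r] for [sigma / D]. *)
Definition rate_exponent (beta r c1 c2 : R) :=
  beta * (2 * (4 + c2) / r) + 8 * c2 * (2 / r) `^ beta + beta * (2 * c1 / r).

(** The first term comes from [expR x - 1 <= x * expR x], the second from the additive error of the
    last piece. *)
Definition rate_const (beta r c1 c2 : R) :=
  let C := rate_exponent beta r c1 c2 in C * expR C + 4 * c2 * expR C.

(** The choice of [psi * D] for [ell] balances the losses: [ell] relative to [s0] and [h] relative
    to [ell] are both of order [psi]. *)
Lemma rate_bound (beta D sigma psi c1 c2 : R) : 0 <= beta -> 0 < D -> 0 < sigma ->
  0 < psi -> psi <= 1 -> 0 <= c1 -> 0 <= c2 ->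
  let s0 := sigma / 2 in let eta := c1 * psi * D in let h := c2 * psi ^+ 2 * D in
  let ell := psi * D in
  let k1 := (1 + (4 * ell + h) / s0) `^ beta in
  let E := 2 * h * D `^ beta / (s0 `^ beta * ell) in
  (k1 * (1 + 2 * E) * (1 + eta / s0) `^ beta - 1) * (D `^ beta * D) +
    k1 * (2 * h * D `^ beta) <=
  rate_const beta (sigma / D) c1 c2 * psi * (D `^ beta * D).
Proof.
move=> b0 D0 s0 p0 p1 c10 c20; cbv zeta.
set r := sigma / D; set B := D `^ beta * D.
have r0 : 0 < r by exact: divr_gt0.
have B0 : 0 <= B by rewrite mulr_ge0 ?powR_ge0// ltW.
have sE : sigma = r * D by rewrite mulfVK// gt_eqF.
set E := _ / (_ * (psi * D)).
have EE : E = 2 * c2 * psi * (2 / r) `^ beta.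
  have -> : 2 / r = D / (sigma / 2) by rewrite sE; field; rewrite ?gt_eqF.
  rewrite (powRM _ (ltW D0)) ?invr_ge0 ?divr_ge0 ?(ltW s0)//.
  rewrite (_ : ((sigma / 2)^-1) `^ beta = ((sigma / 2) `^ beta)^-1); last first.
    by rewrite -powR_inv1 ?divr_ge0 ?(ltW s0)// -powRrM mulN1r powRN.
  rewrite /E; field; rewrite ?gt_eqF ?powR_gt0 ?divr_gt0//.
have E0 : 0 <= E by rewrite EE !mulr_ge0 ?powR_ge0// ltW.
set k1 := (1 + (4 * _ + _) / _) `^ beta.
have k1e : k1 <= expR (beta * (2 * (4 + c2) / r) * psi).
  have q0 : 0 <= (4 * (psi * D) + c2 * psi ^+ 2 * D) / (sigma / 2).
    by rewrite divr_ge0 ?divr_ge0 ?(ltW s0)// addr_ge0// !mulr_ge0 ?exprn_ge0// ltW.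
  apply: (le_trans (powR1D_le_expR q0 b0)); rewrite ler_expR -(mulrA beta).
  apply: ler_wpM2l => //.
  have -> : (4 * (psi * D) + c2 * psi ^+ 2 * D) / (sigma / 2) = 2 / r * (4 * psi + c2 * psi ^+ 2).
    by rewrite sE; field; rewrite ?gt_eqF.
  have -> : 2 * (4 + c2) / r * psi = 2 / r * (4 * psi + c2 * psi) by field; rewrite gt_eqF.
  apply: ler_wpM2l; first by rewrite divr_ge0// ltW.
  apply: lerD => //; apply: ler_wpM2l => //.
  by rewrite expr2 -[X in _ <= X]mulr1 ler_wpM2l// ltW.
have Ee : 1 + 2 * E <= expR (8 * c2 * (2 / r) `^ beta * psi).
  apply: (le_trans (expR_ge1Dx _)); rewrite ler_expR EE.
  have := powR_ge0 (2 / r) beta; move: (_ `^ beta) => q q0.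
  have : 0 <= c2 * q * psi by rewrite !mulr_ge0// ltW.
  lra.
have ce : (1 + c1 * psi * D / (sigma / 2)) `^ beta <= expR (beta * (2 * c1 / r) * psi).
  have q0 : 0 <= c1 * psi * D / (sigma / 2).
    by rewrite divr_ge0 ?divr_ge0 ?(ltW s0)// !mulr_ge0// ltW.
  apply: (le_trans (powR1D_le_expR q0 b0)); rewrite ler_expR -(mulrA beta).
  apply: ler_wpM2l => //; rewrite le_eqVlt; apply/orP; left; apply/eqP.
  by rewrite sE; field; rewrite ?gt_eqF.
rewrite /rate_const; set C := rate_exponent beta r c1 c2.
have C0 : 0 <= C.
  rewrite /C /rate_exponent !addr_ge0// !mulr_ge0 ?powR_ge0 ?invr_ge0 ?(ltW r0)//.
  by rewrite addr_ge0.
have K1 : k1 * (1 + 2 * E) * (1 + c1 * psi * D / (sigma / 2)) `^ beta <= expR (C * psi).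
  have -> : C * psi = beta * (2 * (4 + c2) / r) * psi + 8 * c2 * (2 / r) `^ beta * psi
      + beta * (2 * c1 / r) * psi by rewrite /C /rate_exponent; ring.
  have E1 : 0 <= 1 + 2 * E by rewrite addr_ge0// mulr_ge0.
  have k10 : 0 <= k1 by exact: powR_ge0.
  rewrite !expRD; apply: ler_pM => //; [exact: mulr_ge0|exact: powR_ge0|].
  exact: ler_pM.
have Cp : expR (C * psi) <= expR C.
  by rewrite ler_expR -[X in _ <= X]mulr1 ler_wpM2l.
have k1C : k1 <= expR C.
  apply: (le_trans k1e); apply: le_trans Cp; rewrite ler_expR.
  apply: ler_wpM2r; first exact: ltW.
  have b1 : 0 <= 8 * c2 * (2 / r) `^ beta by rewrite !mulr_ge0 ?powR_ge0.
  have b2 : 0 <= beta * (2 * c1 / r).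
    by apply: mulr_ge0 => //; apply: divr_ge0; [exact: mulr_ge0|exact: ltW].
  rewrite /C /rate_exponent; move: b1 b2.
  by move: (8 * _ * _) (beta * (2 * c1 / r)) (beta * _) => u v w; lra.
have h1 : k1 * (1 + 2 * E) * (1 + c1 * psi * D / (sigma / 2)) `^ beta - 1 <= C * psi * expR C.
  have := expRB1_le (C * psi).
  have : C * psi * expR (C * psi) <= C * psi * expR C.
    by rewrite ler_wpM2l// mulr_ge0// ltW.
  lra.
have h2 : k1 * (2 * (c2 * psi ^+ 2 * D) * D `^ beta) <= 4 * c2 * expR C * psi * B.
  have -> : k1 * (2 * (c2 * psi ^+ 2 * D) * D `^ beta) = k1 * psi * (2 * c2 * psi * B).
    by rewrite /B; ring.
  have -> : 4 * c2 * expR C * psi * B = expR C * 2 * (2 * c2 * psi * B) by ring.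
  apply: ler_wpM2r.
    by apply: mulr_ge0 => //; apply: mulr_ge0; [exact: mulr_ge0|exact: ltW].
  have := powR_ge0 (1 + (4 * (psi * D) + c2 * psi ^+ 2 * D) / (sigma / 2)) beta; rewrite -/k1 => k10.
  apply: (@le_trans _ _ (k1 * 1)); first by rewrite ler_wpM2l.
  have := expR_gt0 C; lra.
have := ler_wpM2r B0 h1; lra.
Qed.

End rate.

(** * Stability of the distance to measure *)

Section power_mean.
Variable R : realType.
Notation lambda := (@lebesgue_measure R).

(** Minkowski's inequality on [[0, m]]; after normalization by [m] the constant function [c] has
    norm [c]. *)
Lemma power_mean_le (m p c : R) (f g : R -> R) : 0 < m -> 1 <= p -> 0 <= c ->
  measurable_fun setT f -> measurable_fun setT g ->
  (forall u, 0 <= f u) -> (forall u, 0 <= g u) ->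
  (forall u, 0 <= u -> u <= m -> f u <= g u + c) ->
  (((m^-1)%:E * \int[lambda]_(u in `[0%R, m]) ((f u)%:E `^ p)) `^ p^-1 <=
   ((m^-1)%:E * \int[lambda]_(u in `[0%R, m]) ((g u)%:E `^ p)) `^ p^-1 + c%:E)%E.
Proof.
move=> m0 p1 c0 mf mg f0 g0 fg.
have p0 : 0 < p by exact: lt_le_trans p1.
have mI0 : measurable (`[0, m] : set R) by [].
pose I := (\1_(`[0, m]%classic : set R) : R -> R).
have mI : measurable_fun setT I by exact: measurable_indic.
have NE (h : R -> R) : (forall u, 0 <= h u) ->
   (\int[lambda]_(u in `[0%R, m]) ((h u)%:E `^ p))%E =
   (\int[lambda]_u (`|(h u * I u)%:E| `^ p))%E.
  move=> h0; rewrite integral_mkcond; apply: eq_integral => u _.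
  rewrite patchE /I indicE; case: ifPn => [uI|uI].
    by rewrite mulr1 gee0_abs// lee_fin.
  by rewrite mulr0 abse0 poweR0r// gt_eqF.
have NL (h : R -> R) : (forall u, 0 <= h u) ->
   ((\int[lambda]_(u in `[0%R, m]) ((h u)%:E `^ p)) `^ p^-1)%E =
   ('N[lambda]_p%:E[EFin \o (h \* I)%R])%E.
  by move=> h0; rewrite NE// unlock.
have i0 h : (0 <= \int[lambda]_(u in `[0%R, m]) ((h u)%:E `^ p))%E.
  by apply: integral_ge0 => u _; exact: poweR_ge0.
have mi0 : 0 <= m^-1 by rewrite invr_ge0 ltW.
rewrite !poweRM ?lee_fin//.
have ce : (c%:E = (m^-1)%:E `^ p^-1 * (\int[lambda]_(u in `[0%R, m]) (((fun=> c) u)%:E `^ p)) `^ p^-1)%E.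
  rewrite -poweRM ?lee_fin//.
  under eq_integral do rewrite poweR_EFin.
  rewrite integral_cst//= lebesgue_measure_itv/= lte_fin m0 sube0 -!EFinM poweR_EFin.
  rewrite mulrCA mulVf ?gt_eqF// mulr1 -powRrM mulfV ?gt_eqF// powRr1//.
rewrite [in leRHS]ce -ge0_muleDr ?poweR_ge0//.
match goal with |- is_true (_ * ?a <= _ * ?b)%E =>
  suff H : (a <= b)%E by apply: lee_wpmul2l H; exact: poweR_ge0 end.
have NLg := NL g g0; have NLc := NL (fun=> c) (fun=> c0).
rewrite NLg NLc.
have mc : measurable_fun setT ((fun=> c) \* I)%R by exact: measurable_funM.
have mgI : measurable_fun setT (g \* I)%R by exact: measurable_funM.
apply: le_trans (minkowski_EFin lambda mgI mc p1).
rewrite NL// unlock; apply: gt0_ler_poweR.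
- by rewrite invr_ge0 ltW.
- by rewrite in_itv/= leey andbT; apply: integral_ge0 => u _; rewrite lee_fin powR_ge0.
- by rewrite in_itv/= leey andbT; apply: integral_ge0 => u _; rewrite lee_fin powR_ge0.
apply: ge0_le_lower_integral => u _; first exact: poweR_ge0.
have I0 : 0 <= I u by rewrite /I indicE.
rewrite /= lee_fin !ger0_norm ?addr_ge0 ?mulr_ge0//.
apply: ge0_ler_powR; rewrite ?nnegrE ?addr_ge0 ?mulr_ge0 ?(ltW p0)//.
rewrite -mulrDl /I indicE; case: (boolP (u \in _)) => [uI|_]; last by rewrite !mulr0.
by rewrite !mulr1; move: uI; rewrite inE/= in_itv/= => /andP[u0 um]; exact: fg.
Qed.

End power_mean.

(** * The support of a measure *)

Section support.
Variables (R : realType) (d : nat).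
Implicit Types (nu : {measure set (borelE R d) -> \bar R}) (x : 'rV[R]_d).

Lemma measurable_open_borelE (A : set 'rV[R]_d) : open A ->
  @measurable _ (borelE R d) A.
Proof. by move=> oA; exact: sub_sigma_algebra. Qed.

Lemma measurable_closed_borelE (A : set 'rV[R]_d) : closed A ->
  @measurable _ (borelE R d) A.
Proof.
move=> cA; rewrite -(setCK A); apply: measurableC.
by apply: measurable_open_borelE; exact/closed_openC.
Qed.

Lemma measurable_eball x r : @measurable _ (borelE R d) (eball x r).
Proof. by apply: measurable_open_borelE; exact: open_eball. Qed.

Lemma eball_sub x y r s : enorm (x - y) + r <= s -> eball y r `<=` eball x s.
Proof.
by move=> h z; rewrite /eball/= => yz; have := enorm_dist y x z; lra.
Qed.

Lemma le_eball nu x y r s : enorm (x - y) + r <= s -> (nu (eball y r) <= nu (eball x s))%E.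
Proof.
by move=> h; rewrite le_measure ?inE//; [exact: measurable_eball..|exact: eball_sub].
Qed.

Lemma closed_supp nu : closed (supp nu).
Proof.
rewrite -openC; apply/open_enormP => x /existsNP[r /not_implyP[r0 nr]].
exists (r / 2); first by rewrite divr_gt0.
move=> y xy sy; apply: nr; apply: lt_le_trans (sy (r / 2) _) _.
  by rewrite divr_gt0.
by apply: le_eball; lra.
Qed.

Lemma rat_dense_enorm x (e : R) : 0 < e ->
  exists q : 'rV[rat]_d, enorm (x - map_mx ratr q) < e.
Proof.
move=> e0; pose t := e / (d%:R + 1).
have t0 : 0 < t by rewrite divr_gt0// ltr_wpDl.
have H i : exists q : rat, `|x ord0 i - ratr q| < t.
  have : x ord0 i - t < x ord0 i + t by lra.
  move=> /rat_in_itvoo[q]; rewrite in_itv/= => /andP[q1 q2]; exists q.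
  by rewrite ltr_norml; apply/andP; split; lra.
have [q Hq] := choice H.
exists (\row_i q i); apply: le_lt_trans (enorm_le_sum _) _.
apply: (@le_lt_trans _ _ (\sum_(i < d) t)).
  by apply: ler_sum => i _; rewrite !mxE ltW.
rewrite sumr_const card_ord -mulr_natl /t mulrA ltr_pdivrMr ?ltr_wpDl//.
by rewrite mulrC ltr_pM2l// ltrDl.
Qed.

(** A point off the support has a null ball around it, hence lies in a null ball with rational
    centre and radius [k.+1%:R^-1]; there are countably many of these. *)
Lemma supp_conull nu : nu (~` supp nu) = 0%E.
Proof.
pose B (qk : 'rV[rat]_d * nat) : set (borelE R d) :=
  eball (map_mx ratr qk.1) (qk.2.+1%:R^-1).
pose F (n : nat) : set (borelE R d) :=
  if unpickle n is Some qk then (if nu (B qk) == 0%E then B qk else set0) else set0.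
have mF n : measurable (F n).
  rewrite /F; case: unpickle => // qk; case: ifP => // _; exact: measurable_eball.
have F0 n : nu (F n) = 0%E.
  rewrite /F; case: unpickle => [qk|]; last exact: measure0.
  by case: ifPn => [/eqP//|_]; exact: measure0.
have sub : ~` supp nu `<=` \bigcup_n F n.
  move=> x /existsNP[r /not_implyP[r0 nr]].
  pose k := Num.truncn (2 / r).
  have k0 : 0 < k.+1%:R^-1 :> R by rewrite invr_gt0.
  have kr : k.+1%:R^-1 < r / 2.
    rewrite -[X in _ < X]invrK ltf_pV2 ?posrE ?invr_gt0 ?divr_gt0// invf_div.
    exact: truncnS_gt.
  have [q xq] := rat_dense_enorm x k0.
  exists (pickle (q, k)) => //; rewrite /F pickleK /=.
  have -> : nu (B (q, k)) == 0%E.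
    rewrite -measure_le0; move/negP: nr; rewrite -leNgt; apply: le_trans.
    apply: le_eball => /=; 
    have -> : r = r / 2 + r / 2 by lra.
    by apply: lerD (ltW kr); exact: ltW (lt_trans xq kr).
  by rewrite /B /eball/= enormB.
have mU : measurable (\bigcup_n F n) by exact: bigcup_measurable.
have msupp : @measurable _ (borelE R d) (~` supp nu).
  by apply: measurableC; apply: measurable_closed_borelE; exact: closed_supp.
apply/eqP; rewrite -measure_le0.
apply: (@le_trans _ _ (nu (\bigcup_n F n))); first by rewrite le_measure ?inE.
apply: le_trans (@measure_sigma_subadditive _ _ _ nu _ F mF mU (@subset_refl _ _)) _.
by rewrite eseries0// => n _ _; exact: F0.
Qed.

Lemma supp_meets nu (A : set (borelE R d)) : measurable A -> (0 < nu A)%E ->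
  exists2 s, supp nu s & A s.
Proof.
move=> mA A0; apply: contrapT => nex.
suff : nu A = 0%E by move=> A00; rewrite A00 ltxx in A0.
apply/eqP; rewrite -measure_le0 -(supp_conull nu) le_measure ?inE//.
  by apply: measurableC; apply: measurable_closed_borelE; exact: closed_supp.
by move=> a Aa sa; apply: nex; exists a.
Qed.

Lemma mass_full nu (A : set (borelE R d)) : measurable A -> nu setT = 1%E ->
  supp nu `<=` A -> nu A = 1%E.
Proof.
move=> mA n1 sA.
have c0 : nu (~` A) = 0%E.
  apply/eqP; rewrite -measure_le0 -(supp_conull nu) le_measure ?inE//.
  - exact: measurableC.
  - by apply: measurableC; apply: measurable_closed_borelE; exact: closed_supp.
  - by apply: subsetC.
have : nu (A `|` ~` A) = (nu A + nu (~` A))%E.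
  by apply: measureU => //; [exact: measurableC|exact: setICr].
by rewrite setUv c0 adde0 n1.
Qed.

End support.

Section delta_dtm.
Variables (R : realType) (d : nat) (m p D : R) (K : set 'rV[R]_d).
Hypotheses (m0 : 0 < m) (m1 : m < 1) (p1 : 1 <= p).
Hypothesis KD : forall x y, K x -> K y -> enorm (x - y) <= D.
Notation lambda := (@lebesgue_measure R).
Implicit Types (nu : {measure set (borelE R d) -> \bar R}) (x : 'rV[R]_d).

Lemma delta_ge0 nu u x : (0 <= delta nu u x)%E.
Proof. by apply: le_ereal_inf_tmp => _ [r [r0 _] <-]; rewrite lee_fin ltW. Qed.

(** Monotonicity in [u], the Lipschitz property in [x] and the comparison of two measures all have
    this form: every radius that counts for one infimum counts for the other once increased by
    [c]. *)
Lemma delta_shift nu nu' u u' x x' c :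
  (forall r, 0 < r -> (u%:E < nu (eball x r))%E ->
     0 < r + c /\ (u'%:E < nu' (eball x' (r + c)))%E) ->
  (delta nu' u' x' <= delta nu u x + c%:E)%E.
Proof.
move=> h; rewrite -leeBlDr//; apply: le_ereal_inf_tmp => _ [r [r0 ur] <-].
rewrite leeBlDr// -EFinD; apply: ereal_inf_lbound.
by have [? ?] := h r r0 ur; exists (r + c).
Qed.

Lemma delta_mono nu u u' x : u <= u' -> (delta nu u x <= delta nu u' x)%E.
Proof.
move=> uu; rewrite -[leRHS]adde0; apply: delta_shift => r r0 ur; rewrite addr0; split => //.
by apply: le_lt_trans ur; rewrite lee_fin.
Qed.

Lemma delta_le_diam nu u x : nu setT = 1%E -> supp nu `<=` K -> K x -> u < 1 ->
  (delta nu u x <= D%:E)%E.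
Proof.
move=> n1 sK Kx u1; have D0 : 0 <= D.
  by apply: le_trans (KD Kx Kx); exact: enorm_ge0.
apply/lee_addgt0Pr => e e0; apply: ereal_inf_lbound; exists (D + e) => //; split.
  by rewrite ltr_wpDl.
rewrite (mass_full (measurable_eball _ _) n1) ?lte_fin//.
by move=> s /sK Ks; rewrite /eball/=; have := KD Kx Ks; lra.
Qed.

(** A real version of [delta]. Clamping the level to [[0, m]] makes it nondecreasing on the whole
    line for points of [K], hence measurable. *)
Definition dl nu x (u : R) := fine (delta nu (Num.min (Num.max 0 u) m) x).

Lemma clampP (u : R) : 0 <= Num.min (Num.max 0 u) m <= m.
Proof. by rewrite le_min le_max lexx (ltW m0) ge_min lexx orbT. Qed.

Lemma dl_fin nu x u : nu setT = 1%E -> supp nu `<=` K -> K x -> u < 1 ->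
  delta nu u x \is a fin_num.
Proof.
move=> n1 sK Kx u1; rewrite ge0_fin_numE ?delta_ge0//.
by apply: le_lt_trans (delta_le_diam n1 sK Kx u1) _; rewrite ltry.
Qed.

Lemma dl_ge0 nu x u : 0 <= dl nu x u.
Proof. by apply: fine_ge0; exact: delta_ge0. Qed.

Lemma dl_measurable nu x : nu setT = 1%E -> supp nu `<=` K -> K x ->
  measurable_fun setT (dl nu x).
Proof.
move=> n1 sK Kx; apply: nondecreasing_measurable => // u v uv.
have [/andP[_ u1] /andP[_ v1]] := (clampP u, clampP v).
apply: fine_le.
- by apply: dl_fin => //; exact: le_lt_trans m1.
- by apply: dl_fin => //; exact: le_lt_trans m1.
by apply: delta_mono; rewrite le_min2// le_max2.
Qed.

Lemma dtm_dl nu x : nu setT = 1%E -> supp nu `<=` K -> K x ->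
  dtm m p nu x =
  (((m^-1)%:E * \int[lambda]_(u in `[0%R, m]) ((dl nu x u)%:E `^ p)) `^ p^-1)%E.
Proof.
move=> n1 sK Kx; rewrite /dtm; congr (_ `^ _)%E; congr (_ * _)%E.
apply: eq_integral => u; rewrite inE => ut.
have /andP[u0 um] : 0 <= u <= m by move: ut; rewrite /= in_itv.
by rewrite /dl max_r// min_l// fineK// dl_fin//; exact: le_lt_trans m1.
Qed.

Lemma dtm_shift nu nu' x x' c : nu setT = 1%E -> supp nu `<=` K -> K x ->
  nu' setT = 1%E -> supp nu' `<=` K -> K x' -> 0 <= c ->
  (forall u, 0 <= u -> u <= m -> (delta nu' u x' <= delta nu u x + c%:E)%E) ->
  (dtm m p nu' x' <= dtm m p nu x + c%:E)%E.
Proof.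
move=> n1 sK Kx n1' sK' Kx' c0 h; rewrite !dtm_dl//.
apply: power_mean_le => //; try exact: dl_measurable; try exact: dl_ge0.
move=> u u0 um; rewrite /dl max_r// min_l//.
have u1 : u < 1 by exact: le_lt_trans m1.
by rewrite -lee_fin EFinD !fineK ?dl_fin//; exact: h.
Qed.

Lemma dtm_le_diam nu x : nu setT = 1%E -> supp nu `<=` K -> K x ->
  (dtm m p nu x <= D%:E)%E.
Proof.
move=> n1 sK Kx; have D0 : 0 <= D.
  by apply: le_trans (KD Kx Kx); exact: enorm_ge0.
have p0 : 0 < p by exact: lt_le_trans p1.
rewrite dtm_dl//.
have -> : D%:E = (((m^-1)%:E * \int[lambda]_(u in `[0%R, m]) ((0 : R)%:E `^ p)) `^ p^-1 + D%:E)%E.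
  under eq_integral do rewrite poweR0r ?gt_eqF//.
  by rewrite integral0 mule0 poweR0r ?invr_eq0 ?gt_eqF// add0e.
apply: (@power_mean_le _ _ _ _ _ (fun=> 0)) => //; try exact: dl_measurable; try exact: dl_ge0.
move=> u u0 um; rewrite add0r /dl max_r// min_l//.
have u1 : u < 1 by exact: le_lt_trans m1.
by rewrite -lee_fin fineK ?dl_fin// delta_le_diam.
Qed.

Lemma dtm_ge0 nu x : (0 <= dtm m p nu x)%E. Proof. exact: poweR_ge0. Qed.

Lemma dtm_fineK nu x : nu setT = 1%E -> supp nu `<=` K -> K x ->
  dtm m p nu x = (fine (dtm m p nu x))%:E.
Proof.
move=> n1 sK Kx; rewrite fineK// ge0_fin_numE ?dtm_ge0//.
by apply: le_lt_trans (dtm_le_diam n1 sK Kx) _; rewrite ltry.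
Qed.

Lemma dtm_lip nu x y : nu setT = 1%E -> supp nu `<=` K -> K x -> K y ->
  (dtm m p nu x <= dtm m p nu y + (enorm (x - y))%:E)%E.
Proof.
move=> n1 sK Kx Ky; apply: dtm_shift => //; first exact: enorm_ge0.
move=> u u0 um; apply: delta_shift => r r0 ur; split.
  by rewrite ltr_pwDl// enorm_ge0.
by apply: lt_le_trans ur _; apply: le_eball; rewrite addrC.
Qed.

End delta_dtm.

(** * From deviations on a net of balls to deviations of [delta] *)

Section deviation.
Variables (R : realType) (d : nat) (a b t tau eps D : R) (K : set 'rV[R]_d).
Variables (mu nu : {measure set (borelE R d) -> \bar R}).
Hypotheses (mu1 : mu setT = 1%E) (nu1 : nu setT = 1%E).
Hypotheses (sK : supp mu `<=` K) (snu : supp nu `<=` supp mu).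
Hypotheses (csupp : connected (supp mu)) (std : standard a b mu).
Hypotheses (t0 : 0 <= t) (t1 : t < 2^-1) (eps0 : 0 < eps) (tau0 : 0 < tau).
Hypotheses (tau1 : tau <= a `^ (- b^-1)) (tmass : t < a * tau `^ b).
Hypothesis dev : forall x, K x -> exists2 z, enorm (x - z) <= eps & forall j : nat,
  (nu (eball z (j%:R * eps)) <= mu (eball z (j%:R * eps)) + t%:E)%E /\
  (mu (eball z (j%:R * eps)) <= nu (eball z (j%:R * eps)) + t%:E)%E.

(** A ball around a net point, with radius a multiple of [eps] between [r + eps] and [r + 2 * eps],
    fits between the balls of radii [r] and [r + 3 * eps] around [x]. *)
Lemma dev_ball x r : K x -> 0 < r ->
  (nu (eball x r) <= mu (eball x (r + 3 * eps)) + t%:E)%E /\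
  (mu (eball x r) <= nu (eball x (r + 3 * eps)) + t%:E)%E.
Proof.
move=> Kx r0; have [z xz zd] := dev Kx.
pose j := (Num.truncn ((r + eps) / eps)).+1.
have q0 : 0 <= (r + eps) / eps by rewrite divr_ge0 ?addr_ge0 ?ltW.
have j1 : r + eps <= j%:R * eps.
  by rewrite -ler_pdivrMr//; apply/ltW/truncnS_gt.
have j2 : j%:R * eps <= r + 2 * eps.
  have jE : j%:R = (Num.truncn ((r + eps) / eps))%:R + 1 :> R by rewrite /j -natr1.
  rewrite jE mulrDl mul1r.
  have -> : r + 2 * eps = (r + eps) + eps by ring.
  by rewrite lerD2r -ler_pdivlMr//; have := truncn_itv q0 => /andP[].
have in1 : enorm (z - x) + r <= j%:R * eps by rewrite enormB; move: xz; lra.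
have in2 : enorm (x - z) + j%:R * eps <= r + 3 * eps by move: xz; lra.
have [d1 d2] := zd j; split.
  apply: le_trans (le_eball nu in1) _; apply: le_trans d1 _.
  by rewrite leeD2r//; exact: le_eball.
apply: le_trans (le_eball mu in1) _; apply: le_trans d2 _.
by rewrite leeD2r//; exact: le_eball.
Qed.

(* The support is connected, so it meets every sphere between a point of it
   inside [eball x r] and a point of it outside [eball x (r + 2 * tau)]. *)
Lemma mass_increase x r s : supp mu s -> enorm (x - s) < r ->
  mu (eball x (r + 2 * tau)) = 1%E \/
  (mu (eball x r) + (a * tau `^ b)%:E <= mu (eball x (r + 2 * tau)))%E.
Proof.
move=> ss xs.
have [full|] := pselect (supp mu `<=` eball x (r + 2 * tau)).
  by left; apply: mass_full => //; exact: measurable_eball.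
move=> /existsNP[q /not_implyP[Fo xo]].
right; have {}xo : r + 2 * tau <= enorm (x - q) by rewrite leNgt; exact/negP.
have [y sy xy] : exists2 y, supp mu y & enorm (x - y) = r + tau.
  have /connected_intervalP cI : connected ((fun y => enorm (x - y)) @` supp mu).
    apply: connected_continuous_connected => //; apply: continuous_subspaceT => y.
    apply: (@continuous_comp 'rV[R]_d 'rV[R]_d R (fun y => x - y) (@enorm R d) y); last exact: enorm_continuous.
    by apply: continuousB; [exact: cst_continuous|exact: cvg_id].
  have : ((fun y => enorm (x - y)) @` supp mu) (r + tau).
    apply: (cI (enorm (x - s)) (enorm (x - q))); [by exists s|by exists q|].
    by apply/andP; split; move: xs xo tau0; lra.
  by move=> [y sy <-]; exists y.
have my := std sy tau0 tau1.
apply: (@le_trans _ _ (mu (eball x r) + mu (eball y tau))%E); first by rewrite leeD2l.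
have dis : eball x r `&` eball y tau = set0.
  apply/seteqP; split => // z [/=]; rewrite /eball/= => h1 h2.
  by have := enorm_dist z x y; rewrite (enormB z y) xy; lra.
have <- : mu (eball x r `|` eball y tau) = (mu (eball x r) + mu (eball y tau))%E.
  by apply: measureU => //; exact: measurable_eball.
rewrite le_measure ?inE//; [|exact: measurable_eball|].
  by apply: measurableU; exact: measurable_eball.
move=> z [|]; rewrite /eball/= => h; first by move: tau0; lra.
by have := enorm_dist y x z; rewrite xy; lra.
Qed.

(** Enlarging the radius by [2 * tau] gains more than [t], which pays for the deviation. If the
    enlarged ball has full mass instead, then 1 exceeds [u + t]; this is where levels up to one half
    are needed. *)
Lemma delta_dev1 u x : K x -> 0 <= u -> u <= 2^-1 ->
  (delta nu u x <= delta mu u x + (2 * tau + 3 * eps)%:E)%E.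
Proof.
move=> Kx u0 u1; apply: delta_shift => r r0 ur.
split; first by rewrite !addr_gt0// !mulr_gt0.
have [|s ss xs] := supp_meets (measurable_eball x r) (le_lt_trans _ ur).
  by rewrite lee_fin.
have h : ((u + t)%:E < mu (eball x (r + 2 * tau)))%E.
  have [->|] := mass_increase ss xs; first by rewrite lte_fin; move: u1 t1; lra.
  apply: lt_le_trans; rewrite EFinD; apply: lteD => //.
have r2 : 0 < r + 2 * tau by rewrite addr_gt0// mulr_gt0.
have [_ h2] := dev_ball Kx r2.
have := lt_le_trans h h2; rewrite EFinD lteD2rE// => h3.
by rewrite addrA.
Qed.

(** Here the deviation [t] is lost first and regained by [mass_increase], which applies because a
    ball charged by [nu] contains a point of the support of [nu], hence of that of [mu]. *)
Lemma delta_dev2 u x : K x -> 0 <= u -> u <= 2^-1 ->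
  (delta mu u x <= delta nu u x + (2 * tau + 3 * eps)%:E)%E.
Proof.
move=> Kx u0 u1; apply: delta_shift => r r0 ur.
split; first by rewrite !addr_gt0// !mulr_gt0.
have [|s ss xs] := supp_meets (measurable_eball x r) (le_lt_trans _ ur).
  by rewrite lee_fin.
have [h _] := dev_ball Kx r0.
have xs' : enorm (x - s) < r + 3 * eps.
  by move: xs; rewrite /eball/=; move: eps0; lra.
rewrite (addrC (2 * tau)) addrA.
have [->|] := mass_increase (snu ss) xs'; first by rewrite lte_fin; move: u1; lra.
apply: lt_le_trans; have := lt_le_trans ur h => h2.
apply: (lt_le_trans h2); rewrite leeD2l// lee_fin; exact: ltW.
Qed.

End deviation.

(** * Deviations of the empirical measure *)

Section sampling.
Variables (R : realType) (dO : measure_display) (Omega : measurableType dO)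
  (P : probability Omega R) (d n : nat) (mu : probability (borelE R d) R)
  (X : 'I_n -> {RV P >-> borelE R d}).
Hypothesis iid : iid_sample mu X.
Hypothesis n0 : (0 < n)%N.

Let nR : 0 < n%:R :> R. Proof. by rewrite ltr0n. Qed.

Definition hits (A : set (borelE R d)) (w : Omega) : R :=
  \sum_(k < n) \1_A (X k w).

Lemma empiricalE A w : empirical (fun k => X k w) A = (n%:R^-1 * hits A w)%:E.
Proof.
rewrite /empirical /hits EFinM; congr (_ * _)%E; rewrite -sumEFin.
by apply: eq_bigr => k _; rewrite diracE indicE.
Qed.

Lemma measurable_sample k (A : set (borelE R d)) : measurable A ->
  measurable (X k @^-1` A).
Proof. by move=> mA; rewrite -[X in measurable X]setTI; exact: measurable_funP. Qed.

Lemma law_sample k (A : set (borelE R d)) : measurable A -> P (X k @^-1` A) = mu A.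
Proof. by move=> mA; have [_ h] := iid; rewrite -(h k A mA). Qed.

Lemma indic_sample (A : set (borelE R d)) k w :
  \1_A (X k w) = \1_(X k @^-1` A) w :> R.
Proof. by rewrite !indicE; congr (_%:R); apply/idP/idP; rewrite !inE. Qed.

Lemma measurable_hits (A : set (borelE R d)) : measurable A -> measurable_fun setT (hits A).
Proof.
move=> mA; apply: measurable_sum => k.
under eq_fun do rewrite indic_sample.
by apply: measurable_indic; exact: measurable_sample.
Qed.

Lemma mu_fin (A : set (borelE R d)) : measurable A -> mu A = (fine (mu A))%:E.
Proof. by move=> mA; rewrite fineK// fin_num_measure. Qed.

Lemma fine_mu_ge0 (A : set (borelE R d)) : 0 <= fine (mu A).
Proof. by rewrite fine_ge0// measure_ge0. Qed.

Lemma fine_mu_le1 (A : set (borelE R d)) : measurable A -> fine (mu A) <= 1.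
Proof. by move=> mA; rewrite -lee_fin -mu_fin// probability_le1. Qed.

Lemma joint_law (J : {set 'I_n}) (A : set (borelE R d)) : measurable A ->
  P (\bigcap_(i in [set` J]) (X i @^-1` A)) = (fine (mu A) ^+ #|J|)%:E.
Proof.
move=> mA; have [ind _] := iid; rewrite (ind J (fun=> A))//.
under eq_bigr => i _ do rewrite law_sample// mu_fin//.
by rewrite prodEFin prodr_const.
Qed.

Lemma prod_indic (J : {set 'I_n}) (A : set (borelE R d)) w :
  \prod_(k in J) \1_A (X k w) = \1_(\bigcap_(i in [set` J]) (X i @^-1` A)) w :> R.
Proof.
rewrite [RHS]indicE; case: (boolP (w \in _)) => [/set_mem h|h].
  rewrite big1// => k kJ; rewrite indicE mem_set//; exact: h.
have [k kJ nk] : exists2 k, k \in J & ~ A (X k w).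
  apply: contrapT => nex; move/negP: h; apply; apply/mem_set => k kJ /=.
  by apply: contrapT => nA; apply: nex; exists k.
by rewrite (bigD1 k)//= indicE memNset// mul0r.
Qed.

(** Expanding the product over subsets [J] of the indices turns each term into the probability of an
    intersection, which is exactly what [mutually_independent] gives. *)
Lemma mgf_sample (A : set (borelE R d)) (c : R) : measurable A -> 0 <= c ->
  (\int[P]_w (\prod_(k < n) (1 + c * \1_A (X k w)))%:E =
   ((1 + c * fine (mu A)) ^+ n)%:E)%E.
Proof.
move=> mA c0.
have E1 (f : 'I_n -> R) : \prod_(k < n) (1 + c * f k) =
    \sum_(J : {set 'I_n}) c ^+ #|J| * \prod_(k in J) f k.
  under eq_bigr do rewrite addrC.
  rewrite bigA_distr; apply: eq_bigr => J _.
  rewrite -prodr_const -big_split/= [RHS]big_mkcond/=.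
  by apply: eq_bigr => k _; case: ifP.
pose B (J : {set 'I_n}) := \bigcap_(i in [set` J]) (X i @^-1` A).
have mB J : measurable (B J).
  apply: fin_bigcap_measurable => [|i _]; first exact: finite_finset || exact: finite_finpred.
  exact: measurable_sample.
under eq_integral => w _.
  rewrite E1; under eq_bigr do rewrite prod_indic.
  rewrite -sumEFin; over.
rewrite ge0_integral_sum//; last 2 first.
- move=> J; apply/measurable_EFinP; apply: measurable_funM => //.
  exact/measurable_indic/mB.
- by move=> J w _; rewrite lee_fin mulr_ge0// exprn_ge0.
have -> : (1 + c * fine (mu A)) ^+ n =
    \sum_(J : {set 'I_n}) c ^+ #|J| * fine (mu A) ^+ #|J|.
  rewrite -[n in LHS]card_ord -prodr_const (E1 (fun=> fine (mu A))).
  by apply: eq_bigr => J _; rewrite prodr_const.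
rewrite -sumEFin; apply: eq_bigr => J _.
under eq_integral do rewrite EFinM.
rewrite ge0_integralZl//; last 2 first.
- by apply/measurable_EFinP/measurable_indic/mB.
- by rewrite lee_fin exprn_ge0.
rewrite integral_indic//; last exact: mB.
rewrite setIT EFinM; congr (_ * _)%E; exact: joint_law.
Qed.

(** From [1 - x <= expR (- x)] and [(1 - x) * (1 + x + 2 * x ^+ 2) = 1 + x ^+ 2 * (1 - 2 * x)]. *)
Lemma expR_le_quadratic (x : R) : 0 <= x -> x <= 2^-1 -> expR x <= 1 + x + 2 * x ^+ 2.
Proof.
move=> x0 x1; have := expR_ge1Dx (- x); rewrite expRN => h.
have e0 := expR_gt0 x.
have h1 : (1 - x) * expR x <= 1 by rewrite -ler_pdivlMr// div1r.
have h2 : 1 <= (1 - x) * (1 + x + 2 * x ^+ 2) by rewrite expr2; nra.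
have x1' : 0 < 1 - x by lra.
by rewrite -(ler_pM2l x1'); exact: le_trans h1 h2.
Qed.

(** Markov's inequality for [expR (l * hits A w)], the product of the factors [1 + c * \1_A (X k w)]
    with [c = expR l - 1]. The choice [l = t / 4] minimizes [2 * l ^+ 2 - l * t], with value
    [- (t ^+ 2 / 8)]. *)
Lemma chernoff_upper (A : set (borelE R d)) (t : R) : measurable A -> 0 < t -> t <= 1 ->
  (P [set w | (mu A + t%:E <= empirical (fun k => X k w) A)%E] <=
   (expR (- (n%:R * t ^+ 2 / 8)))%:E)%E.
Proof.
move=> mA t0 t1; pose l := t / 4; pose c := expR l - 1.
have l0 : 0 < l by rewrite divr_gt0.
have lh : l <= 2^-1 by rewrite /l; lra.
have c0 : 0 <= c by rewrite subr_ge0 -expR0 ler_expR ltW.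
set q := fine (mu A); have q0 : 0 <= q by exact: fine_mu_ge0.
have q1 : q <= 1 by exact: fine_mu_le1.
pose s := n%:R * (q + t).
set E := [set w | _].
have EE : E = hits A @^-1` `[s, +oo[%classic.
  apply/seteqP; split => w; rewrite /E /s /= in_itv/= andbT empiricalE mu_fin// -EFinD lee_fin;
    by rewrite ler_pdivlMl.
have mE : measurable E.
  by rewrite EE -[X in measurable X]setTI; apply: measurable_hits.
have markov : ((expR (l * s))%:E * P E <= ((1 + c * q) ^+ n)%:E)%E.
  rewrite -(mgf_sample mA c0) -[X in (_ * P X)%E]setIT -integral_indic//.
  rewrite -ge0_integralZl//; try by
    [apply/measurable_EFinP/measurable_indic | rewrite lee_fin expR_ge0].
  apply: ge0_le_lower_integral => w _.
    by rewrite -EFinM lee_fin mulr_ge0// expR_ge0.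
  rewrite -EFinM lee_fin indicE; case: (boolP (w \in E)) => [|_]; last first.
    rewrite mulr0; apply: prodr_ge0 => k _.
    by rewrite addr_ge0// mulr_ge0.
  rewrite inE EE /= in_itv/= andbT mulr1 => hs.
  apply: (@le_trans _ _ (expR (l * hits A w))).
    by rewrite ler_expR ler_wpM2l// ltW.
  rewrite /hits mulr_sumr expR_sum le_eqVlt; apply/orP; left; apply/eqP.
  apply: eq_bigr => k _; rewrite indicE; case: (_ \in _).
    by rewrite !mulr1 /c addrC subrK.
  by rewrite !mulr0 expR0 addr0.
have e0 : 0 < expR (l * s) by exact: expR_gt0.
rewrite -lee_pdivlMl// in markov; apply: (le_trans markov).
rewrite -EFinM lee_fin -expRN.
have h1 : (1 + c * q) ^+ n <= expR (n%:R * (c * q)).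
  rewrite expRM_natl; apply: lerXn2r; rewrite ?nnegrE ?expR_ge0 ?expR_ge1Dx//.
  by apply: addr_ge0 => //; exact: mulr_ge0.
apply: (le_trans (ler_wpM2l (expR_ge0 _) h1)).
rewrite -expRD ler_expR.
have ce : c <= l + 2 * l ^+ 2.
  by rewrite /c lerBlDl addrA; apply: expR_le_quadratic => //; exact: ltW.
have h2 : c * q <= l * q + 2 * l ^+ 2.
  have := ler_wpM2r q0 ce; have : 2 * l ^+ 2 * q <= 2 * l ^+ 2.
    by rewrite -[X in _ <= X]mulr1 ler_wpM2l// mulr_ge0// sqr_ge0.
  lra.
have -> : - (l * s) + n%:R * (c * q) = n%:R * (c * q - l * q - l * t) by rewrite /s; ring.
apply: (@le_trans _ _ (n%:R * (- (t ^+ 2 / 8)))); last by rewrite mulrN mulrA.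
apply: ler_wpM2l; first exact: ler0n.
have : l * t = 2 * (t ^+ 2 / 8) by rewrite /l; field.
have : 2 * l ^+ 2 = t ^+ 2 / 8 by rewrite /l; field.
lra.
Qed.

(** Too small a mass for [A] is too large a mass for its complement. *)
Lemma chernoff_lower (A : set (borelE R d)) (t : R) : measurable A -> 0 < t -> t <= 1 ->
  (P [set w | (empirical (fun k => X k w) A + t%:E <= mu A)%E] <=
   (expR (- (n%:R * t ^+ 2 / 8)))%:E)%E.
Proof.
move=> mA t0 t1; apply: le_trans (chernoff_upper (measurableC mA) t0 t1).
suff -> : [set w | (empirical (fun k => X k w) A + t%:E <= mu A)%E] =
  [set w | (mu (~` A) + t%:E <= empirical (fun k => X k w) (~` A))%E] by [].
have hC w : hits (~` A) w = n%:R - hits A w.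
  rewrite /hits; apply/eqP; rewrite eq_sym subr_eq -big_split/=.
  rewrite (eq_bigr (fun=> 1)); first by rewrite sumr_const card_ord.
  move=> k _; rewrite !indicE in_setC; case: (_ \in _); rewrite ?addr0 ?add0r//.
apply/seteqP; split => w /=; rewrite !empiricalE probability_setC// mu_fin// -!EFinB -!EFinD !lee_fin hC;
  rewrite mulrBr mulVf ?gt_eqF//; lra.
Qed.

Lemma measurable_dev_upper (A : set (borelE R d)) (t : R) : measurable A ->
  measurable [set w | (mu A + t%:E <= empirical (fun k => X k w) A)%E].
Proof.
move=> mA.
have -> : [set w | (mu A + t%:E <= empirical (fun k => X k w) A)%E] =
   hits A @^-1` `[n%:R * (fine (mu A) + t), +oo[%classic.
  apply/seteqP; split => w; rewrite /= in_itv/= andbT empiricalE mu_fin// -EFinD lee_fin;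
    by rewrite ler_pdivlMl.
by rewrite -[X in measurable X]setTI; apply: measurable_hits.
Qed.

Lemma measurable_dev_lower (A : set (borelE R d)) (t : R) : measurable A ->
  measurable [set w | (empirical (fun k => X k w) A + t%:E <= mu A)%E].
Proof.
move=> mA.
have -> : [set w | (empirical (fun k => X k w) A + t%:E <= mu A)%E] =
   hits A @^-1` `]-oo, (n%:R * (fine (mu A) - t))]%classic.
  apply/seteqP; split => w; rewrite /= in_itv/= empiricalE mu_fin// -EFinD lee_fin;
    by rewrite -lerBrDr ler_pdivrMl.
by rewrite -[X in measurable X]setTI; apply: measurable_hits.
Qed.

Lemma no_hit_le (A : set (borelE R d)) (q : R) : measurable A -> (q%:E <= mu A)%E ->
  (P (\bigcap_(k in [set: 'I_n]) (X k @^-1` (~` A))) <= (expR (- (n%:R * q)))%:E)%E.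
Proof.
move=> mA qA.
have -> : \bigcap_(k in [set: 'I_n]) (X k @^-1` (~` A)) =
    \bigcap_(k in [set` [set: 'I_n]%SET]) (X k @^-1` (~` A)).
  by apply: eq_bigcapl; split => k //= _; rewrite inE.
rewrite joint_law; last exact: measurableC.
rewrite cardsT card_ord probability_setC// mu_fin// -EFinB /= lee_fin -mulrN expRM_natl.
have a1 := fine_mu_le1 mA; have a0 := fine_mu_ge0 A.
have : q <= fine (mu A) by rewrite -lee_fin -mu_fin.
move=> qa; apply: (@le_trans _ _ (expR (- fine (mu A)) ^+ n)).
  by rewrite lerXn2r ?nnegrE ?expR_ge0 ?subr_ge0// expR_ge1Dx.
by rewrite lerXn2r ?nnegrE ?expR_ge0// ler_expR lerN2.
Qed.

End sampling.

(** * Nets of balls *)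

Section geometry.
Variables (R : realType) (d : nat).
Implicit Types K : set 'rV[R]_d.

Lemma convex_segment_closed K : convex_set K -> segment_closed K.
Proof.
move=> cK x y t Kx Ky t0 t1.
have t01 : Itv.spec (@Itv.num_sem R) (Itv.Real `[0, 1]%Z) t.
  by rewrite /= /Itv.num_sem/= num_real/= in_itv/= t0 t1.
have := cK y x (Itv.mk t01) (mem_set Ky) (mem_set Kx).
rewrite inE; congr (K _); rewrite segE addrC.
by [].
Qed.

Lemma le_diam K x y : compact K -> K x -> K y -> enorm (x - y) <= diam K.
Proof.
move=> cK Kx Ky; apply: sup_ubound; last by exists x => //; exists y.
have [M [_ /(_ (M + 1))]] := compact_bounded cK.
rewrite ltrDl ltr01 => /(_ isT) KM.
exists (d%:R * ((M + 1) + (M + 1))) => _ [u Ku [v Kv <-]].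
apply: (le_trans (enorm_le_norm _)); rewrite ler_wpM2l//.
by apply: (le_trans (ler_normB _ _)); apply: lerD; exact: KM.
Qed.

Lemma unit_vector : (0 < d)%N -> exists u : 'rV[R]_d, enorm u = 1.
Proof.
move=> d0; exists (delta_mx ord0 (Ordinal d0)).
rewrite /enorm (bigD1 (Ordinal d0))//= big1 => [|i ni].
  by rewrite !mxE !eqxx expr1n addr0 sqrtr1.
by rewrite mxE (negbTE ni) andbF expr0n.
Qed.

(** A cubic lattice of half-width [D] around [x0]. The mesh [D / (n * d)] is an error allowed in
    each of the [d] coordinates, which gives [D / n] in Euclidean norm. *)
Definition grid (n : nat) (x0 : 'rV[R]_d) (D : R)
    (f : {ffun 'I_d -> 'I_(2 * n * d).+1}) : 'rV[R]_d :=
  \row_i (x0 ord0 i + ((f i)%:R - (n * d)%:R) * (D / (n * d)%:R)).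

Lemma gridP (n : nat) (x0 x : 'rV[R]_d) (D : R) : (0 < n)%N -> (0 < d)%N -> 0 < D ->
  enorm (x - x0) <= D ->
  exists f, enorm (x - grid x0 D (n := n) f) <= D / n%:R.
Proof.
move=> n0 d0 D0 xD; set M := (n * d)%N; set s := D / M%:R.
have M0 : 0 < M%:R :> R by rewrite ltr0n muln_gt0 n0.
have s0 : 0 < s by exact: divr_gt0.
have H i : exists k : 'I_(2 * n * d).+1,
    `|x ord0 i - (x0 ord0 i + (k%:R - M%:R) * s)| <= s.
  have := coord_le_enorm (x - x0) i; rewrite !mxE => xi.
  have {xi} := le_trans xi xD; rewrite ler_norml => /andP[x1 x2].
  pose y := (x ord0 i - x0 ord0 i) / s + M%:R.
  have sM : s * M%:R = D by rewrite /s mulfVK// gt_eqF.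
  have y0 : 0 <= y.
    by rewrite /y -lerBlDr sub0r ler_pdivlMr// mulNr mulrC sM.
  have y2 : y <= (2 * n * d)%:R.
    have -> : (2 * n * d)%:R = M%:R + M%:R :> R by rewrite -mulnA natrM -/M; ring.
    by rewrite /y lerD2r ler_pdivrMr// mulrC sM.
  have /andP[k1 k2] := truncn_itv y0.
  have kM : (Num.truncn y < (2 * n * d).+1)%N.
    by rewrite ltnS -(ler_nat R); exact: le_trans k1 y2.
  exists (Ordinal kM) => /=.
  have xy : x ord0 i = x0 ord0 i + (y - M%:R) * s.
    by rewrite /y addrK mulfVK ?gt_eqF// subrKC.
  rewrite {1}xy opprD addrACA subrr add0r -mulrBl opprB addrA subrK normrM.
  rewrite (gtr0_norm s0) ger_pMl//.
  rewrite ger0_norm ?subr_ge0// lerBlDl ltW//.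
  by rewrite natr1.
have [f Hf] := choice H.
exists (finfun f); apply: (le_trans (enorm_le_sum _)).
apply: (@le_trans _ _ (\sum_(i < d) s)).
  by apply: ler_sum => i _; rewrite !mxE ffunE.
rewrite sumr_const card_ord -mulr_natl /s /M natrM le_eqVlt; apply/orP; left; apply/eqP.
by field; rewrite !pnatr_eq0 -!lt0n n0 d0.
Qed.

End geometry.

Section counting.
Variable R : realType.

Lemma ln_ge_half (n : nat) : (2 <= n)%N -> 2^-1 <= ln (n%:R : R).
Proof.
move=> n2; have n0 : 0 < n%:R :> R by rewrite ltr0n (leq_trans _ n2).
rewrite -ler_expR lnK ?posrE//.
have h : expR (2^-1 : R) <= 1 + 2^-1 + 2 * 2^-1 ^+ 2.
  by apply: expR_le_quadratic => //; rewrite invr_ge0.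
apply: (le_trans h); apply: (@le_trans _ _ 2); last by rewrite ler_nat.
by rewrite expr2; lra.
Qed.

(** The left-hand side multiplies the number of net points by the number of radii, by 2 for the two
    sides of a deviation, and by a margin [n]. There are at most exp (3 * d * ln n + d ^ 2) net
    points, and the other factors give at most n ^ 4. Since 2 * ln n >= 1, the contributions to the
    exponent are 3, 2 and 4, whence the 9. *)
Lemma grid_count (n d : nat) : (2 <= n)%N -> (0 < d)%N ->
  (#|{: {ffun 'I_d -> 'I_(2 * n * d).+1}}|%:R * (n + 2)%:R * 2 * n%:R <=
   expR (9 * d%:R ^+ 2 * ln (n%:R : R)) :> R).
Proof.
move=> n2 d0; have hl := ln_ge_half n2; set l := ln _ in hl *.
have n0 : 0 < n%:R :> R by rewrite ltr0n (leq_trans _ n2).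
have nE : n%:R = expR l :> R by rewrite lnK ?posrE.
have n2R : 2 <= n%:R :> R by rewrite ler_nat.
have dR : 1 <= d%:R :> R by rewrite ler1n.
rewrite card_ffun !card_ord natrX.
have h1 : ((2 * n * d).+1)%:R <= expR (3 * l + d%:R) :> R.
  rewrite -natr1 !natrM expRD.
  have -> : expR (3 * l) = n%:R ^+ 3 :> R by rewrite expRM_natl nE.
  have : d%:R <= expR d%:R :> R by apply: le_trans (expR_ge1Dx _); rewrite lerDr.
  move: (expR d%:R) => e de.
  have h3 : 3 * n%:R <= n%:R ^+ 3 :> R by rewrite !exprS expr0 mulr1; nra.
  have nd1 : 1 <= n%:R * d%:R :> R by rewrite mulr_ege1// (le_trans _ n2R)// ler1n.
  apply: (@le_trans _ _ (3 * n%:R * d%:R)); first by rewrite -!mulrA; move: nd1; lra.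
  by apply: ler_pM => //; rewrite mulr_ge0// ltW.
have h2 : ((2 * n * d).+1)%:R ^+ d <= expR (d%:R * (3 * l + d%:R)) :> R.
  by rewrite expRM_natl; apply: lerXn2r; rewrite ?nnegrE ?expR_ge0.
have h3 : (n + 2)%:R * 2 * n%:R <= expR (4 * l) :> R.
  rewrite expRM_natl -nE natrD; move: (n%:R : R) n2R => x x2.
  have x4 : 4 <= x * x by nra.
  have h4 : (x + 2) * 2 * x <= 4 * (x * x) by nra.
  have h5 : 4 * (x * x) <= (x * x) * (x * x) by apply: ler_wpM2r => //; nra.
  by apply: (le_trans h4); apply: (le_trans h5); rewrite !exprS expr0 mulr1 !mulrA.
rewrite -!mulrA (mulrA (n + 2)%:R).
apply: (le_trans (ler_pM _ _ h2 h3)).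
- by rewrite exprn_ge0.
- by rewrite !mulr_ge0.
rewrite -expRD ler_expR.
have d2 : d%:R <= d%:R ^+ 2 :> R by rewrite expr2 ler_peMr// ltW// (lt_le_trans ltr01).
have dd : 1 <= d%:R ^+ 2 :> R by exact: le_trans d2.
have e1 : d%:R * l <= d%:R ^+ 2 * l by rewrite ler_wpM2r//; lra.
have e2 : d%:R ^+ 2 <= 2 * (d%:R ^+ 2 * l) :> R.
  rewrite mulrCA -[X in X <= _]mulr1 ler_wpM2l//; lra.
have e3 : l <= d%:R ^+ 2 * l by rewrite ler_peMl//; lra.
rewrite mulrDr -expr2; lra.
Qed.

End counting.

(** * The expected deviation *)

Section good_event.
Variables (R : realType) (d : nat) (m p beta a b sigma : R) (K : set 'rV[R]_d).
Variables (mu : probability (borelE R d) R).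
Hypotheses (m0 : 0 < m) (m2 : m <= 2^-1) (p1 : 1 <= p) (beta1 : 1 <= beta).
Hypotheses (kK : compact K) (cK : convex_set K) (sigma0 : 0 < sigma).
Hypothesis (mod_ : model m p K a b sigma mu).
Notation D := (diam K).

Let m1 : m < 1. Proof. by apply: le_lt_trans m2 _; lra. Qed.
Let KD x y : K x -> K y -> enorm (x - y) <= D. Proof. exact: le_diam. Qed.
Let beta0 : 0 <= beta. Proof. exact: le_trans beta1. Qed.
Let mu1 : mu setT = 1%E. Proof. exact: probability_setT. Qed.
Let sK : supp mu `<=` K. Proof. by case: mod_. Qed.

Lemma supp_nonempty : exists x, supp mu x.
Proof.
have h : (0 < mu setT)%E by rewrite mu1.
by have [s ss _] := supp_meets measurableT h; exists s.
Qed.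

Lemma sigma_le_diam : sigma <= D.
Proof.
have [s ss] := supp_nonempty; rewrite -lee_fin.
have [_ _ h _] := mod_; apply: (le_trans (h s)).
by apply: (dtm_le_diam m0 m1 p1 KD mu1 sK); exact: sK.
Qed.

Lemma diam_gt0 : 0 < D. Proof. exact: lt_le_trans sigma_le_diam. Qed.

(** In dimension 0 all distances vanish, so the distance to measure would be 0, against its lower
    bound [sigma]. *)
Lemma dim_gt0 : (0 < d)%N.
Proof.
rewrite lt0n; apply/eqP => d0.
have en0 (x : 'rV[R]_d) : enorm x = 0.
  rewrite /enorm big1 ?sqrtr0// => i _.
  by have := ltn_ord i; rewrite {2}d0 ltn0.
have KD0 x y : K x -> K y -> enorm (x - y) <= 0 by rewrite en0.
have [s ss] := supp_nonempty.
have [_ _ h _] := mod_; have := h s.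
have := dtm_le_diam m0 m1 p1 KD0 mu1 sK (sK ss).
by move=> h1 /le_trans/(_ h1); rewrite lee_fin leNgt sigma0.
Qed.

Lemma fdtm_le_diam (nu : {measure set (borelE R d) -> \bar R}) F x y :
  nu setT = 1%E -> supp nu `<=` K -> K x -> K y ->
  (fdtm_on m p beta nu F x y <= (D `^ beta * D)%:E)%E.
Proof.
move=> nu1 snu Kx Ky; have [u u1] := @unit_vector R d dim_gt0.
have nr z : K z -> dtm m p nu z = (fine (dtm m p nu z))%:E.
  by move=> Kz; exact: (dtm_fineK m0 m1 p1 KD).
apply: (le_trans (@fdtm_segment _ m p beta d beta0 nu _ F K x y D u u1 nr
  (convex_segment_closed cK) Kx Ky _ _)).
- by move=> z Kz; apply: fine_ge0; exact: dtm_ge0.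
- move=> z Kz; rewrite -lee_fin -(nr z Kz); exact: (dtm_le_diam m0 m1 p1 KD).
by rewrite lee_fin ler_wpM2l ?powR_ge0// KD.
Qed.

Lemma fdtm_dist_le_diam (nu : {measure set (borelE R d) -> \bar R}) x y :
  nu setT = 1%E -> supp nu `<=` K -> K x -> K y ->
  (`|fdtm m p beta mu x y - fdtm m p beta nu x y| <= (D `^ beta * D)%:E)%E.
Proof.
move=> nu1 snu Kx Ky.
have X1 := fdtm_le_diam (supp mu) mu1 sK Kx Ky.
have Y1 := fdtm_le_diam (supp nu) nu1 snu Kx Ky.
have X0 := fdtm_on_ge0 m p beta mu (supp mu) x y.
have Y0 := fdtm_on_ge0 m p beta nu (supp nu) x y.
rewrite /fdtm; move: X1 Y1 X0 Y0.
move: (fdtm_on _ _ _ mu _ _ _) (fdtm_on _ _ _ nu _ _ _) => [r| |] [s| |]//.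
rewrite !lee_fin => h1 h2 h3 h4; rewrite -?EFinB ?abse_EFin ?lee_fin.
by rewrite ler_norml; apply/andP; split; lra.
Qed.

Lemma fdtm_good_event (nu : {measure set (borelE R d) -> \bar R})
    (t tau eps psi c1 c2 : R) x y :
  nu setT = 1%E -> supp nu `<=` supp mu ->
  t < 2^-1 -> 0 < eps -> 0 < tau -> tau <= a `^ (- b^-1) ->
  t < a * tau `^ b ->
  (forall x, K x -> exists2 z, enorm (x - z) <= eps & forall j : nat,
    (nu (eball z (j%:R * eps)) <= mu (eball z (j%:R * eps)) + t%:E)%E /\
    (mu (eball z (j%:R * eps)) <= nu (eball z (j%:R * eps)) + t%:E)%E) ->
  (forall z, supp mu z -> exists2 g, supp nu g & enorm (g - z) <= c2 * psi ^+ 2 * D) ->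
  0 < psi -> psi <= 1 -> 0 <= c1 -> 0 <= c2 ->
  2 * tau + 3 * eps <= c1 * psi * D -> c1 * psi * D <= sigma / 2 ->
  K x -> K y ->
  (`|fdtm m p beta mu x y - fdtm m p beta nu x y| <=
   (rate_const beta (sigma / D) c1 c2 * psi * (D `^ beta * D))%:E)%E.
Proof.
move=> nu1 snu t1 e0 tau0 tau1 tm dev nearG p0 psi1 c10 c20 etaE etas Kx Ky.
have [_ std hs csupp] := mod_.
have snuK := subset_trans snu sK.
have D0 := diam_gt0.
have [u u1] := @unit_vector R d dim_gt0.
have [rho mr] : exists rho, dtm_real m p K mu rho.
  by exists (fun z => fine (dtm m p mu z)) => z Kz; exact: (dtm_fineK m0 m1 p1 KD mu1 sK Kz).
have [rho' nr] : exists rho, dtm_real m p K nu rho.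
  by exists (fun z => fine (dtm m p nu z)) => z Kz; exact: (dtm_fineK m0 m1 p1 KD nu1 snuK Kz).
have rL z z' : K z -> K z' -> rho z <= rho z' + enorm (z - z').
  move=> Kz Kz'; have := dtm_lip m0 m1 p1 KD mu1 sK Kz Kz'.
  by rewrite (mr z Kz) (mr z' Kz') -EFinD lee_fin.
have rL' z z' : K z -> K z' -> rho' z <= rho' z' + enorm (z - z').
  move=> Kz Kz'; have := dtm_lip m0 m1 p1 KD nu1 snuK Kz Kz'.
  by rewrite (nr z Kz) (nr z' Kz') -EFinD lee_fin.
have te0 : 0 <= 2 * tau + 3 * eps by rewrite addr_ge0// mulr_ge0// ltW.
have rr z : K z -> rho z <= rho' z + c1 * psi * D.
  move=> Kz; have := dtm_shift m0 m1 p1 KD nu1 snuK Kz mu1 sK Kz te0 (fun v v0 vm =>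
    delta_dev2 mu1 snu csupp std e0 tau0 tau1 tm dev Kz v0 (le_trans vm m2)).
  rewrite (mr z Kz) (nr z Kz) -EFinD lee_fin => /le_trans; apply.
  by rewrite lerD2l.
have rr' z : K z -> rho' z <= rho z + c1 * psi * D.
  move=> Kz; have := dtm_shift m0 m1 p1 KD mu1 sK Kz nu1 snuK Kz te0 (fun v v0 vm =>
    delta_dev1 mu1 csupp std t1 e0 tau0 tau1 tm dev Kz v0 (le_trans vm m2)).
  rewrite (mr z Kz) (nr z Kz) -EFinD lee_fin => /le_trans; apply.
  by rewrite lerD2l.
have rs z : K z -> sigma <= rho z by move=> Kz; have := hs z; rewrite (mr z Kz) lee_fin.
have rD z : K z -> rho z <= D.
  move=> Kz; have := dtm_le_diam m0 m1 p1 KD mu1 sK Kz.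
  by rewrite (mr z Kz) lee_fin.
have rD' z : K z -> rho' z <= D.
  move=> Kz; have := dtm_le_diam m0 m1 p1 KD nu1 snuK Kz.
  by rewrite (nr z Kz) lee_fin.
have s20 : 0 < sigma / 2 by rewrite divr_gt0.
have rs2 z : K z -> sigma / 2 <= rho z.
  by move=> Kz; have := rs z Kz; lra.
(* The lower bound [sigma] is known for [mu] only; [nu] inherits half of it, because the two
   distances to measure differ by at most [sigma / 2]. *)
have rs2' z : K z -> sigma / 2 <= rho' z.
  by move=> Kz; have := rs z Kz; have := rr z Kz; lra.
have hB : D `^ beta * enorm (y - x) <= D `^ beta * D.
  by rewrite ler_wpM2l ?powR_ge0// KD.
have eta0 : 0 <= c1 * psi * D by rewrite !mulr_ge0// ltW.
have h0 : 0 <= c2 * psi ^+ 2 * D by rewrite !mulr_ge0 ?exprn_ge0// ltW.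
have l0 : 0 < psi * D by exact: mulr_gt0.
apply: le_trans (@fdtm_dist _ m p beta d beta0 mu nu (supp mu) (supp nu) K rho rho'
  (convex_segment_closed cK) (@closed_supp R d mu) sK snu mr nr rL rL' D (sigma / 2)
  (c1 * psi * D) (c2 * psi ^+ 2 * D) (psi * D) s20 eta0 h0 l0 rs2 rs2' rD rD' rr rr'
  nearG u u1 x y Kx Ky _ hB) _.
rewrite lee_fin; exact: (@rate_bound _ beta D sigma psi c1 c2 beta0 D0 sigma0 p0 psi1 c10 c20).
Qed.

End good_event.

(** * Scales and constants *)

Section rate_arith.
Variable R : realType.

(* Coefficients of [psi * D] in [tau_scale] and of [psi ^+ 2 * D] in
   [hole_scale] below; [A] stands for the scale-free [a * D `^ b]. *)
Definition tau_const (A b : R) := 2 * (18 / A) `^ b^-1 + 6.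
Definition hole_const (A b : R) := 4 + (9 / A) `^ b^-1.
(** Below the first bound, [9 * Num.sqrt q] is less than one half, and [18 * Num.sqrt q] and [9 * q]
    are at most 1, so that standardness applies to the radii with these masses. Below the second,
    the distances to measure differ by at most [sigma / 2]. *)
Definition psi_max (A b r : R) := Num.min (20^-1) (r / (2 * tau_const A b)).
(* The last term accounts for small [n], for which [psi > psi_max] and the
   trivial bound [D `^ (beta + 1)] is enough. *)
Definition theorem10_const (m p beta A b r : R) :=
  2 * (rate_const beta r (tau_const A b) (hole_const A b) + 4 + (psi_max A b r)^-1).

Lemma powR_le1 (x e : R) : 0 <= e -> 0 <= x -> x <= 1 -> x `^ e <= 1.
Proof.
move=> e0 x0 x1; have <- : 1 `^ e = 1 :> R by rewrite powR1.
by rewrite ge0_ler_powR ?nnegrE.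
Qed.

Lemma tau_const_gt0 A b : 0 < tau_const A b.
Proof. by rewrite ltr_wpDl// mulr_ge0// powR_ge0. Qed.

Lemma hole_const_ge0 A b : 0 <= hole_const A b.
Proof. by rewrite addr_ge0// powR_ge0. Qed.

Lemma psi_max_gt0 A b r : 0 < r -> 0 < psi_max A b r.
Proof.
by move=> r0; rewrite lt_min invr_gt0 ltr0n/= divr_gt0// mulr_gt0// tau_const_gt0.
Qed.

Lemma rate_const_ge0 (beta r c1 c2 : R) : 0 <= beta -> 0 < r -> 0 <= c1 -> 0 <= c2 ->
  0 <= rate_const beta r c1 c2.
Proof.
move=> b0 r0 c10 c20; rewrite /rate_const.
have C0 : 0 <= rate_exponent beta r c1 c2.
  rewrite /rate_exponent !addr_ge0// !mulr_ge0 ?powR_ge0 ?invr_ge0 ?(ltW r0)//.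
  by rewrite addr_ge0.
by rewrite addr_ge0// mulr_ge0 ?expR_ge0// mulr_ge0.
Qed.

Variables (n d : nat) (a b D : R).
Hypotheses (n2 : (2 <= n)%N) (d0 : (0 < d)%N) (a0 : 0 < a) (b1 : 1 <= b) (D0 : 0 < D).

Definition qrate : R := d%:R ^+ 2 * ln n%:R / n%:R.
Definition psirate : R := qrate `^ (2 * b)^-1.

Let n0 : 0 < n%:R :> R. Proof. by rewrite ltr0n (leq_trans _ n2). Qed.
Let dR : 1 <= d%:R :> R. Proof. by rewrite ler1n. Qed.
Let l2 : 2^-1 <= ln (n%:R : R). Proof. exact: ln_ge_half. Qed.
Let l0 : 0 < ln (n%:R : R). Proof. by apply: lt_le_trans l2; rewrite invr_gt0. Qed.
Let bp : 0 < b. Proof. exact: lt_le_trans b1. Qed.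

Lemma qrate_gt0 : 0 < qrate.
Proof. by rewrite divr_gt0// mulr_gt0// exprn_gt0// (lt_le_trans _ dR). Qed.

Lemma psirate_gt0 : 0 < psirate. Proof. exact/powR_gt0/qrate_gt0. Qed.

(** The factor [d] of the theorem arises here, as a bound for the power 1 / b of [d]. The factor 2
    covers the case [ln n < 1], where [ln n] is still at least one half. *)
Lemma psirate_le : psirate <= 2 * d%:R * (ln n%:R / n%:R `^ (2 * b)^-1).
Proof.
have e0 : 0 <= (2 * b)^-1 by rewrite invr_ge0 mulr_ge0// ltW.
have e1 : (2 * b)^-1 <= 1 by rewrite invf_le1 ?mulr_gt0//; move: b1; lra.
have dd : 0 <= d%:R ^+ 2 :> R by rewrite exprn_ge0.
rewrite /psirate /qrate powRM ?invr_ge0 ?(ltW n0)//; last by rewrite mulr_ge0// ltW.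
rewrite powRM ?(ltW l0)//.
have -> : (n%:R^-1) `^ (2 * b)^-1 = (n%:R `^ (2 * b)^-1)^-1 :> R.
  by rewrite -powR_inv1 ?(ltW n0)// -powRrM mulN1r powRN.
rewrite mulrA; apply: ler_wpM2r; first by rewrite invr_ge0 powR_ge0.
have h1 : (d%:R ^+ 2) `^ (2 * b)^-1 <= d%:R :> R.
  rewrite -powR_mulrn// -powRrM -[X in _ <= X]powRr1//.
  apply: ler_powR => //; rewrite invfM mulrA mulfV// mul1r invf_le1//.
have h2 : ln n%:R `^ (2 * b)^-1 <= 2 * ln n%:R :> R.
  have [ll|ll] := leP 1 (ln n%:R : R).
    apply: (@le_trans _ _ (ln n%:R)); last by lra.
    by rewrite -[X in _ <= X]powRr1 ?(ltW l0)//; exact: ler_powR.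
  apply: (@le_trans _ _ 1); last by move: l2; lra.
  by rewrite powR_le1 ?(ltW l0)// ltW.
apply: (le_trans (ler_pM _ _ h1 h2)); rewrite ?powR_ge0//.
by rewrite mulrA (mulrC d%:R).
Qed.

Lemma inv_n_le : n%:R^-1 <= 2 * qrate.
Proof.
rewrite /qrate mulrA -[X in X <= _]mul1r; apply: ler_wpM2r; first by rewrite invr_ge0 ltW.
have dd : 1 <= d%:R ^+ 2 :> R by rewrite exprn_ege1.
have := l2; nra.
Qed.

Hypothesis psi1 : psirate <= 1.

Lemma qrateE : qrate = psirate `^ (2 * b).
Proof. by rewrite /psirate -powRrM mulVf ?powRr1 ?(ltW qrate_gt0)// mulf_neq0// gt_eqF. Qed.

Lemma qrate_le : qrate <= psirate ^+ 2.
Proof.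
rewrite qrateE -powR_mulrn ?(ltW psirate_gt0)//.
rewrite powRrM -[X in _ <= X]powRr1 ?powR_ge0//.
have x0 : 0 < psirate `^ 2 by apply: powR_gt0; exact: psirate_gt0.
have x1 : psirate `^ 2 <= 1.
  by rewrite powR_le1 ?(ltW psirate_gt0).
by rewrite (ger_powR (a := psirate `^ 2))// x0.
Qed.

Lemma psirate_sq : qrate `^ b^-1 = psirate ^+ 2.
Proof.
rewrite -powR_mulrn ?(ltW psirate_gt0)// /psirate -powRrM; congr (_ `^ _).
by field; rewrite gt_eqF.
Qed.

Lemma psirate_sqrt : Num.sqrt qrate `^ b^-1 = psirate.
Proof.
rewrite -powR12_sqrt ?(ltW qrate_gt0)// -powRrM; congr (_ `^ _).
by field; rewrite gt_eqF.
Qed.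

(** Pulls out [D], so that [a] enters only through its scale-free form. *)
Lemma scaleE (c x : R) : 0 <= c -> 0 <= x ->
  (c * x / a) `^ b^-1 = (c / (a * D `^ b)) `^ b^-1 * x `^ b^-1 * D.
Proof.
move=> c0 x0; have Db : 0 < D `^ b by exact: powR_gt0.
have DE : (D `^ b) `^ b^-1 = D by rewrite -powRrM mulfV ?gt_eqF// powRr1// ltW.
have e0 : 0 <= c / (a * D `^ b) by rewrite divr_ge0// mulr_ge0// ltW.
have -> : c * x / a = c / (a * D `^ b) * x * D `^ b by field; rewrite !gt_eqF.
by rewrite (powRM _ (mulr_ge0 e0 x0) (powR_ge0 _ _)) DE (powRM _ e0 x0).
Qed.

End rate_arith.

Section empirical_support.
Variables (R : realType) (d n : nat) (x : 'I_n -> 'rV[R]_d).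
Hypothesis n0 : (0 < n)%N.

Lemma empirical_setT : empirical x setT = 1%E.
Proof.
rewrite /empirical; under eq_bigr do rewrite diracT.
rewrite sumEFin sumr_const card_ord -EFinM mulVf// pnatr_eq0 -lt0n//.
Qed.

Lemma sample_in_supp k : supp (empirical x) (x k).
Proof.
move=> r r0; rewrite /empirical mule_gt0//.
  by rewrite lte_fin invr_gt0 ltr0n.
rewrite (bigD1 k)//=; apply: (@lt_le_trans _ _ 1%E); first by rewrite lte01.
rewrite diracE mem_set ?leeDl ?sume_ge0//.
by rewrite /eball/= subrr enorm0.
Qed.

Lemma supp_empirical_sub (F : set 'rV[R]_d) : closed F -> (forall k, F (x k)) ->
  supp (empirical x) `<=` F.
Proof.
move=> cF Fx z sz; apply: contrapT => nFz.
have /open_enormP/(_ z nFz)[r r0 hr] : open (~` F) by exact/closed_openC.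
suff e0 : empirical x (eball z r) = 0%E by have := sz r r0; rewrite /= e0 ltxx.
rewrite /empirical big1 ?mule0// => k _.
by rewrite diracE memNset// => zk; exact: (hr _ zk) (Fx k).
Qed.

End empirical_support.

(** * The exceptional events of the sample *)

Section bad_events.
Variables (R : realType) (dO : measure_display) (Omega : measurableType dO)
  (P : probability Omega R) (d n : nat) (mu : probability (borelE R d) R)
  (X : 'I_n -> {RV P >-> borelE R d}).
Hypotheses (iid : iid_sample mu X) (n0 : (0 < n)%N).

Definition outside : set Omega := \big[setU/set0]_(k < n) (X k @^-1` (~` supp mu)).

Let mS : @measurable _ (borelE R d) (~` supp mu).
Proof. by apply: measurableC; apply: measurable_closed_borelE; exact: closed_supp. Qed.

Lemma measurable_outside : measurable outside.
Proof. by apply: bigsetU_measurable => k _; exact: measurable_sample. Qed.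

Lemma outside0 : P outside = 0%E.
Proof.
apply/eqP; rewrite -measure_le0.
apply: (le_trans (measure_bigsetU_le _ _ _)) => [k|]; first exact: measurable_sample.
by rewrite big1// => k _; apply: etrans (law_sample iid k mS) _; exact: supp_conull.
Qed.

Lemma not_outside w k : ~ outside w -> supp mu (X k w).
Proof.
move=> nw; apply: contrapT => ns; apply: nw.
by rewrite /outside (bigD1 k)//=; left.
Qed.

Variables (I : finType) (c : I -> 'rV[R]_d) (N : nat) (eps r t E : R).

Let emp w := empirical (fun k => X k w).

Definition deviates (i : I) (j : nat) : set Omega :=
  let B := eball (c i) (j%:R * eps) in
  [set w | (mu B + t%:E <= emp w B)%E] `|` [set w | (emp w B + t%:E <= mu B)%E].

(** No mass is guaranteed around a net point far from the support, and the event is then empty.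
    Otherwise the ball of radius [eps + r] contains a ball of radius [r] centred in the support,
    whose mass standardness bounds from below. *)
Definition misses (i : I) : set Omega :=
  if `[< exists2 z, supp mu z & enorm (z - c i) <= eps >] then
    \bigcap_(k in [set: 'I_n]) (X k @^-1` (~` eball (c i) (eps + r)))
  else set0.

Definition bad : set Omega :=
  \big[setU/set0]_(i : I) (\big[setU/set0]_(j < N) deviates i j `|` misses i).

Lemma measurable_deviates i j : measurable (deviates i j).
Proof.
apply: measurableU.
  exact: (measurable_dev_upper mu X n0 t (measurable_eball _ _)).
exact: (measurable_dev_lower mu X n0 t (measurable_eball _ _)).
Qed.

Lemma measurable_misses i : measurable (misses i).
Proof.
rewrite /misses; case: asboolP => // _.
apply: fin_bigcap_measurable => [|k _]; first exact: finite_finset.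
by apply: measurable_sample; apply: measurableC; exact: measurable_eball.
Qed.

Lemma measurable_bad : measurable bad.
Proof.
apply: bigsetU_measurable => i _; apply: measurableU; last exact: measurable_misses.
by apply: bigsetU_measurable => j _; exact: measurable_deviates.
Qed.

Lemma bad_le (a b : R) : standard a b mu -> 0 < r -> r <= a `^ (- b^-1) ->
  0 < t -> t <= 1 ->
  expR (- (n%:R * t ^+ 2 / 8)) <= E -> expR (- (n%:R * (a * r `^ b))) <= E ->
  (P bad <= (#|I|%:R * (N%:R * (2 * E) + E))%:E)%E.
Proof.
move=> std r0 r1 t0 t1 tE rE.
have dev i j : (P (deviates i j) <= (2 * E)%:E)%E.
  have mB := measurable_eball (c i) (j%:R * eps).
  apply: (@le_trans _ _ ((expR (- (n%:R * t ^+ 2 / 8)))%:E + (expR (- (n%:R * t ^+ 2 / 8)))%:E)%E).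
    apply: le_trans (measureU2 _ _ _) _ => /=.
    - exact: (measurable_dev_upper mu X n0 t mB).
    - exact: (measurable_dev_lower mu X n0 t mB).
    apply: leeD; first exact: (chernoff_upper iid n0 mB t0 t1).
    exact: (chernoff_lower iid n0 mB t0 t1).
  by rewrite -EFinD lee_fin; lra.
have mis i : (P (misses i) <= E%:E)%E.
  rewrite /misses; case: asboolP => [[z sz zc]|_]; last first.
    by rewrite measure0 lee_fin (le_trans _ tE)// expR_ge0.
  apply: (@le_trans _ _ (expR (- (n%:R * (a * r `^ b))))%:E); last by rewrite lee_fin.
  apply: (no_hit_le iid); first exact: measurable_eball.
  apply: (le_trans (std z r sz r0 r1)); apply: le_eball.
  by rewrite enormB lerD2r.
apply: (le_trans (measure_bigsetU_le _ _ _)) => [i|].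
  apply: measurableU; last exact: measurable_misses.
  by apply: bigsetU_measurable => j _; exact: measurable_deviates.
apply: (@le_trans _ _ (\sum_(i : I) (N%:R * (2 * E) + E)%:E)%E); last first.
  by rewrite sumEFin sumr_const lee_fin -[leLHS]mulr_natl.
apply: lee_sum => i _; apply: le_trans (measureU2 _ _ _) _ => /=.
- by apply: bigsetU_measurable => j _; exact: measurable_deviates.
- exact: measurable_misses.
rewrite EFinD; apply: leeD; last exact: mis.
apply: le_trans (measure_bigsetU_le P _ (fun j : 'I_N => measurable_deviates i j)) _.
apply: (@le_trans _ _ (\sum_(j < N) (2 * E)%:E)%E); first by apply: lee_sum => j _; exact: dev.
by rewrite sumEFin sumr_const card_ord lee_fin -[leLHS]mulr_natl.
Qed.

Lemma not_bad_dev w i j : ~ bad w -> (j < N)%N ->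
  let B := eball (c i) (j%:R * eps) in
  (emp w B <= mu B + t%:E)%E /\ (mu B <= emp w B + t%:E)%E.
Proof.
move=> nb jN B; have nd : ~ deviates i j w.
  move=> h; apply: nb; rewrite /bad (bigD1 i)//=; left; left.
  by rewrite (bigD1 (Ordinal jN))//=; left.
split; rewrite leNgt; apply/negP => /ltW h; apply: nd; [by left|by right].
Qed.

Lemma not_bad_hit w z i : ~ bad w -> supp mu z -> enorm (z - c i) <= eps ->
  exists2 g, supp (emp w) g & enorm (g - z) <= 2 * eps + r.
Proof.
move=> nb sz zi; have nm : ~ misses i w.
  by move=> h; apply: nb; rewrite /bad (bigD1 i)//=; left; right.
have [k hk] : exists k, eball (c i) (eps + r) (X k w).
  apply: contrapT => nk; apply: nm; rewrite /misses; case: asboolP => [_|[]]; last by exists z.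
  by move=> k _ /= hk; apply: nk; exists k.
exists (X k w); first exact: sample_in_supp.
have hz := enorm_dist (c i) (X k w) z; have := hk; rewrite /eball/= (enormB (c i)) => hk'.
by rewrite (enormB (c i)) in hz; lra.
Qed.

End bad_events.

Section scales.
Variables (R : realType) (n d : nat) (a b D sigma : R).
Hypotheses (n2 : (2 <= n)%N) (d0 : (0 < d)%N) (a0 : 0 < a) (b1 : 1 <= b) (D0 : 0 < D).
Hypothesis sigma0 : 0 < sigma.
Notation A := (a * D `^ b).
Notation q := (qrate R n d).
Notation psi := (psirate n d b).
Hypothesis psi_small : psi <= psi_max A b (sigma / D).

(** With the factor 9, [n * dev_width ^+ 2 / 8] is 81 / 8 times [d ^ 2 * ln n], which exceeds the
    exponent of [grid_count]. The next two radii are those at which standardness guarantees the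
    masses [2 * dev_width] and [9 * q]. *)
Definition dev_width : R := 9 * Num.sqrt q.
Definition tau_width : R := (18 * Num.sqrt q / a) `^ b^-1.
Definition hole_width : R := (9 * q / a) `^ b^-1.

Let q0 : 0 < q. Proof. exact: qrate_gt0. Qed.
Let p0 : 0 < psi. Proof. exact: psirate_gt0. Qed.
Let sq0 : 0 < Num.sqrt q. Proof. by rewrite sqrtr_gt0. Qed.
Let n0 : 0 < n%:R :> R. Proof. by rewrite ltr0n (leq_trans _ n2). Qed.
Let bp : 0 < b. Proof. exact: lt_le_trans b1. Qed.

Let p20 : psi <= 20^-1.
Proof. by move: psi_small; rewrite /psi_max le_min => /andP[]. Qed.

Let p1 : psi <= 1. Proof. by move: p20; lra. Qed.

Let qp : q <= psi ^+ 2. Proof. exact: qrate_le. Qed.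

Let q1 : q <= 400^-1.
Proof. by apply: (le_trans qp); move: p20 p0; rewrite expr2; nra. Qed.

Let sq1 : Num.sqrt q <= 20^-1.
Proof.
apply: le_trans p20; rewrite -(ger0_norm (ltW p0)) -sqrtr_sqr.
by apply: ler_wsqrtr.
Qed.

Lemma dev_width_gt0 : 0 < dev_width. Proof. by rewrite mulr_gt0. Qed.

Lemma dev_width_lt : dev_width < 2^-1.
Proof. by move: sq1; rewrite /dev_width; lra. Qed.

Lemma radius_le (c x : R) : 0 <= c * x -> c * x <= 1 -> (c * x / a) `^ b^-1 <= a `^ (- b^-1).
Proof.
move=> cx0 cx1.
have -> : a `^ (- b^-1) = (a^-1) `^ b^-1 by rewrite -(powR_inv1 (ltW a0)) -powRrM mulN1r.
rewrite ge0_ler_powR ?nnegrE ?invr_ge0 ?(ltW bp) ?divr_ge0 ?(ltW a0)//.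
by rewrite -[leRHS]mul1r ler_wpM2r// invr_ge0 ltW.
Qed.

Lemma mass_radius (y : R) : 0 <= y -> a * ((y / a) `^ b^-1) `^ b = y.
Proof.
move=> y0; rewrite -powRrM mulVf ?gt_eqF// powRr1 ?divr_ge0 ?(ltW a0)//.
by field; rewrite gt_eqF.
Qed.

Lemma tau_width_gt0 : 0 < tau_width. Proof. by rewrite powR_gt0 ?divr_gt0 ?mulr_gt0. Qed.

Lemma tau_width_le : tau_width <= a `^ (- b^-1).
Proof.
by apply: radius_le; [rewrite mulr_ge0// ltW|move: sq1; lra].
Qed.

Lemma tau_width_mass : dev_width < a * tau_width `^ b.
Proof.
rewrite mass_radius; last by rewrite mulr_ge0// ltW.
by rewrite /dev_width; move: sq0; lra.
Qed.

Lemma hole_width_gt0 : 0 < hole_width. Proof. by apply/powR_gt0/divr_gt0 => //; exact: mulr_gt0. Qed.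

Lemma hole_width_le : hole_width <= a `^ (- b^-1).
Proof.
by apply: radius_le; [rewrite mulr_ge0// ltW|move: q1; lra].
Qed.

Lemma grid_width_le : D / n%:R <= 2 * psi ^+ 2 * D.
Proof.
rewrite mulrC ler_wpM2r ?(ltW D0)//; apply: (le_trans (inv_n_le _ n2 d0)).
by rewrite ler_wpM2l.
Qed.

Lemma tau_scale : 2 * tau_width + 3 * (D / n%:R) <= tau_const A b * psi * D.
Proof.
rewrite /tau_width (scaleE a0 b1 D0)//; [|exact: ltW..].
rewrite psirate_sqrt// /tau_const.
have h : psi ^+ 2 * D <= psi * D.
  by rewrite ler_wpM2r ?(ltW D0)// expr2 ger_pMl.
have := grid_width_le; move: (D / _) => e; nra.
Qed.

Lemma hole_scale : 2 * (D / n%:R) + hole_width <= hole_const A b * psi ^+ 2 * D.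
Proof.
rewrite /hole_width (scaleE a0 b1 D0)//; last exact: ltW.
rewrite psirate_sq// /hole_const.
have := grid_width_le; move: (D / _) => e; nra.
Qed.

Lemma tau_scale_le : tau_const A b * psi * D <= sigma / 2.
Proof.
have c0 := tau_const_gt0 A b.
have : psi <= sigma / D / (2 * tau_const A b).
  by move: psi_small; rewrite /psi_max le_min => /andP[].
rewrite ler_pdivlMr ?mulr_gt0// ler_pdivlMr//; lra.
Qed.

Let qn : n%:R * q = d%:R ^+ 2 * ln n%:R.
Proof. by rewrite /qrate; field; rewrite gt_eqF. Qed.

Lemma dev_exponent :
  expR (- (n%:R * dev_width ^+ 2 / 8)) <= expR (- (9 * d%:R ^+ 2 * ln (n%:R : R))).
Proof.
rewrite ler_expR lerN2 -mulrA -qn /dev_width exprMn sqr_sqrtr ?(ltW q0)//.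
have : 0 <= n%:R * q by rewrite mulr_ge0 ?(ltW q0).
rewrite expr2; lra.
Qed.

Lemma hole_exponent :
  expR (- (n%:R * (a * hole_width `^ b))) <= expR (- (9 * d%:R ^+ 2 * ln (n%:R : R))).
Proof.
rewrite ler_expR lerN2 mass_radius; last by rewrite mulr_ge0// ltW.
by rewrite -mulrA -qn; lra.
Qed.

(** By [grid_count] the left-hand side is at most 2 / n, and 1 / n <= 2 * q <= 2 * psi ^ 2. *)
Lemma bad_mass_le :
  #|{: {ffun 'I_d -> 'I_(2 * n * d).+1}}|%:R *
    ((n + 2)%:R * (2 * expR (- (9 * d%:R ^+ 2 * ln (n%:R : R)))) +
     expR (- (9 * d%:R ^+ 2 * ln (n%:R : R)))) <= 4 * psi.
Proof.
have := grid_count R n2 d0; set G := #|_|%:R; set x := 9 * _ * _ => gc.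
have e0 : 0 < expR x by exact: expR_gt0.
have G0 : 0 <= G by rewrite /G.
have N2 : 2 <= (n + 2)%:R :> R by rewrite ler_nat leq_addl.
rewrite expRN.
have h : G * ((n + 2)%:R * (2 * (expR x)^-1) + (expR x)^-1) <= 2 * n%:R^-1.
  rewrite -(ler_pM2r e0) -(ler_pM2r n0).
  have -> : G * ((n + 2)%:R * (2 * (expR x)^-1) + (expR x)^-1) * expR x * n%:R =
    G * (n + 2)%:R * 2 * n%:R + G * n%:R by field; rewrite gt_eqF.
  have -> : 2 * n%:R^-1 * expR x * n%:R = 2 * expR x by field; rewrite gt_eqF.
  have : G * n%:R <= G * (n + 2)%:R * 2 * n%:R.
    rewrite ler_wpM2r ?(ltW n0)// -mulrA ler_peMr//; lra.
  lra.
apply: (le_trans h); have := inv_n_le R n2 d0; have := qp.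
have : psi ^+ 2 <= psi by rewrite expr2 ger_pMl.
lra.
Qed.

End scales.

(** * Integration over the sample *)

Section main.
Variables (R : realType) (d : nat) (m p beta a b sigma : R) (K : set 'rV[R]_d).
Variable mu : probability (borelE R d) R.
Hypotheses (m0 : 0 < m) (m2 : m <= 2^-1) (p1 : 1 <= p) (beta1 : 1 <= beta).
Hypotheses (kK : compact K) (cK : convex_set K).
Hypotheses (a0 : 0 < a) (b1 : 1 <= b) (sigma0 : 0 < sigma).
Hypothesis mod_ : model m p K a b sigma mu.
Variables (dO : measure_display) (Omega : measurableType dO) (P : probability Omega R).
Variables (n : nat) (X : 'I_n -> {RV P >-> borelE R d}).
Hypotheses (iid : iid_sample mu X) (n2 : (2 <= n)%N).
Notation D := (diam K).
Notation psi := (psirate n d b).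
Notation A := (a * D `^ b).
Notation B := (D `^ beta * D).

Let emp w := empirical (fun k => X k w).
Let f w := ereal_sup
  [set `|fdtm m p beta mu x y - fdtm m p beta (emp w) x y|%E | x in K & y in K].

Let n0 : (0 < n)%N. Proof. exact: leq_trans n2. Qed.
Let D0 : 0 < D. Proof. exact: (diam_gt0 m0 m2 p1 kK sigma0 mod_). Qed.
Let d0 : (0 < d)%N. Proof. exact: (dim_gt0 m0 m2 p1 sigma0 mod_). Qed.
Let sK : supp mu `<=` K. Proof. by case: mod_. Qed.
Let B0 : 0 <= B. Proof. by rewrite mulr_ge0 ?powR_ge0// ltW. Qed.

(** The supremum of an empty set would be -oo; a point of the support provides a pair in [K]. *)
Lemma sup_dist_ge0 w : (0 <= f w)%E.
Proof.
have [s ss] := supp_nonempty mu; have Ks := sK ss.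
apply: (@le_trans _ _ `|fdtm m p beta mu s s - fdtm m p beta (emp w) s s|%E) => //.
by apply: ereal_sup_ubound; exists s => //; exists s.
Qed.

Let supp_emp w : ~ outside mu X w -> supp (emp w) `<=` supp mu.
Proof.
move=> nw; apply: supp_empirical_sub => [|k]; first exact: closed_supp.
exact: not_outside nw.
Qed.

Lemma sup_dist_le_diam w : ~ outside mu X w -> (f w <= B%:E)%E.
Proof.
move=> nw; apply: ge_ereal_sup => _ [x Kx [y Ky <-]].
apply: (fdtm_dist_le_diam m0 m2 p1 beta1 kK cK sigma0 mod_) => //.
  exact: empirical_setT.
exact: subset_trans (supp_emp nw) sK.
Qed.

Variable x0 : 'rV[R]_d.
Hypothesis Kx0 : K x0.

Let bad_ := bad mu X (@grid R d n x0 D) (n + 2) (D / n%:R) (hole_width n d a b)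
  (dev_width R n d).

Let RC := rate_const beta (sigma / D) (tau_const A b) (hole_const A b).

Lemma sup_dist_le_rate w : psi <= psi_max A b (sigma / D) ->
  ~ outside mu X w -> ~ bad_ w -> (f w <= (RC * psi * B)%:E)%E.
Proof.
move=> ps nw nb; apply: ge_ereal_sup => _ [x Kx [y Ky <-]].
have psi1 : psi <= 1.
  move: ps; rewrite /psi_max le_min => /andP[h _]; apply: (le_trans h).
  by rewrite invf_le1 ?ler1n.
have e0 : 0 < D / n%:R by rewrite divr_gt0// ltr0n.
have emp1 := empirical_setT (fun k => X k w) n0.
have gr x' : K x' -> exists i, enorm (x' - @grid R d n x0 D i) <= D / n%:R.
  by move=> Kx'; apply: gridP => //; exact: le_diam.
apply: (fdtm_good_event m0 m2 p1 beta1 kK cK sigma0 mod_ emp1 (supp_emp nw)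
  (dev_width_lt n2 d0 b1 ps) e0 (tau_width_gt0 b n2 d0 a0)
  (tau_width_le n2 d0 a0 b1 ps) (tau_width_mass n2 d0 a0 b1)
  _ _ (psirate_gt0 b n2 d0) psi1 (ltW (tau_const_gt0 _ _)) (hole_const_ge0 _ _)
  (tau_scale n2 d0 a0 b1 D0 ps) (tau_scale_le D0 ps) Kx Ky).
  move=> x' Kx'; have [i xi] := gr x' Kx'; exists (grid x0 D i) => // j.
  (* For [j >= n + 2] the radius is at least [D + 2 * (D / n)], and the centre is within [D / n] of
     a point of [K], so the ball contains [K] and both masses are 1. Hence finitely many radii
     suffice. *)
  have [jn|jn] := ltnP j (n + 2); first exact: (not_bad_dev i nb jn).
  have full : K `<=` eball (grid x0 D i) (j%:R * (D / n%:R)).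
    move=> z Kz; rewrite /eball/=.
    have h1 := enorm_dist x' (grid x0 D i) z; rewrite (enormB (grid x0 D i) x') in h1.
    have h2 : enorm (x' - z) <= D by exact: le_diam.
    have h3 : (n + 2)%:R * (D / n%:R) <= j%:R * (D / n%:R).
      by rewrite ler_wpM2r ?(ltW e0)// ler_nat.
    have h4 : (n + 2)%:R * (D / n%:R) = D + 2 * (D / n%:R).
      by rewrite natrD mulrDl; congr (_ + _); field; rewrite pnatr_eq0 -lt0n.
    by move: xi h1 h2 h3 h4 e0; move: (D / n%:R) => e; lra.
  have mu1 : mu (eball (grid x0 D i) (j%:R * (D / n%:R))) = 1%E.
    apply: (mass_full (measurable_eball _ _) (probability_setT mu)).
    exact: subset_trans full.
  have nu1 : (emp w : {measure set (borelE R d) -> \bar R}) (eball (grid x0 D i) (j%:R * (D / n%:R))) = 1%E.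
    apply: (@mass_full R d (emp w) _ (measurable_eball _ _) emp1).
    exact: subset_trans (supp_emp nw) (subset_trans sK full).
  have dw : (0 <= (dev_width R n d)%:E)%E by rewrite lee_fin ltW// dev_width_gt0.
  by split; rewrite mu1 nu1 leeDl.
move=> z sz; have [i zi] := gr z (sK sz).
have [g sg gz] := not_bad_hit n0 nb sz zi.
exists g => //; apply: (le_trans gz).
exact: (hole_scale n2 d0 a0 b1 D0 ps).
Qed.

Lemma prob_bad_le : psi <= psi_max A b (sigma / D) -> (P bad_ <= (4 * psi)%:E)%E.
Proof.
move=> ps; have [_ std _ _] := mod_.
apply: le_trans (bad_le iid n0 _ _ _ std (hole_width_gt0 b n2 d0 a0)
  (hole_width_le n2 d0 a0 b1 ps) (dev_width_gt0 R n2 d0) _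
  (dev_exponent R n2 d0) (hole_exponent n2 d0 a0 b1)) _.
  by have := dev_width_lt n2 d0 b1 ps; lra.
by rewrite lee_fin; exact: (bad_mass_le n2 d0 b1 ps).
Qed.

(** Almost surely the integrand is at most the rate plus [B] on the bad event, which is a measurable
    bound. When [psi] is at least [psi_max], the bound [B] alone is enough, as the ratio of [psi] to
    [psi_max] is then at least 1. *)
Lemma expected_sup_dist_le :
  (\int[P]_w f w <= ((RC + 4 + (psi_max A b (sigma / D))^-1) * psi * B)%:E)%E.
Proof.
have int_cst (c : R) : (\int[P]_w (cst c%:E) w = c%:E)%E.
  by rewrite integral_cst// -[RHS]mule1; congr (_ * _)%E; exact: probability_setT.
have p0 : 0 < psi by exact: psirate_gt0.
have r0 : 0 < sigma / D by exact: divr_gt0.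
have M0 : 0 < psi_max A b (sigma / D) by exact: psi_max_gt0.
have RC0 : 0 <= RC.
  by rewrite rate_const_ge0 ?hole_const_ge0 ?(ltW (tau_const_gt0 _ _))// (le_trans _ beta1).
have [ps|/ltW ps] := leP psi (psi_max A b (sigma / D)); last first.
  apply: (@le_trans _ _ (\int[P]_w (cst B%:E) w)%E).
    apply: (ae_ge0_le_lower_integral measurableT (measurable_outside mu X) (outside0 iid)).
    - exact: measurable_cst.
    - by move=> w _; exact: sup_dist_ge0.
    - by move=> w _; rewrite /cst/= lee_fin.
    - by move=> w _; exact: sup_dist_le_diam.
  rewrite int_cst lee_fin ler_peMl//.
  rewrite mulrDl; apply: (@le_trans _ _ ((psi_max A b (sigma / D))^-1 * psi)).
    by rewrite ler_pdivlMl// mulr1.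
  rewrite lerDr; apply: mulr_ge0; [exact: addr_ge0|exact: ltW].
have mb : measurable bad_ by exact: measurable_bad.
have c0 : 0 <= RC * psi * B by rewrite mulr_ge0 ?(mulr_ge0 RC0) ?(ltW p0).
have mi : measurable_fun setT (fun w => (\1_bad_ w)%:E : \bar R).
  by apply/measurable_EFinP; exact: measurable_indic.
have mB : measurable_fun setT (fun w => (B%:E * (\1_bad_ w)%:E)%E : \bar R).
  exact: measurable_funeM.
apply: (@le_trans _ _ (\int[P]_w ((RC * psi * B)%:E + B%:E * (\1_bad_ w)%:E))%E).
  apply: (ae_ge0_le_lower_integral measurableT (measurable_outside mu X) (outside0 iid)).
  - by apply: emeasurable_funD => //; exact: measurable_cst.
  - by move=> w _; exact: sup_dist_ge0.
  - by move=> w _; rewrite adde_ge0 ?mule_ge0 ?lee_fin.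
  - move=> w _ nw; have [bw|nb] := pselect (bad_ w).
      apply: (le_trans (sup_dist_le_diam nw)).
      by rewrite indicE mem_set// mule1 leeDr// lee_fin.
    by rewrite indicE memNset// mule0 adde0; exact: sup_dist_le_rate.
have B1 w : (0 <= B%:E * (\1_bad_ w)%:E)%E by rewrite mule_ge0 ?lee_fin.
rewrite ge0_integralD// int_cst ge0_integralZl//.
rewrite integral_indic// setIT.
have -> : ((RC + 4 + (psi_max A b (sigma / D))^-1) * psi * B) =
  RC * psi * B + B * (4 * psi) + (psi_max A b (sigma / D))^-1 * psi * B by ring.
rewrite EFinD EFinD -[leLHS]adde0; apply: leeD; last first.
  by rewrite lee_fin mulr_ge0// mulr_ge0 ?invr_ge0 ?(ltW p0) ?(ltW M0).
by apply: leeD2l; rewrite (EFinM B); apply: lee_wpmul2l; [rewrite lee_fin|exact: prob_bad_le].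
Qed.

End main.

Theorem theorem10 (R : realType) :
  exists C : R -> R -> R -> R -> R -> R -> R,
  forall (m p beta : R), 0 < m -> m <= 1 -> 1 <= p -> 1 <= beta ->
  forall (d : nat) (K : set 'rV[R]_d), compact K -> convex_set K ->
  forall (a b sigma : R), 0 < a -> 1 <= b -> 0 < sigma ->
  forall mu : probability (borelE R d) R, model m p K a b sigma mu ->
  m <= 2^-1 ->
  forall n : nat, m^-1 <= n%:R ->
  forall (dO : measure_display) (Omega : measurableType dO)
    (P : probability Omega R) (X : 'I_n -> {RV P >-> borelE R d}),
  iid_sample mu X ->
  (\int[P]_w ereal_sup
     [set `|fdtm m p beta mu x y
            - fdtm m p beta (empirical (fun k => X k w)) x y| | x in K & y in K]
   <= (C m p beta (a * diam K `^ b)%R b (sigma / diam K)%R * d%:R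
       * diam K `^ (beta + 1) * (ln n%:R / n%:R `^ (2 * b)^-1))%R%:E)%E.
Proof.
exists (@theorem10_const R) => m p beta m0 _ p1 beta1 d K kK cK a b sigma a0 b1 sigma0.
move=> mu mod_ m2 n mn dO Omega P X iid.
(* [m <= 1 / 2] and [n >= 1 / m] give [n >= 2], which keeps [ln n] away from 0. *)
have n2 : (2 <= n)%N.
  rewrite -(ler_nat R); apply: le_trans mn.
  by rewrite -[leLHS]invrK lef_pV2 ?posrE ?invr_gt0.
have D0 := diam_gt0 m0 m2 p1 kK sigma0 mod_.
have d0 := dim_gt0 m0 m2 p1 sigma0 mod_.
have [s ss] := supp_nonempty mu.
have Ks : K s by case: mod_ => sK _ _ _; exact: sK.
apply: (le_trans (expected_sup_dist_le m0 m2 p1 beta1 kK cK a0 b1 sigma0 mod_ iid n2 Ks)).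
rewrite lee_fin /theorem10_const powRD ?(gt_eqF D0)// ?implybT// powRr1 ?(ltW D0)//.
have := psirate_le n2 d0 b1; move: (psirate _ _ _) (ln _ / _) => psi l psil.
set W := _ + 4 + _; have W0 : 0 <= W.
  have r0 : 0 < sigma / diam K by exact: divr_gt0.
  rewrite addr_ge0 ?invr_ge0 ?(ltW (psi_max_gt0 _ _ r0))// addr_ge0//.
  by rewrite rate_const_ge0 ?hole_const_ge0 ?(ltW (tau_const_gt0 _ _))// (le_trans _ beta1).
have -> : 2 * W * d%:R * (diam K `^ beta * diam K) * l =
  W * (2 * d%:R * l) * (diam K `^ beta * diam K) by ring.
by rewrite ler_wpM2r ?mulr_ge0 ?powR_ge0 ?(ltW D0)// ler_wpM2l.
Qed.
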